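(* Let $d\in\mathbb{N}$, $0<s<\infty$ and $0<r\le\infty$. (i) If $v_n\in\{b_n,x_n\}$ (Bernstein or Weyl numbers), then $$\lim_{n\to\infty}\frac{v_n\big(id:\mathcal{A}^{s,r}_{\mathrm{mix}}(\mathbb{T}^d)\to L_2(\mathbb{T}^d)\big)}{n^{-s-\frac12}(\ln n)^{s(d-1)}}=\sqrt{2s+1}\,\bigg(\frac{2^d}{(d-1)!}\bigg)^s .$$ (ii) If $u_n\in\{a_n,d_n\}$ (approximation or Kolmogorov numbers), then $$\lim_{n\to\infty}\frac{u_n\big(id:\mathcal{A}^{s,r}_{\mathrm{mix}}(\mathbb{T}^d)\to L_2(\mathbb{T}^d)\big)}{n^{-s}(\ln n)^{s(d-1)}}=\bigg(\frac{2s}{2s+1}\bigg)^s\bigg(\frac{2^d}{(d-1)!}\bigg)^s .$$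
   Context: $\mathbb{T}^d$ is the $d$-dimensional torus ($[0,2\pi]^d$ with endpoints identified) with the probability measure $(2\pi)^{-d}d\boldsymbol{x}$ (so $\|f|L_2(\mathbb{T}^d)\|^2=(2\pi)^{-d}\int|f|^2d\boldsymbol{x}=\sum_{\boldsymbol{k}}|\hat f(\boldsymbol{k})|^2$); $\hat f(\boldsymbol{k})=(2\pi)^{-d}\int_{\mathbb{T}^d}f(\boldsymbol{x})e^{-i\boldsymbol{k}\boldsymbol{x}}\,d\boldsymbol{x}$, $\boldsymbol{k}\in\mathbb{Z}^d$. For a weight $\omega=(\omega(\boldsymbol{k}))_{\boldsymbol{k}\in\mathbb{Z}^d}$ of positive numbers, $\mathcal{A}_\omega(\mathbb{T}^d)$ is the space of all $f\in L_1(\mathbb{T}^d)$ with $\|f|\mathcal{A}_\omega(\mathbb{T}^d)\|:=\sum_{\boldsymbol{k}\in\mathbb{Z}^d}\omega(\boldsymbol{k})|\hat f(\boldsymbol{k})|<\infty$. $\mathcal{A}^{s,r}_{\mathrm{mix}}(\mathbb{T}^d):=\mathcal{A}_{\omega_{s,r}}(\mathbb{T}^d)$ with $\omega_{s,r}(\boldsymbol{k})=\prod_{i=1}^d(1+|k_i|^r)^{s/r}$ if $0<r<\infty$, and $\omega_{s,\infty}(\boldsymbol{k})=\prod_{i=1}^d\max(1,|k_i|)^s$. $id$ denotes the identity (embedding) operator. For a continuous linear operator $T:X\to Y$ between Banach spaces and $n\in\mathbb{N}$: approximation numbers $a_n(T)=\inf\{\|T-A\|: A\in\mathcal{L}(X,Y),\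 \mathrm{rank}(A)<n\}$; Kolmogorov numbers $d_n(T)=\inf_{L_{n-1}}\sup_{\|x|X\|\le1}\inf_{y\in L_{n-1}}\|Tx-y|Y\|$, infimum over all $(n-1)$-dimensional subspaces $L_{n-1}$ of $Y$; Weyl numbers $x_n(T)=\sup\{a_n(TA): A\in\mathcal{L}(\ell_2,X),\ \|A\|\le1\}$; Bernstein numbers $b_n(T)=\sup_{L_n}\inf_{x\in L_n,\,0<\|x|X\|\le1}\|Tx|Y\|/\|x|X\|$, supremum over all $n$-dimensional subspaces $L_n$ of $X$. *)

(* Defs.v *)
From HB Require Import structures.
From mathcomp Require Import all_boot all_order all_algebra.
From mathcomp Require Import complex.
From mathcomp Require Import all_classical all_reals all_analysis.
From mathcomp Require Import measurable_realfun.

Set Implicit Arguments.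
Unset Strict Implicit.
Unset Printing Implicit Defensive.
Import Order.TTheory GRing.Theory Num.Theory.
Import numFieldNormedType.Exports.

Local Open Scope classical_set_scope.
Local Open Scope ring_scope.
Local Open Scope quotient_scope.

(* s-numbers.  A normed space X is presented by an ambient complex vector
   space E and an extended norm nX : E -> \bar R; X itself is the set of the
   vectors of finite norm, normed by nX. This makes every operator norm and
   s-number an element of \bar R and allows an embedding X -> Y of two spaces
   with the same ambient space to be the identity function of E. Operators
   X -> Y are functions E -> F of which only the values on X matter. *)
Section snumbers.
Context {R : realType}.

Section space.
Context {E : lmodType R[i]}.
Implicit Types (nX : E -> \bar R) (L : set E).

Definition nspace nX : set E := [set x | (nX x < +oo)%E].

Definition unit_ball nX : set E := [set x | (nX x <= 1)%E].

Definition subspace_dim n L :=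
  exists v : 'I_n -> E,
    (forall c : 'I_n -> R[i], \sum_i c i *: v i = 0 -> forall i, c i = 0) /\
    L = [set \sum_i c i *: v i | c in [set: 'I_n -> R[i]]].

End space.

Section operator.
Context {E F : lmodType R[i]}.
Variables (nX : E -> \bar R) (nY : F -> \bar R).
Implicit Types (A T : E -> F).

Definition bounded_operator A :=
  (forall a x y, nspace nX x -> nspace nX y ->
     A (a *: x + y) = a *: A x + A y) /\
  exists M : R, forall x, nspace nX x -> (nY (A x) <= M%:E * nX x)%E.

Definition opnorm A : \bar R := ereal_sup [set nY (A x) | x in unit_ball nX].

Definition rank_lt A n :=
  exists2 m, (m < n)%N & subspace_dim m (A @` nspace nX).

Definition approximation_number T n : \bar R :=
  ereal_inf [set opnorm (fun x => T x - A x)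
            | A in [set A | bounded_operator A /\ rank_lt A n]].

Definition kolmogorov_number T n : \bar R :=
  ereal_inf [set
    ereal_sup [set ereal_inf [set nY (T x - y) | y in L] | x in unit_ball nX]
    | L in [set L : set F | subspace_dim n.-1 L /\ L `<=` nspace nY]].

Definition bernstein_number T n : \bar R :=
  ereal_sup [set
    ereal_inf [set (nY (T x) / nX x)%E
              | x in L `&` [set x | (0 < nX x <= 1)%E]]
    | L in [set L : set E | subspace_dim n L /\ L `<=` nspace nX]].

End operator.

Definition l2_norm (x : nat -> R[i]) : \bar R :=
  ((\sum_(0 <= k <oo) (Normc.normc (x k) ^+ 2)%:E) `^ 2^-1)%E.

Definition weyl_number {E F : lmodType R[i]} (nX : E -> \bar R)
    (nY : F -> \bar R) (T : E -> F) n : \bar R :=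
  ereal_sup [set approximation_number l2_norm nY (T \o A) n
            | A in [set A : (nat -> R[i]) -> E |
                bounded_operator l2_norm nX A /\ (opnorm l2_norm nX A <= 1)%E]].

End snumbers.


(* R[i] with the Borel sigma-algebra of R * R. *)
Section complex_measurable.
Context {R : realType}.

HB.instance Definition _ := isPointed.Build R[i] 0.

Definition reim (z : R[i]) : (R * R)%type :=
  (complex.Re z, complex.Im z).

HB.instance Definition _ :=
  Measurable.copy R[i] (g_sigma_algebra_preimageType reim).

Lemma measurable_complexP d (T : measurableType d) (f : T -> R[i]) :
  measurable_fun [set: T] f <->
  measurable_fun [set: T] (fun x => complex.Re (f x)) /\
  measurable_fun [set: T] (fun x => complex.Im (f x)).
Proof.
transitivity (measurable_fun [set: T] (reim \o f)).
  split=> [mf|mf] _ B.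
    move=> mB; apply: (mf _ (reim @^-1` B)) => //.
    by exists B => //; rewrite setTI.
  by case=> A mA <-; rewrite setTI; exact: (mf _ A).
split=> [mf|[mr mi]].
  have := measurableT_comp measurable_snd mf.
  by have := measurableT_comp measurable_fst mf; split.
exact: measurable_fun_pair.
Qed.

End complex_measurable.

(* The complex vector space of the measurable functions T -> R[i] modulo
   equality mu-almost everywhere. *)
Section L0.
Context d (T : measurableType d) (R : realType).
Variable mu : {measure set T -> \bar R}.

Definition L0 : Type := {mfun_ mu, T >-> R[i]}.
HB.instance Definition _ := Choice.on L0.

Definition to_L0 (f : T -> R[i]) (mf : measurable_fun [set: T] f) : L0 :=
  \pi_({mfun_ mu, T >-> R[i]}) (mfun_Sub (mem_set mf)).

Definition L0_fun (f : L0) : T -> R[i] := (f : {mfun_ mu, T >-> R[i]}).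
Coercion L0_fun : L0 >-> Funclass.

Lemma measurable_L0 (f : L0) : measurable_fun [set: T] f.
Proof. exact: measurable_funPT. Qed.

Lemma to_L0E f mf : {ae mu, forall x, @to_L0 f mf x = f x}.
Proof.
have /eqmodP/asboolP := reprK (@to_L0 f mf).
by apply: filterS => x /= /(_ I).
Qed.

Lemma L0_eq (f g : L0) : {ae mu, forall x, f x = g x} -> f = g.
Proof.
move=> fg; rewrite -[LHS]reprK -[RHS]reprK; apply/eqmodP/asboolP.
by apply: filterS fg => x /= + _.
Qed.

Lemma measurable_cplxD (f g : T -> R[i]) :
  measurable_fun [set: T] f -> measurable_fun [set: T] g ->
  measurable_fun [set: T] (fun x => f x + g x).
Proof.
move=> /measurable_complexP[fr fi] /measurable_complexP[gr gi].
apply/measurable_complexP; split.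
  rewrite (_ : (fun _ => _) =
    (fun x => complex.Re (f x) + complex.Re (g x))); last first.
    by apply/funext => x; case: (f x) (g x) => [? ?] [].
  exact: measurable_funD.
rewrite (_ : (fun _ => _) =
  (fun x => complex.Im (f x) + complex.Im (g x))); last first.
  by apply/funext => x; case: (f x) (g x) => [? ?] [].
exact: measurable_funD.
Qed.

Lemma measurable_cplxZ (a : R[i]) (f : T -> R[i]) :
  measurable_fun [set: T] f -> measurable_fun [set: T] (fun x => a * f x).
Proof.
move=> /measurable_complexP[fr fi]; case: a => a b.
apply/measurable_complexP; split.
  rewrite (_ : (fun _ => _) =
    (fun x => a * complex.Re (f x) - b * complex.Im (f x))); last first.
    by apply/funext => x; case: (f x) => [? ?].
  by apply: measurable_funB; apply: measurable_funM => //;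
    exact: measurable_cst.
rewrite (_ : (fun _ => _) =
  (fun x => a * complex.Im (f x) + b * complex.Re (f x))); last first.
  by apply/funext => x; case: (f x) => [? ?].
by apply: measurable_funD; apply: measurable_funM => //;
  exact: measurable_cst.
Qed.

Definition L0_zero : L0 := @to_L0 (fun=> 0 : R[i]) (measurable_cst (0 : R[i])).
Definition L0_add (f g : L0) : L0 :=
  to_L0 (measurable_cplxD (measurable_L0 f) (measurable_L0 g)).
Definition L0_scale (a : R[i]) (f : L0) : L0 :=
  to_L0 (measurable_cplxZ a (measurable_L0 f)).
Definition L0_opp (f : L0) : L0 := L0_scale (-1) f.

Local Ltac ae_use h := move: h; apply: filter_app.

Let zeroE : {ae mu, forall x, L0_zero x = 0}. Proof. exact: to_L0E. Qed.
Let addE f g : {ae mu, forall x, L0_add f g x = f x + g x}.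
Proof. exact: to_L0E. Qed.
Let scaleE a f : {ae mu, forall x, L0_scale a f x = a * f x}.
Proof. exact: to_L0E. Qed.

Let L0_addA : associative L0_add.
Proof.
move=> f g h; apply: L0_eq.
ae_use (addE f g).
ae_use (addE (L0_add f g) h).
ae_use (addE g h).
ae_use (addE f (L0_add g h)).
by apply: aeW => x -> -> -> ->; rewrite addrA.
Qed.

Let L0_addC : commutative L0_add.
Proof.
move=> f g; apply: L0_eq.
ae_use (addE g f).
ae_use (addE f g).
by apply: aeW => x -> ->; rewrite addrC.
Qed.

Let L0_add0 : left_id L0_zero L0_add.
Proof.
move=> f; apply: L0_eq.
ae_use zeroE.
ae_use (addE L0_zero f).
by apply: aeW => x -> ->; rewrite add0r.
Qed.

Let L0_addN : left_inverse L0_zero L0_opp L0_add.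
Proof.
move=> f; apply: L0_eq.
ae_use (scaleE (-1) f).
ae_use zeroE.
ae_use (addE (L0_opp f) f).
by apply: aeW => x -> -> ->; rewrite mulN1r addNr.
Qed.

HB.instance Definition _ :=
  GRing.isZmodule.Build L0 L0_addA L0_addC L0_add0 L0_addN.

Let L0_scaleA a b f : L0_scale a (L0_scale b f) = L0_scale (a * b) f.
Proof.
apply: L0_eq.
ae_use (scaleE (a * b) f).
ae_use (scaleE b f).
ae_use (scaleE a (L0_scale b f)).
by apply: aeW => x -> -> ->; rewrite mulrA.
Qed.

Let L0_scale1 : left_id 1 L0_scale.
Proof.
move=> f; apply: L0_eq.
ae_use (scaleE 1 f).
by apply: aeW => x ->; rewrite mul1r.
Qed.

Let L0_scaleDr : right_distributive L0_scale +%R.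
Proof.
move=> a f g; apply: L0_eq.
ae_use (scaleE a g).
ae_use (scaleE a f).
ae_use (addE (L0_scale a f) (L0_scale a g)).
ae_use (addE f g).
ae_use (scaleE a (L0_add f g)).
by apply: aeW => x -> -> -> -> ->; rewrite mulrDr.
Qed.

Let L0_scaleDl f : {morph L0_scale^~ f : a b / a + b}.
Proof.
move=> a b; apply: L0_eq.
ae_use (scaleE b f).
ae_use (scaleE a f).
ae_use (addE (L0_scale a f) (L0_scale b f)).
ae_use (scaleE (a + b) f).
by apply: aeW => x -> -> -> ->; rewrite mulrDl.
Qed.

HB.instance Definition _ := GRing.Zmodule_isLmodule.Build R[i] L0
  L0_scaleA L0_scale1 L0_scaleDr L0_scaleDl.

(* the extended norm of L_p(mu) *)
Definition Lp_norm (p : \bar R) (f : L0) : \bar R :=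
  Lnorm mu p (fun x => (Normc.normc (f x))%:E).

End L0.

Section torus.
Context {R : realType}.

Lemma twopi_gt0 : 0 < 2 * pi :> R.
Proof. by rewrite mulr_gt0// pi_gt0. Qed.

Lemma measurable_consR d : measurable_fun
  [set: (measurableTypeR R * d.-tuple (measurableTypeR R))%type]
  (fun x => [tuple of x.1 :: x.2]).
Proof. exact: measurable_cons. Qed.

(* The normalised Lebesgue measure of T^d: a function on T^d is represented
   by a function on R^d, of which only the restriction to [0, 2pi]^d matters
   since this product of uniform distributions is carried by that cube. *)
Fixpoint torus_measure d : probability (d.-tuple (measurableTypeR R)) R :=
  match d with
  | 0 => dirac [tuple]
  | d'.+1 => distribution (uniform_prob twopi_gt0 \x torus_measure d')%E
               (mfun_Sub (mem_set (@measurable_consR d')))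
  end.

Definition expi (t : R) : R[i] := (cos t +i* sin t)%C.

Definition fourier_coef d (f : L0 (torus_measure d)) (k : d.-tuple int) :
    R[i] :=
  let g x := f x * expi (- \sum_(i < d) (tnth k i)%:~R * tnth x i) in
  ((\int[torus_measure d]_x complex.Re (g x)) +i*
   (\int[torus_measure d]_x complex.Im (g x)))%C.

(* the extended norm of the weighted Wiener algebra A_w(T^d) *)
Definition wiener_norm d (w : d.-tuple int -> R) (f : L0 (torus_measure d)) :
    \bar R :=
  if (Lp_norm 1 f < +oo)%E
  then (\esum_(k in [set: d.-tuple int])
          (w k * Normc.normc (fourier_coef f k))%:E)%E
  else +oo%E.

(* the value at r = -oo is junk *)
Definition mix_weight d (s : R) (r : \bar R) (k : d.-tuple int) : R :=
  match r with
  | r%:E => \prod_(i < d) (1 + `|(tnth k i)%:~R| `^ r) `^ (s / r)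
  | _ => \prod_(i < d) (Num.max 1 `|(tnth k i)%:~R|) `^ s
  end.

Definition Amix_norm d (s : R) (r : \bar R) : L0 (torus_measure d) -> \bar R :=
  wiener_norm (mix_weight s r).

Definition L2_norm d : L0 (torus_measure d) -> \bar R := Lp_norm 2%:E.

End torus.

(* Main.v *)
Require Import Defs.
From HB Require Import structures.
From mathcomp Require Import all_boot all_order all_algebra.
From mathcomp Require Import complex spectral sesquilinear.
From mathcomp Require Import all_classical all_reals all_analysis.
From mathcomp Require Import measurable_realfun.
From mathcomp Require Import zify ring lra.

Set Implicit Arguments.
Unset Strict Implicit.
Unset Printing Implicit Defensive.
Import Order.TTheory GRing.Theory Num.Theory.
Import numFieldNormedType.Exports.

Local Open Scope classical_set_scope.
Local Open Scope ring_scope.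

(** The characters of the torus are orthonormal in L2. Once the frequencies are
    listed by increasing weight [w 0 <= w 1 <= ...], the embedding is therefore
    the identity of a weighted l1 space of coefficient sequences into l2, and its
    s-numbers depend only on the sums [wsum n] of the first [n] squared weights.

    The Bernstein and Weyl numbers are both equal to [(Num.sqrt (wsum n))^-1].
    The lower bounds come from the span of the first [n] characters and the
    Cauchy-Schwarz inequality. The upper bounds rest on the fact that a
    contraction of l2 into the weighted l1 space has a weighted Hilbert-Schmidt
    norm of at most 1 ([hs_weighted_le1]), combined with the observation that a
    density bounded by 1 of total mass [n] weighs at least [wsum n] ([bathtub]).

    The approximation and Kolmogorov numbers are both equal to the maximum over
    [m >= n] of the square root of [tail_ratio n m], which is
    [(m + 1 - n) / wsum m]. Averaging the squared distances of the first [m]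
    normalised characters from a space of dimension less than [n] yields the
    lower bound ([span_far]). For the upper bound, take the [m] at which the
    ratio stops increasing and project orthogonally on a space of dimension
    [n - 1] that is equally far from all these normalised characters. It exists
    because a matrix with orthonormal rows can have prescribed column norms
    ([parseval_frame]).

    To see the embedding as a diagonal one, it must be known that a function with
    absolutely summable Fourier coefficients is the sum of its Fourier series
    ([fourier_tail]). This follows from the uniqueness of Fourier coefficients
    of integrable functions ([torus_uniqueness]), which is proved on the circle
    by approximating indicator functions of arcs by trigonometric polynomials,
    and in higher dimension by Fubini's theorem.

    The asymptotics start from the number of lattice points in the hyperbolic
    cross of parameter [T], equivalent to [2 ^ d / (d - 1)! * T * (ln T) ^ (d - 1)]
    ([cross_count_asym]), by induction on [d]; the parameter [r] has no influence
    on the limit, for each factor of the weight is equivalent to [j ^ s].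
    Inverting the counting function gives the growth of the weights, and the
    theorem of Stolz and Cesaro that of their sums of squares ([cvg_wsum]). This
    settles Bernstein and Weyl numbers. For the others, the ratio at
    [m = n / t], divided by the square of the expected order, tends to a
    constant multiple of [(1 - t) * t ^ (2 s)], whose maximum at [t = 2 s / (2 s + 1)] is the remaining constant
    ([tail_ratio_lower], [tail_ratio_upper]). *)

(** * Complex matrices and the Hilbert-Schmidt norm *)

Section ComplexMatrices.
Context {R : rcfType}.
Local Notation C := R[i].
Local Notation normc := (@Normc.normc R).
Local Open Scope sesquilinear_scope.
Local Open Scope complex_scope.

Lemma normcE2 (z : C) : normc z ^+ 2 = complex.Re z ^+ 2 + complex.Im z ^+ 2.
Proof. by case: z => a b /=; rewrite sqr_sqrtr// addr_ge0// sqr_ge0. Qed.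

Lemma normc_ge0 (z : C) : 0 <= normc z.
Proof. by case: z => a b; exact: sqrtr_ge0. Qed.

Lemma normc_normr (z : C) : (normc z)%:C = `|z|.
Proof. by []. Qed.

Lemma normc_sqrC (z : C) : (normc z ^+ 2)%:C = z * z^*%R.
Proof. by rewrite -normCK -normc_normr -rmorphXn. Qed.

Lemma normc_conj (z : C) : normc (z^*)%R = normc z.
Proof. by apply: (@complexI R); rewrite !normc_normr norm_conjC. Qed.

Lemma normc_real (x : R) : normc x%:C = `|x|.
Proof. by rewrite /= expr0n addr0 sqrtr_sqr. Qed.

(** The square of the Hilbert-Schmidt norm. *)
Definition hs m n (A : 'M[C]_(m, n)) : R :=
  \sum_i \sum_j normc (A i j) ^+ 2.

Lemma hs_ge0 m n (A : 'M[C]_(m, n)) : 0 <= hs A.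
Proof. by do 2![apply: sumr_ge0 => ? _]; exact: sqr_ge0. Qed.

Lemma hsE m n (A : 'M[C]_(m, n)) : (hs A)%:C = \tr (A *m A^t*).
Proof.
rewrite rmorph_sum; apply: eq_bigr => i _; rewrite mxE rmorph_sum.
by apply: eq_bigr => j _; rewrite /= normc_sqrC !mxE.
Qed.

Lemma trmxC_mul m n p (A : 'M[C]_(m, n)) (B : 'M[C]_(n, p)) :
  (A *m B)^t* = B^t* *m A^t*.
Proof. by rewrite trmx_mul map_mxM. Qed.

Lemma trmxC_sub m n (A B : 'M[C]_(m, n)) : (A - B)^t* = A^t* - B^t*.
Proof. by rewrite linearB /= map_mxB. Qed.

Lemma hs_trC m n (A : 'M[C]_(m, n)) : hs (A^t*) = hs A.
Proof. by apply: (@complexI R); rewrite !hsE trmxCK mxtrace_mulC. Qed.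

(** Pythagoras for the orthogonal projection of the rows of [A] on the span of
    the orthonormal rows of [W]. *)
Lemma hs_unitary_split m n q (A : 'M[C]_(m, n)) (W : 'M[C]_(q, n)) :
  W \is unitarymx -> hs A = hs (A *m W^t*) + hs (A - A *m W^t* *m W).
Proof.
move=> /unitarymxP WW; apply: (@complexI R); rewrite rmorphD /= !hsE.
rewrite trmxC_sub !trmxC_mul trmxCK mulmxBl !mulmxBr !mulmxA.
rewrite -[A *m W^t* *m W *m W^t*]mulmxA WW mulmx1 subrr subr0.
by rewrite mxtraceD linearN /=; ring.
Qed.

Lemma hs_unitary_le m n q (A : 'M[C]_(m, n)) (W : 'M[C]_(q, n)) :
  W \is unitarymx -> hs (A *m W^t*) <= hs A.
Proof. by move=> /hs_unitary_split ->; rewrite lerDl hs_ge0. Qed.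

Lemma hs_unitary m n (U : 'M[C]_n) (A : 'M[C]_(n, m)) :
  U \is unitarymx -> hs (U *m A) = hs A.
Proof.
rewrite -trmxC_unitary => /unitarymxP; rewrite trmxCK => UU.
apply: (@complexI R); rewrite !hsE trmxC_mul !mulmxA mxtrace_mulC !mulmxA UU.
by rewrite mul1mx.
Qed.

Lemma hs_unitary_rows q n (W : 'M[C]_(q, n)) :
  W \is unitarymx -> hs W = q%:R.
Proof.
move=> /unitarymxP WW; apply: (@complexI R).
by rewrite hsE WW mxtrace1 rmorph_nat.
Qed.

Lemma unitary_col_le1 q n (W : 'M[C]_(q, n)) (k : 'I_n) :
  W \is unitarymx -> \sum_i normc (W i k) ^+ 2 <= 1.
Proof.
move=> W1; have := hs_unitary_le (delta_mx 0 k : 'rV[C]_n) W1.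
rewrite -rowE /hs !big_ord1.
under eq_bigr do rewrite !mxE normc_conj.
move=> /le_trans; apply; rewrite (bigD1 k)//= big1 ?addr0 => [|j jk].
  by rewrite !mxE !eqxx Normc.normc1 expr1n.
by rewrite !mxE (negPf jk) andbF Normc.normc0 expr0n.
Qed.

(** Multiplication by an orthonormal basis of the orthogonal complement of the
    row space of [D *m V] does not increase the norm and kills [D *m V]; what
    is left of the identity is that basis, of at least [M - q] unit vectors. *)
Lemma hs_sub1_rank q M (D : 'M[C]_(M, q)) (V : 'M[C]_(q, M)) :
  M%:R - q%:R <= hs (1%:M - D *m V).
Proof.
set Y := D *m V.
pose Z : 'M[C]_M := orthomx Num.conj (mx_of_hermitian (hermitian1mx M)) Y.
pose W := schmidt (row_base Z).
have W1 : W \is unitarymx by rewrite schmidt_unitarymx// rank_leq_col.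
have YW : Y *m W^t* = 0.
  apply/orthomx1P; rewrite orthomx_sym.
  by rewrite /W eqmx_schmidt_free ?row_base_free// eq_row_base.
have rZ : \rank Z = (M - \rank Y)%N by rewrite rank_ortho.
have rY : (\rank Y <= q)%N.
  by apply: leq_trans (mxrankM_maxr _ _) _; exact: rank_leq_row.
apply: le_trans (hs_unitary_le (1%:M - Y) W1).
rewrite mulmxBl mul1mx YW subr0 hs_trC hs_unitary_rows// rZ.
have [MY|/ltnW YM] := leqP (\rank Y) M.
  by rewrite natrB// lerB// ler_nat.
by rewrite (eqP (YM : (M - _)%N == 0%N)) subr_le0 ler_nat (leq_trans YM).
Qed.

Lemma parallelogram (a b : C) :
  normc (a + b) ^+ 2 + normc (a - b) ^+ 2 = 2 * (normc a ^+ 2 + normc b ^+ 2).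
Proof. by rewrite !normcE2; case: a b => [a1 a2] [b1 b2] /=; ring. Qed.

(** By the parallelogram law, adding or subtracting the next row makes the
    squared norm grow by at least the squared norm of that row: it does so for
    one of the two signs. *)
Lemma signs_exist p m (v : 'M[C]_(p, m)) :
  exists e : 'I_p -> bool,
    hs v <= \sum_j normc (\sum_i (-1) ^+ e i * v i j) ^+ 2.
Proof.
elim: p v => [|p IH] v.
  by exists (fun=> true); rewrite /hs big_ord0; apply: sumr_ge0 => ? _; exact: sqr_ge0.
have [e he] := IH (\matrix_(i, j) v (widen_ord (leqnSn p) i) j).
pose u j := \sum_i (-1) ^+ e i * v (widen_ord (leqnSn p) i) j.
have hsS : hs v <= \sum_j normc (u j) ^+ 2 + \sum_j normc (v ord_max j) ^+ 2.
  rewrite /hs big_ord_recr /= lerD2r; apply: le_trans (le_trans _ he) _.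
    rewrite le_eqVlt; apply/orP; left; apply/eqP.
    by apply: eq_bigr => i _; apply: eq_bigr => j _; rewrite !mxE.
  by apply: ler_sum => j _; rewrite /u; under eq_bigr do rewrite mxE.
have hpar : \sum_j normc (u j) ^+ 2 + \sum_j normc (v ord_max j) ^+ 2 <=
   Num.max (\sum_j normc (u j + v ord_max j) ^+ 2)
           (\sum_j normc (u j - v ord_max j) ^+ 2).
  have E : \sum_j normc (u j + v ord_max j) ^+ 2 +
      \sum_j normc (u j - v ord_max j) ^+ 2 =
      2 * (\sum_j normc (u j) ^+ 2 + \sum_j normc (v ord_max j) ^+ 2).
    rewrite -!big_split mulr_sumr /=; apply: eq_bigr => j _.
    exact: parallelogram.
  rewrite le_max; case: (lerP (\sum_j normc (u j) ^+ 2 + \sum_j normc (v ord_max j) ^+ 2)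
     (\sum_j normc (u j + v ord_max j) ^+ 2)) => //= h; lra.
have ext (b : bool) : exists e' : 'I_p.+1 -> bool, forall j,
    \sum_i (-1) ^+ e' i * v i j = u j + (-1) ^+ b * v ord_max j.
  exists (fun i => if unlift ord_max i is Some k then e k else b); move=> j.
  rewrite big_ord_recr /= unlift_none; congr (_ + _).
  apply: eq_bigr => i _.
  have -> : widen_ord (leqnSn p) i = lift ord_max i.
    by apply: val_inj; rewrite /= /bump leqNgt ltn_ord.
  by rewrite liftK.
move: hpar; rewrite le_max => /orP[h|h].
- have [e' E] := ext false; exists e'; apply: le_trans hsS (le_trans h _).
  by rewrite le_eqVlt; apply/orP; left; apply/eqP; apply: eq_bigr => j _;
     rewrite E expr0 mul1r.
- have [e' E] := ext true; exists e'; apply: le_trans hsS (le_trans h _).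
  by rewrite le_eqVlt; apply/orP; left; apply/eqP; apply: eq_bigr => j _;
     rewrite E expr1 mulN1r.
Qed.

Lemma normc_sum (I : Type) (r : seq I) (f : I -> C) :
  normc (\sum_(i <- r) f i) <= \sum_(i <- r) normc (f i).
Proof.
elim/big_ind2: _ => [|x1 x2 y1 y2 h1 h2|//].
  by rewrite Normc.normc0.
exact: le_trans (le_normcD _ _) (lerD h1 h2).
Qed.

(** A contraction of l2 into a weighted l1 has a weighted Hilbert-Schmidt norm
    of at most 1. Choose signs for which the signed sum [y] of the rows of
    [B], weighted by [w], has at least that norm, and apply the contraction to
    the conjugate [x] of [y]: the l1 norm of the image bounds [hs x] from above,
    whence [hs x ^+ 2 <= hs x]. *)
Lemma hs_weighted_le1 p m (w : 'I_p -> R) (B : 'M[C]_(p, m)) :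
    (forall k, 0 <= w k) ->
    (forall x : 'cV[C]_m, (\sum_k w k * normc ((B *m x) k 0)) ^+ 2 <= hs x) ->
  \sum_k w k ^+ 2 * \sum_j normc (B k j) ^+ 2 <= 1.
Proof.
move=> w0 hB.
have [e he] := signs_exist (\matrix_(k, j) ((w k)%:C * B k j)).
have -> : \sum_k w k ^+ 2 * \sum_j normc (B k j) ^+ 2 =
    hs (\matrix_(k, j) ((w k)%:C * B k j)).
  apply: eq_bigr => k _; rewrite mulr_sumr; apply: eq_bigr => j _.
  by rewrite mxE Normc.normcM normc_real exprMn ger0_norm.
apply: le_trans he _.
pose y : 'cV[C]_m := \col_j (\sum_k (-1) ^+ e k * ((w k)%:C * B k j)).
pose x : 'cV[C]_m := \col_j (y j 0)^*%R.
have hsx : hs x = \sum_j normc (y j 0) ^+ 2.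
  by apply: eq_bigr => j _; rewrite big_ord1 mxE normc_conj.
under eq_bigr => j _.
  under eq_bigr => k _ do rewrite mxE.
  over.
rewrite (_ : \sum_j _ = hs x); last first.
  by rewrite hsx; apply: eq_bigr => j _; rewrite mxE.
have key : (hs x)%:C = \sum_k (-1) ^+ e k * ((w k)%:C * (B *m x) k 0).
  rewrite hsx rmorph_sum /=.
  under eq_bigr => j _ do rewrite normc_sqrC {1}mxE mulr_suml.
  rewrite exchange_big; apply: eq_bigr => k _.
  rewrite mxE !mulr_sumr; apply: eq_bigr => j _.
  by rewrite !mxE; ring.
have hx0 := hs_ge0 x.
have h1 : hs x <= \sum_k w k * normc ((B *m x) k 0).
  rewrite -[leLHS](ger0_norm hx0) -normc_real key.
  apply: le_trans (normc_sum _ _) _; apply: ler_sum => k _.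
  rewrite !Normc.normcM normc_real (ger0_norm (w0 _)).
  case: (e k); rewrite ?expr0 ?expr1 ?normcN Normc.normc1 mul1r//.
have h2 := hB x.
have h3 : hs x ^+ 2 <= hs x.
  by apply: le_trans h2; rewrite ler_sqr ?nnegrE// (le_trans hx0).
have [//|hx1] := lerP (hs x) 1.
nra.
Qed.

(** A mass of at least [n], with density at most 1, weighs the least when it
    fills the [n] cells of smallest weight: moving the mass that lies beyond
    them to the left replaces weights above [w2 n] by weights below it. *)
Lemma bathtub (n M : nat) (w2 q : nat -> R) :
    (forall i, 0 <= w2 i) -> {homo w2 : i j / (i <= j)%N >-> i <= j} ->
    (forall k, (k < M)%N -> 0 <= q k <= 1) ->
    n%:R <= \sum_(k < M) q k ->
  \sum_(k < n) w2 k <= \sum_(k < M) w2 k * q k.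
Proof.
move=> w0 wm q01 qn.
have [nM|Mn] := leqP n M; last first.
  have : \sum_(k < M) q k <= M%:R.
    rewrite -[X in _ <= X%:R]card_ord -sumr_const; apply: ler_sum => k _.
    by have /andP[] := q01 k (ltn_ord k).
  by move=> /(le_trans qn); rewrite ler_nat leqNgt Mn.
move: qn.
rewrite -[in X in X -> _](subnKC nM) -[in X in _ -> X](subnKC nM) !big_split_ord /= => qn.
have lo : \sum_(i < n) w2 i - w2 n * \sum_(i < n) (1 - q i) <=
    \sum_(i < n) w2 i * q i.
  rewrite lerBlDr mulr_sumr -big_split /=; apply: ler_sum => i _.
  have /andP[? ?] := q01 i (leq_trans (ltn_ord i) nM).
  have := wm i n (ltnW (ltn_ord i)); nra.
have hi : w2 n * \sum_(i < M - n) q (n + i)%N <= \sum_(i < M - n) w2 (n + i)%N * q (n + i)%N.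
  rewrite mulr_sumr; apply: ler_sum => i _.
  have /andP[? ?] := q01 (n + i)%N ltac:(by rewrite -ltn_subRL).
  by rewrite ler_wpM2r// wm// leq_addr.
apply: le_trans (lerD lo hi); rewrite -addrA lerDl -mulNr addrC.
move: qn; rewrite sumrB sumr_const card_ord.
set a := \sum_(i < n) _; set b := \sum_(i < M - n) _ => qn.
by have := w0 n; rewrite -[1 *+ n]/(n%:R); nra.
Qed.

(** The upper bound for Weyl numbers in finite dimension. In the eigenbasis [U]
    of [B *m B^t*], keep the set [I] of the eigenvalues above [S^-1]. The
    weighted trace of the matrix is at most 1, and the eigenvectors of [I] form
    a density bounded by 1 of total mass [#|I|]. If there were [n] of them, they
    would weigh at least [S] by [bathtub] and their part of the trace would
    exceed 1; so [I] has fewer than [n] elements. The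
    projection on the other eigenvectors turns [B] into a map of squared norm
    at most [S^-1]. *)
Lemma weighted_hs_lowrank n p m (w : nat -> R) (B : 'M[C]_(p, m)) :
    (forall i, 0 < w i) -> {homo w : i j / (i <= j)%N >-> i <= j} ->
    (0 < n)%N ->
    \sum_k w (k : 'I_p) ^+ 2 * \sum_j normc (B k j) ^+ 2 <= 1 ->
  exists (U : 'M[C]_p) (I : {set 'I_p}),
    [/\ (#|I| < n)%N,
    forall z : 'cV[C]_p, hs (z - U^t* *m diag_mx (\row_i (i \in I)%:R) *m U *m z) <= hs z &
    forall x : 'cV[C]_m,
      (\sum_(k < n) w k ^+ 2) *
        hs (B *m x - U^t* *m diag_mx (\row_i (i \in I)%:R) *m U *m B *m x)
      <= hs x].
Proof.
move=> w0 wm n0 hB.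
set S := \sum_(k < n) w k ^+ 2.
have S0 : 0 < S.
  by rewrite /S; case: n n0 {S} => // n _; rewrite big_ord_recl ltr_pwDl ?exprn_gt0//
    sumr_ge0// => i _; rewrite exprn_ge0// ltW.
pose G := B *m B^t*.
have Gn : G \is normalmx by apply/normalmxP; rewrite /G trmxC_mul trmxCK.
have := orthomx_spectralP Gn.
set U := spectralmx G; set lam := spectral_diag G.
have U1 : U \is unitarymx by exact: spectral_unitarymx.
rewrite invmx_unitary// => GE.
have UU : U *m U^t* = 1%:M by apply/unitarymxP.
have UU' : U^t* *m U = 1%:M by move: U1; rewrite -trmxC_unitary => /unitarymxP; rewrite trmxCK.
pose D := U *m B.
have DD : D *m D^t* = diag_mx lam.
  by rewrite /D trmxC_mul !mulmxA -(mulmxA U B) -/G GE !mulmxA UU mul1mx -mulmxA UU mulmx1.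
pose l i := \sum_j normc (D i j) ^+ 2.
have lE i : lam 0 i = (l i)%:C.
  have /matrixP/(_ i i) := DD; rewrite !mxE eqxx mulr1n => <-.
  by rewrite rmorph_sum; apply: eq_bigr => j _; rewrite /= normc_sqrC !mxE.
have l0 i : 0 <= l i by apply: sumr_ge0 => j _; exact: sqr_ge0.
have BE k : \sum_j normc (B k j) ^+ 2 = \sum_i l i * normc (U i k) ^+ 2.
  apply: (@complexI R); have /matrixP/(_ k k) := GE.
  rewrite [LHS]mxE [RHS]mxE => h.
  transitivity (\sum_j B k j * B^t* j k).
    by rewrite rmorph_sum; apply: eq_bigr => j _; rewrite /= normc_sqrC !mxE.
  rewrite h rmorph_sum; apply: eq_bigr => i _.
  by rewrite mul_mx_diag !mxE rmorphM /= normc_sqrC lE; ring.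
pose I := [set i | S^-1 < l i]%SET.
exists U, I.
have hI : (#|I| < n)%N.
  rewrite ltnNge; apply/negP => nI.
  (* the share of the coordinate k in the eigenvectors of I *)
  pose q (k : nat) : R := if insub k is Some k' then \sum_(i in I) normc (U i k') ^+ 2 else 0.
  have qE (k : 'I_p) : q k = \sum_(i in I) normc (U i k) ^+ 2.
    by rewrite /q valK.
  have colU k : \sum_i normc (U i k) ^+ 2 = 1.
    apply: (@complexI R); rewrite rmorph_sum; have /matrixP/(_ k k) := UU'.
    rewrite [LHS]mxE [RHS]mxE eqxx => h; rewrite -[RHS]/(true%:R : C) -h.
    by apply: eq_bigr => i _; rewrite /= normc_sqrC !mxE; ring.
  have rowU i : \sum_k normc (U i k) ^+ 2 = 1.
    apply: (@complexI R); rewrite rmorph_sum; have /matrixP/(_ i i) := UU.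
    rewrite [LHS]mxE [RHS]mxE eqxx => h; rewrite -[RHS]/(true%:R : C) -h.
    by apply: eq_bigr => k _; rewrite /= normc_sqrC !mxE.
  pose T i := \sum_k w (k : 'I_p) ^+ 2 * normc (U i k) ^+ 2.
  have T0 i : 0 < T i.
    have : w 0%N ^+ 2 <= T i.
      rewrite -[leLHS]mulr1 -(rowU i) mulr_sumr; apply: ler_sum => k _.
      by rewrite ler_wpM2r ?sqr_ge0// ler_sqr ?nnegrE ?(ltW (w0 _))// wm.
    by apply: lt_le_trans; rewrite exprn_gt0.
  have hS : S <= \sum_(i in I) T i.
    have -> : \sum_(i in I) T i = \sum_(k < p) w k ^+ 2 * q k.
      rewrite exchange_big; apply: eq_bigr => k _.
      by rewrite qE mulr_sumr.
    apply: (@bathtub n p (fun k => w k ^+ 2)) => [k|i j ij|k kp|].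
    - exact: sqr_ge0.
    - by rewrite ler_sqr ?nnegrE ?(ltW (w0 _))// wm.
    - rewrite -[k]/(val (Ordinal kp)) qE sumr_ge0/= => [|i _]; last exact: sqr_ge0.
      rewrite -(colU (Ordinal kp)) [leRHS](bigID [in I])/= lerDl.
      by apply: sumr_ge0 => i _; exact: sqr_ge0.
    - have -> : \sum_(k < p) q k = #|I|%:R.
        under eq_bigr do rewrite qE.
        rewrite exchange_big /= (eq_bigr (fun=> 1)) => [|i _]; last exact: rowU.
        by rewrite sumr_const.
      by rewrite ler_nat.
  have hT : \sum_(i in I) l i * T i <= 1.
    apply: le_trans hB.
    under [leRHS]eq_bigr do rewrite BE mulr_sumr.
    rewrite exchange_big [leRHS](bigID [in I])/=.
    apply: ler_wpDr.
      apply: sumr_ge0 => i _; apply: sumr_ge0 => k _.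
      by rewrite mulr_ge0 ?sqr_ge0// mulr_ge0// sqr_ge0.
    apply: ler_sum => i _; rewrite mulr_sumr; apply: ler_sum => k _.
    by rewrite le_eqVlt; apply/orP; left; apply/eqP; ring.
  have : S^-1 * \sum_(i in I) T i < \sum_(i in I) l i * T i.
    rewrite mulr_sumr; apply: ltr_sum => [|i]; last by rewrite inE ltr_pM2r.
    have /card_gt0P[i iI] := leq_trans n0 nI.
    by apply/hasP; exists i => //; rewrite mem_index_enum.
  apply/negP; rewrite -leNgt; apply: le_trans hT _.
  by rewrite mulrC ler_pdivlMr// mul1r.
split=> // [z|x].
  rewrite -(hs_unitary z U1).
  set Z := (Z in hs Z <= _); rewrite -(hs_unitary Z U1) /Z mulmxBr !mulmxA UU mul1mx -mulmxA.
  rewrite mul_diag_mx; apply: ler_sum => i _; rewrite !big_ord1 !mxE.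
  by case: (i \in I); rewrite ?mul1r ?subrr ?mul0r ?subr0// Normc.normc0 expr0n sqr_ge0.
pose v := D *m x.
pose y : 'cV[C]_p := \col_i (if i \in I then 0 else v i 0).
pose z := D^t* *m y.
have -> : hs (B *m x - U^t* *m diag_mx (\row_i (i \in I)%:R) *m U *m B *m x) = hs y.
  rewrite -(hs_unitary _ U1) mulmxBr !mulmxA UU mul1mx -/D; congr hs.
  rewrite -!mulmxA (mulmxA U B) -/D -/v mul_diag_mx; apply/colP => i; rewrite !mxE.
  by case: ifP => _; rewrite ?mul1r ?subrr ?mul0r ?subr0.
clearbody D.
have trz : \tr (z *m z^t*) = (\sum_i l i * normc (y i 0) ^+ 2)%:C.
  rewrite /z (trmxC_mul (D^t*) y) trmxCK -mulmxA mxtrace_mulC -!mulmxA DD (mulmxA y).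
  rewrite mul_mx_diag rmorph_sum; apply: eq_bigr => i _.
  by rewrite rmorphM /= normc_sqrC -lE !mxE big_ord1 !mxE mulrC.
have trx : \tr (z *m x^t*) = (hs y)%:C.
  rewrite /z mxtrace_mulC mulmxA mxtrace_mulC -trmxC_mul -/v hsE.
  rewrite /mxtrace; apply: eq_bigr => i _; rewrite !mxE !big_ord1 !mxE.
  by case: ifP => _; rewrite ?mul0r.
have trx' : \tr (x *m z^t*) = (hs y)%:C.
  rewrite /z (trmxC_mul (D^t*) y) trmxCK mulmxA mxtrace_mulC mulmxA -/v hsE.
  rewrite /mxtrace; apply: eq_bigr => i _; rewrite !mxE !big_ord1 !mxE.
  by case: ifP => _; rewrite ?rmorph0 ?mulr0.
(* the square of z - x / S bounds the cross term, which is hs y *)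
have E : hs (z - (S^-1)%:C *: x) =
    \sum_i l i * normc (y i 0) ^+ 2 - 2 * S^-1 * hs y + S^-1 ^+ 2 * hs x.
  apply: (@complexI R); rewrite hsE trmxC_sub mulmxBl !mulmxBr.
  have -> : ((S^-1)%:C *: x)^t* = (S^-1)%:C *: x^t*.
    by rewrite linearZ /= map_mxZ; congr (_ *: _); apply: CrealP; rewrite complex_real.
  rewrite -!scalemxAr -!scalemxAl.
  rewrite !raddfB /= !mxtraceZ trz trx trx' -hsE.
  rewrite !(rmorphD, rmorphN, rmorphM, rmorphXn) /=; ring.
have := hs_ge0 (z - (S^-1)%:C *: x); rewrite E.
have : \sum_i l i * normc (y i 0) ^+ 2 <= S^-1 * hs y.
  rewrite mulr_sumr; apply: ler_sum => i _; rewrite big_ord1 !mxE.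
  case: ifPn => [_|]; first by rewrite Normc.normc0 expr0n !mulr0.
  by rewrite inE -leNgt => h; rewrite ler_wpM2r ?sqr_ge0.
have Si : 0 < S^-1 by rewrite invr_gt0.
move: (\sum_i _) => t ht h.
have : S^-1 * hs y <= S^-1 * (S^-1 * hs x) by nra.
by rewrite ler_pM2l// ler_pdivlMl.
Qed.

(** A matrix with [p] orthonormal rows can have any squared column norms in
    [0, 1] of sum [p]. Induction on the number of columns treats the last two,
    of squared norms [a] and [b]. If [a + b <= 1], they are proportional to one
    column of squared norm [a + b]. Otherwise the last column of a smaller
    matrix, of squared norm [a + b - 1], is split into two columns proportional
    to [(c, s)], and a new row [(- s, c)] supported on them is added; the angle
    is chosen such that the norms are right. *)
Lemma parseval_frame (p M : nat) (t : nat -> R) :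
    (forall k, (k < M)%N -> 0 <= t k <= 1) -> \sum_(k < M) t k = p%:R ->
  exists W : nat -> nat -> R,
    (forall i j, (i < p)%N -> (j < p)%N ->
       \sum_(k < M) W i k * W j k = (i == j)%:R) /\
    (forall k, (k < M)%N -> \sum_(i < p) W i k ^+ 2 = t k).
Proof.
elim: M p t => [|[|M] IH] p t t01 tp.
- exists (fun _ _ => 0); split=> // i j ip.
  by move: tp ip; rewrite big_ord0 => /esym/eqP; rewrite pnatr_eq0 => /eqP ->.
- move: tp; rewrite big_ord1 => tp; have /andP[t0 t1] := t01 0%N isT.
  exists (fun _ _ => 1); split => [i j ip jp|[|//] _].
    have p1 : (p <= 1)%N by rewrite -(ler_nat R) -tp.
    by rewrite big_ord1 mulr1; case: p p1 ip jp {tp} => [|[|]]//; case: i j => [|//] [|//].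
  by rewrite (eq_bigr (fun=> 1)) ?sumr_const ?card_ord ?tp// => i _; rewrite expr1n.
have nE (k : 'I_M) : ((k == M.+1 :> nat) = false) * ((k == M :> nat) = false).
  by split; apply: ltn_eqF; rewrite ?ltnS ?(ltnW (ltn_ord k)) ?ltn_ord.
have := t01 M.+1 (leqnn _); have := t01 M (leqW (leqnn _)).
move: tp; rewrite !big_ord_recr /=; set a := t M; set b := t M.+1 => tp.
move=> /andP[a0 a1] /andP[b0 b1].
have [ab1|ab1] := lerP (a + b) 1.
  pose t' k := if k == M then a + b else t k.
  have [k kM||W [Wo Wn]] := IH p t'.
  - rewrite /t'; case: eqP => _; first by rewrite addr_ge0.
    by rewrite t01// ltnW.
  - rewrite big_ord_recr /= {2}/t' eqxx -tp -addrA; congr (_ + _).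
    by apply: eq_bigr => k _; rewrite /t' ltn_eqF.
  have [ab0|abp] := eqVneq (a + b) 0.
    (* both columns vanish *)
    have [za zb] : a = 0 /\ b = 0 by split; lra.
    exists (fun i k => if k == M.+1 then 0 else W i k); split => [i j ip jp|k].
      rewrite big_ord_recr /= eqxx mulr0 addr0 -Wo//.
      by apply: eq_bigr => k _; rewrite ltn_eqF.
    rewrite ltnS leq_eqVlt => /predU1P[->|kM].
      by rewrite eqxx -/b zb; under eq_bigr do rewrite expr0n; rewrite sumr_const mul0rn.
    rewrite ltn_eqF//= Wn//= /t'; case: eqP => // ->; rewrite -/a; lra.
  have abp0 : 0 < a + b by rewrite lt0r abp addr_ge0.
  pose c := Num.sqrt (a / (a + b)); pose s := Num.sqrt (b / (a + b)).
  have c2 : c ^+ 2 = a / (a + b) by rewrite sqr_sqrtr// divr_ge0// ltW.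
  have s2 : s ^+ 2 = b / (a + b) by rewrite sqr_sqrtr// divr_ge0// ltW.
  have cs : c ^+ 2 + s ^+ 2 = 1 by rewrite c2 s2 -mulrDl divff.
  exists (fun i k => if k == M.+1 then s * W i M else
                     if k == M then c * W i M else W i k); split=> [i j ip jp|k].
    rewrite -(Wo i j)// !big_ord_recr /= !eqxx (ltn_eqF (ltnSn M)).
    rewrite -[LHS]addrA; congr (_ + _).
      by apply: eq_bigr => k _; rewrite !nE.
    rewrite [in RHS](_ : W i M * W j M = (c ^+ 2 + s ^+ 2) * (W i M * W j M)); first by ring.
    by rewrite cs mul1r.
  have nM : \sum_(i < p) W i M ^+ 2 = a + b by rewrite Wn// /t' eqxx.
  rewrite ltnS leq_eqVlt => /predU1P[->|].
    rewrite eqxx; under eq_bigr do rewrite exprMn.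
    by rewrite -mulr_sumr nM s2 mulfVK.
  rewrite ltnS leq_eqVlt => /predU1P[->|kM].
    rewrite eqxx (ltn_eqF (ltnSn M)); under eq_bigr do rewrite exprMn.
    by rewrite -mulr_sumr nM c2 mulfVK.
  have kM1 : (k < M.+1)%N by rewrite ltnW.
  by rewrite (ltn_eqF kM) (ltn_eqF kM1) Wn// /t' ltn_eqF.
case: p tp => [|p] tp.
  have : 0 <= \sum_(i < M) t i by apply: sumr_ge0 => i _; have /andP[] := t01 i (leqW (leqW (ltn_ord i))).
  by move: tp => /=; lra.
pose t' k := if k == M then a + b - 1 else t k.
have [k kM||W [Wo Wn]] := IH p t'.
- rewrite /t'; case: eqP => _; first by apply/andP; split; lra.
  by rewrite t01// ltnW.
- rewrite big_ord_recr /= {2}/t' eqxx.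
  rewrite (eq_bigr (fun i : 'I_M => t i)) => [|k _]; last by rewrite /t' ltn_eqF.
  by move: tp; rewrite -natr1; lra.
(* the solution r of r (a + b - 1) + (1 - r) = a, the squared cosine of the
   rotation; every r solves it when a = b = 1 *)
pose r := if a + b - 1 == 1 then 1 else (1 - a) / (2 - a - b).
have [r0 [r1 ra]] : 0 <= r /\ r <= 1 /\ r * (a + b - 1) + (1 - r) = a.
  rewrite /r; case: eqP => [h|/eqP h]; first by rewrite ler01 lexx; split=> //; split=> //; lra.
  have d0 : 0 < 2 - a - b by rewrite lt_def; apply/andP; split; [apply: contra h => /eqP h; apply/eqP; lra|lra].
  split; first by apply: divr_ge0; lra.
  split; first by rewrite ler_pdivrMr// mul1r; lra.
  by field; rewrite gt_eqF.
pose c := Num.sqrt r; pose s := Num.sqrt (1 - r).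
have c2 : c ^+ 2 = r by rewrite sqr_sqrtr.
have s2 : s ^+ 2 = 1 - r by rewrite sqr_sqrtr// subr_ge0.
exists (fun i k => if i == p then (if k == M.+1 then c else if k == M then - s else 0)
   else if k == M.+1 then s * W i M else if k == M then c * W i M else W i k).
have nM : \sum_(i < p) W i M ^+ 2 = a + b - 1 by rewrite Wn// /t' eqxx.
split=> [i j|k].
  rewrite ltnS leq_eqVlt => /predU1P[->|ip]; rewrite ltnS leq_eqVlt => /predU1P[->|jp].
  - rewrite !eqxx !big_ord_recr /= !eqxx (ltn_eqF (ltnSn M)) big1 => [|k _].
      by rewrite add0r mulrNN -!expr2 c2 s2; lra.
    by rewrite !nE mul0r.
  - rewrite !eqxx !big_ord_recr /= !eqxx (ltn_eqF (ltnSn M)) big1 => [|k _].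
      by rewrite (ltn_eqF jp) (gtn_eqF jp) /=; ring.
    by rewrite !nE ?mul0r.
  - rewrite !eqxx !big_ord_recr /= !eqxx (ltn_eqF (ltnSn M)) big1 => [|k _].
      by rewrite (ltn_eqF ip) /=; ring.
    by rewrite !nE ?mulr0.
  - rewrite (ltn_eqF ip) (ltn_eqF jp) -(Wo i j)// !big_ord_recr /= !eqxx (ltn_eqF (ltnSn M)).
    rewrite -[LHS]addrA; congr (_ + _).
      by apply: eq_bigr => k _; rewrite !nE.
    rewrite [in RHS](_ : W i M * W j M = (c ^+ 2 + s ^+ 2) * (W i M * W j M)); first by ring.
    by rewrite c2 s2 addrC subrK mul1r.
rewrite big_ord_recr /= eqxx.
rewrite (eq_bigr (fun i : 'I_p => (if k == M.+1 then s * W i M else if k == M then c * W i M else W i k) ^+ 2)) => [|i _]; last by rewrite ltn_eqF.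
rewrite ltnS leq_eqVlt => /predU1P[->|].
  rewrite eqxx; under eq_bigr do rewrite exprMn.
  by rewrite -mulr_sumr nM s2 c2 -/b; lra.
rewrite ltnS leq_eqVlt => /predU1P[->|kM].
  rewrite eqxx (ltn_eqF (ltnSn M)); under eq_bigr do rewrite exprMn.
  by rewrite -mulr_sumr nM c2 sqrrN s2 -/a; lra.
have kM1 : (k < M.+1)%N by rewrite ltnW.
by rewrite (ltn_eqF kM) (ltn_eqF kM1) Wn// /t' ltn_eqF// expr0n addr0.
Qed.

End ComplexMatrices.

(** * Square-summable sequences and finite-dimensional subspaces *)

Lemma cauchy_schwarz_sum (R : realFieldType) (I : finType) (a b : I -> R) :
  (\sum_i a i * b i) ^+ 2 <= (\sum_i a i ^+ 2) * (\sum_i b i ^+ 2).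
Proof.
set X := \sum_i a i * b i; set A := \sum_i a i ^+ 2; set B := \sum_i b i ^+ 2.
have B0 : 0 <= B by apply: sumr_ge0 => i _; exact: sqr_ge0.
have : 0 <= \sum_i (B * a i - X * b i) ^+ 2 by apply: sumr_ge0 => i _; exact: sqr_ge0.
have -> : \sum_i (B * a i - X * b i) ^+ 2 = B * (A * B - X ^+ 2).
  transitivity (\sum_i (B ^+ 2 * a i ^+ 2 - 2 * B * X * (a i * b i) + X ^+ 2 * b i ^+ 2)).
    by apply: eq_bigr => i _; ring.
  by rewrite !big_split /= sumrN -!mulr_sumr -/A -/B -/X; ring.
have [B0'|Bn0] := eqVneq B 0.
  move=> _; suff -> : X = 0 by rewrite expr0n/= B0' mulr0.
  apply: big1 => i _; suff -> : b i = 0 by rewrite mulr0.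
  by apply/eqP; rewrite -sqrf_eq0; apply/eqP;
     apply: (psumr_eq0P _ B0') => // j _; exact: sqr_ge0.
by rewrite pmulr_rge0 ?subr_ge0// lt0r Bn0.
Qed.

Lemma hs_triangle (R : rcfType) m n (A B : 'M[R[i]]_(m, n)) :
  Num.sqrt (hs (A + B)) <= Num.sqrt (hs A) + Num.sqrt (hs B).
Proof.
have hA := hs_ge0 A; have hB := hs_ge0 B.
rewrite -(ler_pXn2r (ltn0Sn 1)) ?nnegrE ?addr_ge0 ?sqrtr_ge0//.
rewrite sqrrD !sqr_sqrtr// ?hs_ge0// -sqrtrM//.
pose a (k : 'I_m * 'I_n) := Normc.normc (A k.1 k.2).
pose b (k : 'I_m * 'I_n) := Normc.normc (B k.1 k.2).
have EA : hs A = \sum_k a k ^+ 2 by rewrite /hs pair_bigA.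
have EB : hs B = \sum_k b k ^+ 2 by rewrite /hs pair_bigA.
have hab : \sum_k a k * b k <= Num.sqrt (hs A * hs B).
  have h0 : 0 <= \sum_k a k * b k by apply: sumr_ge0 => k _; rewrite mulr_ge0 ?normc_ge0.
  rewrite -(ler_pXn2r (ltn0Sn 1)) ?nnegrE ?sqrtr_ge0//.
  by rewrite sqr_sqrtr ?mulr_ge0// EA EB cauchy_schwarz_sum.
apply: (@le_trans _ _ (\sum_k (a k + b k) ^+ 2)).
  rewrite /hs pair_bigA; apply: ler_sum => k _.
  by rewrite mxE ler_pXn2r ?nnegrE ?addr_ge0 ?normc_ge0// le_normcD.
have -> : \sum_k (a k + b k) ^+ 2 = hs A + 2 * \sum_k a k * b k + hs B.
  by rewrite EA EB mulr_sumr -!big_split; apply: eq_bigr => k _ /=; ring.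
by rewrite lerD2r lerD2l mulr2n; lra.
Qed.

Lemma kernel_row (F : fieldType) n m (D : 'M[F]_(n, m)) : (m < n)%N ->
  exists2 u : 'rV_n, u != 0 & u *m D = 0.
Proof.
move=> mn; exists (nz_row (kermx D)).
  by rewrite nz_row_eq0 -mxrank_eq0 mxrank_ker -lt0n subn_gt0
    (leq_ltn_trans (rank_leq_col _)).
by apply/sub_kermxP; exact: nz_row_sub.
Qed.

Section L2.
Context {R : realType}.
Local Notation C := R[i].
Local Notation normc := (@Normc.normc R).
Local Notation l2 := (@l2_norm R).

Definition delta_seq (k : nat) : nat -> C := fun j => (j == k)%:R.
Definition head_seq (m : nat) (x : nat -> C) : nat -> C := fun j => if (j < m)%N then x j else 0.
Definition tail_seq (m : nat) (x : nat -> C) : nat -> C := fun j => if (j < m)%N then 0 else x j.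

Lemma head_tail m x : x = head_seq m x + tail_seq m x.
Proof.
by apply/funext => j; rewrite fctE /head_seq /tail_seq; case: ifP; rewrite ?addr0 ?add0r.
Qed.

Lemma l2_summand_ge0 (x : nat -> C) k : (0 <= (normc (x k) ^+ 2)%:E)%E.
Proof. by rewrite lee_fin sqr_ge0. Qed.

Lemma l2_series_ge0 (x : nat -> C) (P : pred nat) N :
  (0 <= \sum_(N <= k <oo | P k) (normc (x k) ^+ 2)%:E)%E.
Proof. by apply: nneseries_ge0 => k _ _; exact: l2_summand_ge0. Qed.

Lemma l2_ge0 x : (0 <= l2 x)%E.
Proof. exact: poweR_ge0. Qed.

Lemma l2_mono (x y : nat -> C) : (forall k, normc (x k) <= normc (y k)) -> (l2 x <= l2 y)%E.
Proof.
move=> h; apply: gt0_ler_poweR; rewrite ?invr_ge0// ?in_itv/= ?leey ?andbT.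
- exact: l2_series_ge0.
- exact: l2_series_ge0.
apply: lee_nneseries => k _; first by move=> _; exact: l2_summand_ge0.
by rewrite lee_fin ler_sqr ?nnegrE ?normc_ge0.
Qed.

Lemma l2_sqr (x : nat -> C) (r : R) : l2 x = r%:E ->
  (\sum_(0 <= k <oo) (normc (x k) ^+ 2)%:E)%E = (r ^+ 2)%:E.
Proof.
rewrite /l2_norm; have := l2_series_ge0 x xpredT 0.
case: (\big[_/_]_(_ <= _ <oo) _)%E => [t||//]; last first.
  by rewrite poweRyr// invr_eq0 pnatr_eq0.
by rewrite lee_fin => t0; rewrite poweR_EFin powR12_sqrt// => -[<-]; rewrite sqr_sqrtr.
Qed.

Lemma l2_of_series (x : nat -> C) (t : R) :
  (\sum_(0 <= k <oo) (normc (x k) ^+ 2)%:E)%E = t%:E -> l2 x = (Num.sqrt t)%:E.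
Proof.
move=> h; have := l2_series_ge0 x xpredT 0.
by rewrite /l2_norm h lee_fin => t0; rewrite poweR_EFin powR12_sqrt.
Qed.

Lemma l2_partial (x : nat -> C) (r : R) M : l2 x = r%:E ->
  \sum_(k < M) normc (x k) ^+ 2 <= r ^+ 2.
Proof.
move=> /l2_sqr h; rewrite -lee_fin -h -sumEFin.
rewrite -(big_mkord xpredT (fun k => (normc (x k) ^+ 2)%:E)).
by apply: nneseries_lim_ge => k _ _; exact: l2_summand_ge0.
Qed.

Lemma l2_finite M (x : nat -> C) : (forall k, (M <= k)%N -> x k = 0) ->
  l2 x = (Num.sqrt (\sum_(k < M) normc (x k) ^+ 2))%:E.
Proof.
move=> x0; apply: l2_of_series.
rewrite (nneseries_split 0 M) => [|k _]; last exact: l2_summand_ge0.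
rewrite eseries0 => [|k /x0 ->]; last by move=> _; rewrite Normc.normc0 expr0n.
by rewrite adde0 add0n big_mkord sumEFin.
Qed.

Lemma l2_tail (x : nat -> C) (th : R) : (l2 x < +oo)%E -> 0 < th ->
  exists M, (l2 (tail_seq M x) <= th%:E)%E.
Proof.
move=> xoo th0.
have xf : l2 x \is a fin_num by rewrite ge0_fin_numE// l2_ge0.
have h := l2_sqr (esym (fineK xf)).
have sfin : (\sum_(0 <= k <oo) (normc (x k) ^+ 2)%:E < +oo)%E by rewrite h ltry.
have /fine_cvgP[_] := nneseries_tail_cvg sfin (fun k _ => l2_summand_ge0 x k).
move=> /cvgr0Pnorm_lt/(_ (th ^+ 2)); rewrite exprn_gt0// => /(_ isT)[M _ /(_ M)].
rewrite /= leqnn => /(_ isT) hM; exists M.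
have tE : (\sum_(0 <= k <oo) (normc (tail_seq M x k) ^+ 2)%:E =
   \sum_(M <= k <oo) (normc (x k) ^+ 2)%:E)%E.
  rewrite (nneseries_split 0 M) => [|k _]; last exact: l2_summand_ge0.
  rewrite big_mkord big1 => [|k _]; last first.
    by rewrite /tail_seq ltn_ord Normc.normc0 expr0n.
  rewrite add0e add0n eseries_cond [RHS]eseries_cond.
  by apply: eq_eseriesr => k /=; rewrite /tail_seq ltnNge => ->.
have sf : (\sum_(M <= k <oo) (normc (x k) ^+ 2)%:E)%E \is a fin_num.
  rewrite ge0_fin_numE ?l2_series_ge0//; apply: le_lt_trans sfin.
  rewrite [leRHS](nneseries_split 0 M) => [|k _]; last exact: l2_summand_ge0.
  rewrite add0n leeDr// big_mkord sume_ge0// => k _; exact: l2_summand_ge0.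
rewrite (l2_of_series (etrans tE (esym (fineK sf)))) lee_fin.
rewrite -(ler_pXn2r (ltn0Sn 1)) ?nnegrE ?sqrtr_ge0 ?(ltW th0)//.
rewrite sqr_sqrtr ?fine_ge0 ?l2_series_ge0//.
by apply: le_trans (ltW hM); rewrite ler_norm.
Qed.

Lemma l2_head_le m x : (l2 (head_seq m x) <= l2 x)%E.
Proof.
by apply: l2_mono => k; rewrite /head_seq; case: ifP; rewrite ?Normc.normc0 ?normc_ge0.
Qed.

Lemma l2_tail_le m x : (l2 (tail_seq m x) <= l2 x)%E.
Proof.
by apply: l2_mono => k; rewrite /tail_seq; case: ifP; rewrite ?Normc.normc0 ?normc_ge0.
Qed.

Lemma delta_comb m (u : 'I_m -> C) :
  \sum_j u j *: delta_seq j = fun k => if insub k is Some j then u j else 0.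
Proof.
apply/funext => k; rewrite fct_sumE.
under eq_bigr do rewrite fctE.
case: insubP => [j _ <-|km].
  rewrite (bigD1 j)//= big1 ?addr0 => [|i ij]; rewrite /delta_seq.
    by rewrite eqxx; exact: mulr1.
  by rewrite eq_sym (inj_eq val_inj) (negPf ij); exact: mulr0.
apply: big1 => j _; rewrite /delta_seq; case: eqP => [kj|_]; last exact: mulr0.
by rewrite kj ltn_ord in km.
Qed.

Lemma l2_delta_comb m (u : 'I_m -> C) :
  l2 (\sum_j u j *: delta_seq j) = (Num.sqrt (\sum_j normc (u j) ^+ 2))%:E.
Proof.
rewrite delta_comb (@l2_finite m) => [|k mk]; last first.
  by rewrite insubN// -leqNgt.
by congr (Num.sqrt _)%:E; apply: eq_bigr => k _; rewrite valK.
Qed.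

Lemma head_seqE m x : head_seq m x = \sum_(j < m) x j *: delta_seq j.
Proof.
rewrite delta_comb; apply/funext => k; rewrite /head_seq.
by case: insubP => [j -> <-|/negPf ->].
Qed.

Lemma l2_lty (x : nat -> C) : (l2 x < +oo)%E ->
  (\sum_(0 <= k <oo) (normc (x k) ^+ 2)%:E < +oo)%E.
Proof. by apply: lty_poweRy; rewrite invr_eq0 pnatr_eq0. Qed.

(** The parallelogram law bounds the square of a sum by twice the squares. *)
Lemma l2_lin a (x y : nat -> C) :
  (l2 x < +oo)%E -> (l2 y < +oo)%E -> (l2 (a *: x + y)%R < +oo)%E.
Proof.
move=> /l2_lty hx /l2_lty hy; apply: poweR_lty.
apply: (@le_lt_trans _ _ (\sum_(0 <= k <oo) ((2 * normc a ^+ 2)%:E * (normc (x k) ^+ 2)%:E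
    + 2%:E * (normc (y k) ^+ 2)%:E))%E).
  apply: lee_nneseries => k _; first by move=> _; exact: l2_summand_ge0.
  have := parallelogram (a * x k) (y k); rewrite Normc.normcM exprMn => h.
  rewrite -!EFinM -EFinD lee_fin -mulrA -mulrDr -h.
  by rewrite -[leLHS]addr0 lerD2l sqr_ge0.
have h0 k : (0 <= (normc (x k) ^+ 2)%:E)%E by exact: l2_summand_ge0.
have h1 k : (0 <= (normc (y k) ^+ 2)%:E)%E by exact: l2_summand_ge0.
have a0 : 0 <= 2 * normc a ^+ 2 by rewrite mulr_ge0 ?sqr_ge0.
rewrite nneseriesD => [|k _ _|k _ _]; try by rewrite mule_ge0// lee_fin.
rewrite !nneseriesZl => [|k _|k _]//; try exact: h0; try exact: h1.
by apply: lte_add_pinfty; rewrite lte_mul_pinfty ?lee_fin ?ge0_fin_numE// ltry.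
Qed.

Lemma l2_homog a (x : nat -> C) : (l2 x < +oo)%E -> l2 (a *: x) = ((normc a)%:E * l2 x)%E.
Proof.
move=> xoo; have xf : l2 x \is a fin_num by rewrite ge0_fin_numE// l2_ge0.
have h := l2_sqr (esym (fineK xf)).
rewrite -(fineK xf) -EFinM (@l2_of_series _ ((normc a * fine (l2 x)) ^+ 2)).
  by rewrite sqrtr_sqr ger0_norm// mulr_ge0 ?normc_ge0// fine_ge0// l2_ge0.
rewrite exprMn EFinM -h -nneseriesZl => [|k _]; last exact: l2_summand_ge0.
by apply: eq_eseriesr => k _; rewrite -EFinM -exprMn -Normc.normcM.
Qed.

End L2.

Section LinearSubspaces.
Context {F : fieldType} {E : lmodType F}.

Definition lin_indep m (v : 'I_m -> E) :=
  forall c : 'I_m -> F, \sum_i c i *: v i = 0 -> forall i, c i = 0.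

Lemma lin_indep_leq m q (v : 'I_m -> E) (f : 'I_q -> E) (D : 'M[F]_(m, q)) :
  lin_indep v -> (forall j, v j = \sum_i D j i *: f i) -> (m <= q)%N.
Proof.
move=> vi vD; rewrite leqNgt; apply/negP => qm.
have [u /eqP u0 uD] := kernel_row D qm; apply: u0.
apply/rowP => j; rewrite mxE; apply: (vi (u 0)) j.
under eq_bigr do rewrite vD scaler_sumr.
rewrite exchange_big big1//= => i _.
under eq_bigr do rewrite scalerA.
rewrite -scaler_suml; have /rowP/(_ i) := uD.
by rewrite !mxE => ->; rewrite scale0r.
Qed.

(** The basis is an independent family of members of [V] of maximal size; the
    size is bounded because [m] independent vectors in the span of [q] others
    force [m <= q]. *)
Lemma subspace_basis q (f : 'I_q -> E) (V : set E) :
    V 0 -> (forall a x y, V x -> V y -> V (a *: x + y)) ->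
    (forall x, V x -> exists c : 'I_q -> F, x = \sum_i c i *: f i) ->
  exists2 m, (m <= q)%N & exists v : 'I_m -> E,
    lin_indep v /\ V = [set \sum_i c i *: v i | c in [set: 'I_m -> F]].
Proof.
move=> V0 Vlin Vf.
pose P m := `[< exists v : 'I_m -> E, lin_indep v /\ forall j, V (v j) >].
have P0 : exists m, P m.
  exists 0%N; apply/asboolP; exists (fun=> 0); split; last by case.
  by move=> c _ [].
have Pq m : P m -> (m <= q)%N.
  move=> /asboolP[v [vi vV]].
  have [c cE] := choice (fun j => Vf _ (vV j)).
  by apply: (@lin_indep_leq m q v f (\matrix_(j, i) c j i)) => // j; rewrite cE;
    apply: eq_bigr => i _; rewrite mxE.
case: (ex_maxnP P0 Pq) => m /[dup] Pm /asboolP[v [vi vV]] mmax.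
exists m; first exact: Pq.
exists v; split => //; apply/seteqP; split => [x Vx|_ [c _ <-]]; last first.
  elim/big_ind: _ => // [x y Vx Vy|i _].
    by rewrite -[x]scale1r; exact: Vlin.
  by rewrite -[_ *: _]addr0; exact: Vlin.
have : ~~ P m.+1 by apply/negP => /mmax; rewrite ltnn.
apply: contraNP => nx; apply/asboolP.
exists (fun i => if unlift ord_max i is Some k then v k else x); split; last first.
  by move=> j; case: unliftP.
move=> c; rewrite big_ord_recr /= unlift_none.
under eq_bigr => i _.
  rewrite (_ : widen_ord (leqnSn m) i = lift ord_max i); last first.
    by apply: val_inj; rewrite /= /bump leqNgt ltn_ord.
  rewrite liftK.
  over.
move=> h.
have [c0|c0] := eqVneq (c ord_max) 0.
  move: h; rewrite c0 scale0r addr0 => /vi ci i.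
  by case: (unliftP ord_max i) => [j ->|->].
exfalso; apply: nx; exists (fun i => - (c ord_max)^-1 * c (lift ord_max i)) => //.
move/eqP: h; rewrite addrC addr_eq0 => /eqP h.
apply: (scalerI c0); rewrite h scaler_sumr -sumrN; apply: eq_bigr => i _.
by rewrite scalerA mulrA mulrN mulfV// mulN1r scaleNr.
Qed.

End LinearSubspaces.

(** * Diagonal embeddings of weighted l1 into l2 *)

Lemma hs_tr (R : rcfType) m n (A : 'M[R[i]]_(m, n)) : hs A^T = hs A.
Proof.
by rewrite /hs exchange_big; apply: eq_bigr => i _; apply: eq_bigr => j _; rewrite mxE.
Qed.

Lemma hs_mul_unitary (R : rcfType) m q n (A : 'M[R[i]]_(m, q)) (W : 'M[R[i]]_(q, n)) :
  W \is unitarymx -> hs (A *m W) = hs A.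
Proof.
move=> /unitarymxP WW; apply: (@complexI R); rewrite !hsE trmxC_mul mulmxA.
by rewrite -(mulmxA A) WW mulmx1.
Qed.

Section FiniteRank.
Context {R : realType} {E F : lmodType R[i]}.
Variable (nX : E -> \bar R).
Hypothesis nX_zero : nspace nX 0.
Hypothesis nX_lin : forall a x y, nspace nX x -> nspace nX y -> nspace nX (a *: x + y).
Variable A : E -> F.
Hypothesis A_lin : forall a x y, nspace nX x -> nspace nX y -> A (a *: x + y) = a *: A x + A y.

Lemma operator0 : A 0 = 0.
Proof.
have := A_lin 1 nX_zero nX_zero; rewrite !scale1r addr0 => h.
by apply: (addrI (A 0)); rewrite addr0 -h.
Qed.

Lemma operator_sum q (v : 'I_q -> E) (a : 'I_q -> R[i]) :
  (forall i, nspace nX (v i)) ->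
  nspace nX (\sum_i a i *: v i) /\ A (\sum_i a i *: v i) = \sum_i a i *: A (v i).
Proof.
move=> hv; elim: q v a hv => [|q IH] v a hv; first by rewrite !big_ord0 operator0.
rewrite !big_ord_recl.
have [h1 h2] := IH _ (fun i => a (lift ord0 i)) (fun i => hv (lift ord0 i)).
by split; [exact: nX_lin|rewrite A_lin// h2].
Qed.

Lemma finite_rank_lt q n (f : 'I_q -> F) : (q < n)%N ->
  (forall x, nspace nX x -> exists c : 'I_q -> R[i], A x = \sum_i c i *: f i) ->
  rank_lt nX A n.
Proof.
move=> qn Af.
have [|a _ _ [x hx <-] [y hy <-]|_ [x hx <-]|m mq [v [vi vE]]] :=
    @subspace_basis _ F q f (A @` nspace nX).
- by exists 0; rewrite ?operator0.
- by exists (a *: x + y); [exact: nX_lin|exact: A_lin].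
- exact: Af.
by exists m; [exact: leq_ltn_trans qn|exists v].
Qed.

End FiniteRank.

Section Diagonal.
Context {R : realType} {E : lmodType R[i]}.
Local Notation C := R[i].
Local Notation normc := (@Normc.normc R).
Local Notation l2 := (@l2_norm R).

(** What the s-numbers below need of the identity of a weighted l1 space [nX]
    into l2 [nY], where [coef] are the coordinates and [e] the unit vectors.
    As the weights increase, the part of a vector beyond [N] has a weighted l1
    norm of at least [w N] times its l2 norm: this is [wl_tail]. Unbounded
    weights make the embedding compact. *)
Record weighted_l1_in_l2 (nX nY : E -> \bar R) (w : nat -> R)
    (coef : nat -> E -> C) (e : nat -> E) : Prop := {
  wl_ge1 : forall k, 1 <= w k;
  wl_homo : {homo w : i j / (i <= j)%N >-> i <= j};
  wl_unbounded : forall M, exists k, M <= w k;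
  wl_X_lin : forall a x y, (nX x < +oo)%E -> (nX y < +oo)%E -> (nX (a *: x + y)%R < +oo)%E;
  wl_X_homog : forall a x, (nX x < +oo)%E -> nX (a *: x) = ((normc a)%:E * nX x)%E;
  wl_Y_triangle : forall x y, (nY (x + y)%R <= nY x + nY y)%E;
  wl_Y_homog : forall a x, nY (a *: x) = ((normc a)%:E * nY x)%E;
  wl_Y_eq0 : forall x, nY x = 0%E -> x = 0;
  wl_coef_X : forall k a x y, (nX x < +oo)%E -> (nX y < +oo)%E ->
    coef k (a *: x + y) = a * coef k x + coef k y;
  wl_coef_Y : forall k a x y, (nY x < +oo)%E -> (nY y < +oo)%E ->
    coef k (a *: x + y) = a * coef k x + coef k y;
  wl_coef_comb : forall N (a : 'I_N -> C) j,
    coef j (\sum_(k < N) a k *: e k) = if insub j is Some k then a k else 0;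
  wl_X_comb : forall N (a : 'I_N -> C),
    nX (\sum_(k < N) a k *: e k) = (\sum_(k < N) w k * normc (a k))%:E;
  wl_Y_comb : forall N (a : 'I_N -> C),
    nY (\sum_(k < N) a k *: e k) = (Num.sqrt (\sum_k normc (a k) ^+ 2))%:E;
  wl_bessel : forall N y,
    ((Num.sqrt (\sum_(k < N) normc (coef k y) ^+ 2))%:E <= nY y)%E;
  wl_tail : forall N x,
    ((\sum_(k < N) w k * normc (coef k x))%:E
      + (w N)%:E * nY (x - \sum_(k < N) coef k x *: e k)%R <= nX x)%E
}.

Context (nX nY : E -> \bar R) (w : nat -> R) (coef : nat -> E -> C) (e : nat -> E).
Hypothesis H : weighted_l1_in_l2 nX nY w coef e.

Let w_gt0 k : 0 < w k. Proof. exact: lt_le_trans ltr01 (wl_ge1 H k). Qed.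
Let w_ge0 k : 0 <= w k. Proof. exact: ltW (w_gt0 k). Qed.

Definition wsum n := \sum_(k < n) w k ^+ 2.

Lemma wsum_gt0 n : (0 < n)%N -> 0 < wsum n.
Proof.
case: n => // n _; rewrite /wsum big_ord_recl ltr_pwDl ?exprn_gt0//.
by apply: sumr_ge0 => i _; rewrite sqr_ge0.
Qed.

Let nY_ge0 y : (0 <= nY y)%E.
Proof. by have := wl_bessel H 0 y; rewrite big_ord0 sqrtr0. Qed.

Let nY_tail_ge0 N x : (0 <= (w N)%:E * nY (x - \sum_(k < N) coef k x *: e k)%R)%E.
Proof. by rewrite mule_ge0// lee_fin. Qed.

Let nX_ge0 x : (0 <= nX x)%E.
Proof. by apply: le_trans (nY_tail_ge0 0 x) (le_trans _ (wl_tail H 0 x)); rewrite leeDr// lee_fin big_ord0. Qed.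

Let nX_partial N x : ((\sum_(k < N) w k * normc (coef k x))%:E <= nX x)%E.
Proof. by apply: le_trans (wl_tail H N x); rewrite leeDl. Qed.

Let nY_tail N x : (nY (x - \sum_(k < N) coef k x *: e k)%R <= (w N)^-1%:E * nX x)%E.
Proof.
rewrite muleC lee_pdivlMr// muleC; apply: le_trans (wl_tail H N x).
by rewrite leeDr// lee_fin; apply: sumr_ge0 => k _; rewrite mulr_ge0 ?normc_ge0.
Qed.

Let nX0 : nX 0 = 0%E.
Proof. by have := wl_X_comb H (fun i : 'I_0 => 0); rewrite !big_ord0. Qed.

Let nY0 : nY 0 = 0%E.
Proof. by have := wl_Y_comb H (fun i : 'I_0 => 0); rewrite !big_ord0 sqrtr0. Qed.

Let nX_comb_lty N (a : 'I_N -> C) : (nX (\sum_(k < N) a k *: e k)%R < +oo)%E.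
Proof. by rewrite (wl_X_comb H) ltry. Qed.

Let nY_comb_lty N (a : 'I_N -> C) : (nY (\sum_(k < N) a k *: e k)%R < +oo)%E.
Proof. by rewrite (wl_Y_comb H) ltry. Qed.

Let nY_lin a x y : (nY x < +oo)%E -> (nY y < +oo)%E -> (nY (a *: x + y)%R < +oo)%E.
Proof.
move=> hx hy; apply: le_lt_trans (wl_Y_triangle H _ _) _.
rewrite lte_add_pinfty// (wl_Y_homog H).
have : nY x \is a fin_num by rewrite ge0_fin_numE.
by move=> /fineK <-; rewrite -EFinM ltry.
Qed.

Let nX_sum_lty q (v : 'I_q -> E) (a : 'I_q -> C) :
  (forall i, (nX (v i) < +oo)%E) -> (nX (\sum_i a i *: v i)%R < +oo)%E.
Proof.
move=> hv; elim/big_ind: _ => [|x y hx hy|i _]; first by rewrite nX0.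
  by rewrite -[x]scale1r; apply: (wl_X_lin H).
by rewrite -[_ *: _]addr0; apply: (wl_X_lin H); rewrite ?nX0.
Qed.

Let coef0X k : coef k 0 = 0.
Proof.
have := wl_coef_comb H (fun i : 'I_0 => 0) k; rewrite big_ord0 => ->.
by rewrite insubN.
Qed.

Let coef_sumX k q (v : 'I_q -> E) (a : 'I_q -> C) :
  (forall i, (nX (v i) < +oo)%E) ->
  coef k (\sum_i a i *: v i) = \sum_i a i * coef k (v i).
Proof.
move=> hv; elim: q v a hv => [|q IH] v a hv; first by rewrite !big_ord0 coef0X.
rewrite !big_ord_recl (wl_coef_X H)// ?IH//.
exact: (nX_sum_lty (fun i => a (lift ord0 i)) (fun i => hv (lift ord0 i))).
Qed.

Let nY_sum_lty q (v : 'I_q -> E) (a : 'I_q -> C) :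
  (forall i, (nY (v i) < +oo)%E) -> (nY (\sum_i a i *: v i)%R < +oo)%E.
Proof.
move=> hv; elim/big_ind: _ => [|x y hx hy|i _]; first by rewrite nY0.
  by rewrite -[x]scale1r; apply: nY_lin.
by rewrite -[_ *: _]addr0; apply: nY_lin; rewrite ?nY0.
Qed.

Let coef_sumY k q (v : 'I_q -> E) (a : 'I_q -> C) :
  (forall i, (nY (v i) < +oo)%E) ->
  coef k (\sum_i a i *: v i) = \sum_i a i * coef k (v i).
Proof.
move=> hv; elim: q v a hv => [|q IH] v a hv; first by rewrite !big_ord0 coef0X.
rewrite !big_ord_recl (wl_coef_Y H)// ?IH//.
exact: (nY_sum_lty (fun i => a (lift ord0 i)) (fun i => hv (lift ord0 i))).
Qed.

Let nY_sum_le q (v : 'I_q -> E) (a : 'I_q -> C) (b : 'I_q -> R) :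
  (forall i, (nY (v i) <= (b i)%:E)%E) ->
  (nY (\sum_i a i *: v i)%R <= (\sum_i normc (a i) * b i)%:E)%E.
Proof.
move=> hv; elim: q v a b hv => [|q IH] v a b hv; first by rewrite !big_ord0 nY0.
rewrite !big_ord_recl; apply: le_trans (wl_Y_triangle H _ _) _.
rewrite EFinD leeD//; last by apply: IH => i; exact: hv.
by rewrite (wl_Y_homog H) EFinM lee_wpmul2l// lee_fin normc_ge0.
Qed.

Let comb_inj N (a : 'I_N -> C) : \sum_(k < N) a k *: e k = 0 -> forall k, a k = 0.
Proof. by move=> a0 k; have := wl_coef_comb H a k; rewrite a0 coef0X valK. Qed.

Let wnorm_le n (a : 'I_n -> C) :
  \sum_(k < n) w k * normc (a k) <= Num.sqrt (wsum n) * Num.sqrt (\sum_k normc (a k) ^+ 2).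
Proof.
have h0 : 0 <= \sum_(k < n) w k * normc (a k).
  by apply: sumr_ge0 => k _; rewrite mulr_ge0 ?normc_ge0.
have s0 : 0 <= wsum n by apply: sumr_ge0 => k _; exact: sqr_ge0.
rewrite -sqrtrM// -(ler_pXn2r (ltn0Sn 1)) ?nnegrE ?sqrtr_ge0//.
rewrite sqr_sqrtr ?cauchy_schwarz_sum// mulr_ge0//.
by apply: sumr_ge0 => k _; exact: sqr_ge0.
Qed.

(** * Bernstein numbers *)

(** On the span of the first [n] unit vectors, the Cauchy-Schwarz inequality
    bounds the weighted l1 norm by [Num.sqrt (wsum n)] times the l2 norm. *)
Lemma bernstein_ge n : (0 < n)%N ->
  ((Num.sqrt (wsum n))^-1%:E <= bernstein_number nX nY idfun n)%E.
Proof.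
move=> n0; set L := [set \sum_i c i *: e (val i) | c in [set: 'I_n -> C]].
apply: le_ereal_sup_tmp; eexists.
  exists L => //; split.
    exists (fun i : 'I_n => e i); split => // c; exact: comb_inj.
  by move=> _ [c _ <-]; exact: nX_comb_lty.
apply: le_ereal_inf_tmp => _ [x [[c _ <-]] /andP[x0 _] <-].
move: x0; rewrite (wl_X_comb H) (wl_Y_comb H) lte_fin => x0.
rewrite inver gt_eqF// -EFinM lee_fin ler_pdivlMr//.
have S0 := wsum_gt0 n0.
by rewrite mulrC ler_pdivrMr ?sqrtr_gt0// [leRHS]mulrC; exact: wnorm_le.
Qed.

(** Suppose that [b * nX x <= nY x] on an [n]-dimensional space, with [b] above
    the bound. Truncating the coordinates at [N] costs [(w N)^-1 * nX x] and is
    harmless for large [N]. An orthonormal basis [U] of the truncated space is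
    then a contraction of l2 into l1 with the weights [b' * w], so that its
    weighted Hilbert-Schmidt norm is at most 1. But the squared column norms of
    [U] are at most 1 and add up to [n], and [bathtub] makes the weighted norm
    at least [b' ^+ 2 * wsum n], which exceeds 1. *)
Lemma bernstein_le n : (0 < n)%N ->
  (bernstein_number nX nY idfun n <= (Num.sqrt (wsum n))^-1%:E)%E.
Proof.
move=> n0; apply: ge_ereal_sup => _ [L [[v [vi LE]] LX] <-].
set c0 := (Num.sqrt (wsum n))^-1.
rewrite leNgt; apply/negP => hinf.
have S0 := wsum_gt0 n0.
have c0gt : 0 < c0 by rewrite invr_gt0 sqrtr_gt0.
have [b [b1 b2]] : exists b, c0 < b /\ (b%:E <= ereal_inf [set (nY (idfun x) / nX x)%E
     | x in L `&` [set x | (0 < nX x <= 1)%E]])%E.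
  move: hinf; case: (ereal_inf _) => [t||//] h.
    by exists t; rewrite -lte_fin.
  by exists (c0 + 1); rewrite ltrDl ltr01 leey.
have Lb x : L x -> (b%:E * nX x <= nY x)%E.
  move=> Lx; have xf : nX x \is a fin_num by rewrite ge0_fin_numE// LX.
  have [x0|xn0] := eqVneq (nX x) 0%E; first by rewrite x0 mule0.
  set r := fine (nX x); have rE : nX x = r%:E by rewrite fineK.
  have r0 : 0 < r by rewrite -lte_fin -rE lt0e xn0 nX_ge0.
  pose x' := ((r^-1)%:C)%C *: x.
  have rn : normc (r^-1)%:C%C = r^-1 by rewrite normc_real ger0_norm// invr_ge0 ltW.
  have hX : nX x' = 1%E.
    by rewrite (wl_X_homog H) ?LX// rn rE -EFinM mulVf// gt_eqF.
  have := b2 => /ereal_infP/(_ (nY (idfun x') / nX x')%E).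
  rewrite hX inve1 mule1 /= (wl_Y_homog H) rn rE muleC => h.
  rewrite -lee_pdivlMr//; apply: h; exists x'; last first.
    by rewrite hX inve1 mule1 /= (wl_Y_homog H) rn muleC.
  split; last by rewrite /= hX lte01 lexx.
  have := Lx; rewrite {1}LE => -[c _ cE].
  rewrite LE; exists (fun i => (r^-1)%:C%C * c i) => //.
  by rewrite /x' -cE scaler_sumr; apply: eq_bigr => i _; rewrite scalerA.
have [N hN] := wl_unbounded H (2 / (b - c0)).
have bc0 : 0 < b - c0 by rewrite subr_gt0.
(* so small a loss leaves b above c0 *)
have d0 : (w N)^-1 <= (b - c0) / 2.
  by rewrite invf_ple ?posrE ?divr_gt0// invf_div.
set b' := b - (w N)^-1.
have b'c : c0 < b' by rewrite /b'; lra.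
have b'0 : 0 < b' by exact: lt_trans b'c.
have LF x : L x -> (b'%:E * nX x <= (Num.sqrt (\sum_(k < N) normc (coef k x) ^+ 2))%:E)%E.
  move=> Lx; have xf : nX x \is a fin_num by rewrite ge0_fin_numE// LX.
  have h1 := Lb x Lx.
  have h2 : (nY x <= nY (\sum_(k < N) coef k x *: e k)%R + (w N)^-1%:E * nX x)%E.
    rewrite -[x in nY x](subrK (\sum_(k < N) coef k x *: e k)).
    by rewrite addrC; apply: le_trans (wl_Y_triangle H _ _) _; rewrite leeD2l.
  rewrite (wl_Y_comb H) in h2; have := le_trans h1 h2.
  by rewrite -(fineK xf) -!EFinM -EFinD !lee_fin /b' mulrBl lerBlDr.
pose M : 'M[C]_(n, N) := \matrix_(i, k) coef k (v i).
have vX i : (nX (v i) < +oo)%E.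
  apply: LX; rewrite LE; exists (fun j => (j == i)%:R) => //.
  by rewrite (bigD1 i)//= eqxx scale1r big1 ?addr0// => j /negPf ->; rewrite scale0r.
have coefM (u : 'rV[C]_n) (k : 'I_N) : coef k (\sum_i u 0 i *: v i) = (u *m M) 0 k.
  by rewrite coef_sumX// mxE; apply: eq_bigr => i _; rewrite mxE.
have Lu (u : 'rV[C]_n) : L (\sum_i u 0 i *: v i) by rewrite LE; exists (u 0).
have rfM : row_free M.
  apply/row_freeP; apply/row_freeP; rewrite -kermx_eq0; apply/eqP/row_matrixP => i.
  rewrite row0; set u := row i _.
  have uM : u *m M = 0 by apply/sub_kermxP; exact: row_sub.
  set x := \sum_i u 0 i *: v i.
  have : (b'%:E * nX x <= 0)%E.
    apply: le_trans (LF _ (Lu u)) _; rewrite big1 ?sqrtr0// => k _.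
    by rewrite coefM uM mxE Normc.normc0 expr0n.
  rewrite pmule_rle0 ?lte_fin// => nx0.
  have ny0 : nY x = 0%E.
    apply/eqP; rewrite eq_le nY_ge0 andbT.
    have := nY_tail 0 x; rewrite big_ord0 subr0 => /le_trans; apply.
    by rewrite mule_ge0_le0// lee_fin invr_ge0.
  have x0 : x = 0 by exact: (wl_Y_eq0 H).
  by apply/rowP => j; rewrite [RHS]mxE; apply: (vi (u 0)).
have nN : (n <= N)%N by move: rfM; rewrite -row_leq_rank => /leq_trans; apply; exact: rank_leq_col.
pose U := schmidt M.
have U1 : U \is unitarymx by rewrite schmidt_unitarymx.
have [D UD] : exists D, U = D *m M.
  by apply/submxP; rewrite /U eqmx_schmidt_free.
have colU k : \sum_i normc (U i k) ^+ 2 <= 1 by exact: unitary_col_le1.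
have hU : b' ^+ 2 * \sum_(k < N) w k ^+ 2 * \sum_i normc (U i k) ^+ 2 <= 1.
  rewrite mulr_sumr.
  have := @hs_weighted_le1 R N n (fun k : 'I_N => b' * w k) U^T.
  have -> : \sum_(k < N) (b' * w k) ^+ 2 * \sum_j normc (U^T k j) ^+ 2 =
    \sum_(k < N) b' ^+ 2 * (w k ^+ 2 * \sum_i normc (U i k) ^+ 2).
    apply: eq_bigr => k _; rewrite exprMn -mulrA; congr (_ * (_ * _)).
    by apply: eq_bigr => j _; rewrite mxE.
  apply=> [k|x]; first by rewrite mulr_ge0 ?ltW.
  pose u := x^T *m D.
  have uk (k : 'I_N) : coef k (\sum_i u 0 i *: v i) = (U^T *m x) k 0.
    by rewrite coefM /u -mulmxA -UD -[x in RHS]trmxK -trmx_mul [RHS]mxE.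
  have hxE : hs x = \sum_(k < N) normc ((U^T *m x) k 0) ^+ 2.
    transitivity (hs (x^T *m U)); first by rewrite hs_mul_unitary// hs_tr.
    rewrite -hs_tr trmx_mul trmxK; apply: eq_bigr => k _.
    by rewrite big_ord1.
  have h0 : 0 <= \sum_(k < N) b' * w k * normc ((U^T *m x) k 0).
    by apply: sumr_ge0 => k _; rewrite !mulr_ge0 ?normc_ge0// ltW.
  rewrite -[hs x]sqr_sqrtr ?hs_ge0// ler_pXn2r ?nnegrE ?sqrtr_ge0//.
  rewrite -lee_fin hxE.
  under eq_bigr do rewrite -mulrA -uk.
  under [in leRHS]eq_bigr do rewrite -uk.
  apply: le_trans (LF _ (Lu u)); rewrite -mulr_sumr EFinM lee_wpmul2l// lee_fin ltW//.
have : wsum n <= \sum_(k < N) w k ^+ 2 * \sum_i normc (U i k) ^+ 2.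
  pose q (k : nat) : R := if insub k is Some k' then \sum_i normc (U i k') ^+ 2 else 0.
  have qE (k : 'I_N) : q k = \sum_i normc (U i k) ^+ 2 by rewrite /q valK.
  have := @bathtub R n N (fun k => w k ^+ 2) q.
  under [X in _ -> _ -> _ -> _ -> _ <= X]eq_bigr do rewrite qE.
  apply=> [k|i j ij|k kN|]; first exact: sqr_ge0.
  - by rewrite ler_sqr ?nnegrE// (wl_homo H).
  - rewrite -[k]/(val (Ordinal kN)) qE colU andbT.
    by apply: sumr_ge0 => i _; exact: sqr_ge0.
  - under eq_bigr do rewrite qE.
    by rewrite exchange_big -/(hs U) hs_unitary_rows.
move=> hS; have : b' ^+ 2 * wsum n <= 1.
  by apply: le_trans hU; rewrite ler_wpM2l// sqr_ge0.
apply/negP; rewrite -ltNge.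
have -> : 1 = c0 ^+ 2 * wsum n by rewrite /c0 exprVn sqr_sqrtr ?(ltW S0)// mulVf// gt_eqF.
by rewrite ltr_pM2r// ltr_pXn2r ?nnegrE ?ltW.
Qed.

(** * Kolmogorov and approximation numbers *)

Let e_comb m (k : 'I_m) : e k = \sum_(l < m) (l == k)%:R *: e l.
Proof.
by rewrite (bigD1 k)//= eqxx scale1r big1 ?addr0// => j /negPf ->; rewrite scale0r.
Qed.

Let nX_e k : nX (e k) = (w k)%:E.
Proof.
rewrite (e_comb (Ordinal (ltnSn k))) (wl_X_comb H) big_ord_recr /= big1 => [|i _].
  by rewrite add0r eqxx Normc.normc1 mulr1.
have /negPf -> : widen_ord (leqnSn k) i != Ordinal (ltnSn k).
  by rewrite -val_eqE/= ltn_eqF.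
by rewrite Normc.normc0 mulr0.
Qed.

Let nX_e1 k : nX ((w k)^-1%:C%C *: e k) = 1%E.
Proof.
rewrite (wl_X_homog H) ?nX_e ?ltry// normc_real ger0_norm ?invr_ge0//.
by rewrite -EFinM mulVf// gt_eqF.
Qed.

Let nY_e k : (nY (e k) < +oo)%E.
Proof. by rewrite (e_comb (Ordinal (ltnSn k))) nY_comb_lty. Qed.

Let coef_e k l : coef l (e k) = (l == k)%:R.
Proof.
rewrite (e_comb (Ordinal (ltnSn k))) (wl_coef_comb H).
case: insubP => [i _ <-|]; first by rewrite -val_eqE.
by rewrite ltnS -ltnNge => kl; rewrite gtn_eqF.
Qed.

(** If the [m] vectors [(w k)^-1 *: e k] all have the same distance from a
    space of dimension [n - 1] spanned by combinations of them, then this is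
    its square: with the weights [w k ^+ 2] the squared distances add up to
    [m - (n - 1)]. *)
Definition tail_ratio n m := (m.+1 - n)%:R / wsum m.

Lemma tail_ratio_ge0 n m : 0 <= tail_ratio n m.
Proof. by rewrite divr_ge0// sumr_ge0// => k _; exact: sqr_ge0. Qed.

(** By [hs_sub1_rank] the squared distances of the unit vectors from the span
    add up to at least [m - q >= m.+1 - n]. They are those of the normalised
    vectors [(w k)^-1 *: e k] weighted by [w k ^+ 2], so that one of the latter
    is at least the mean [tail_ratio n m]. *)
Lemma span_far q n m (v : 'I_q -> E) : (q < n)%N -> (n <= m)%N ->
    (forall i, (nY (v i) < +oo)%E) ->
  exists k : nat, forall c : 'I_q -> C,
    ((Num.sqrt (tail_ratio n m))%:E <= nY ((w k)^-1%:C%C *: e k - \sum_i c i *: v i)%R)%E.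
Proof.
move=> qn nm vY; apply: contrapT => /forallNP far.
have {far} /choice[c hc] (k : 'I_m) : exists c : 'I_q -> C,
    (nY ((w k)^-1%:C%C *: e k - \sum_i c i *: v i)%R < (Num.sqrt (tail_ratio n m))%:E)%E.
  by have /existsNP[c /negP] := far k; rewrite -ltNge => h; exists c.
have m0 : (0 < m)%N by apply: leq_trans nm; apply: leq_ltn_trans qn.
pose z (k : 'I_m) := (w k)^-1%:C%C *: e k + \sum_i (- c k i) *: v i.
have zE k : z k = (w k)^-1%:C%C *: e k - \sum_i c k i *: v i.
  by rewrite /z -sumrN; congr (_ + _); apply: eq_bigr => i _; rewrite scaleNr.
pose D : 'M[C]_(m, q) := \matrix_(k, i) ((w k)%:C%C * c k i).
pose V : 'M[C]_(q, m) := \matrix_(i, l) coef l (v i).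
have coefz (k l : 'I_m) : (1%:M - D *m V) k l = (w k)%:C%C * coef l (z k).
  rewrite /z (wl_coef_Y H) ?nY_sum_lty// coef_sumY// coef_e.
  have wk : (w k)%:C%C * (w k)^-1%:C%C = 1 :> C.
    by rewrite -rmorphM /= mulfV ?gt_eqF.
  rewrite [in RHS]mulrDr [in RHS]mulrA wk mul1r.
  rewrite !mxE eq_sym.
  congr (_ + _); rewrite mulr_sumr -sumrN.
  by apply: eq_bigr => i _; rewrite !mxE; ring.
have := hs_sub1_rank D V; apply/negP; rewrite -ltNge.
have hz (k : 'I_m) : \sum_(l < m) normc (coef l (z k)) ^+ 2 < tail_ratio n m.
  have := hc k; rewrite -zE => /(le_lt_trans (wl_bessel H m (z k))).
  rewrite lte_fin -(ltr_pXn2r (ltn0Sn 1)) ?nnegrE ?sqrtr_ge0// !sqr_sqrtr ?tail_ratio_ge0//.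
  by apply: sumr_ge0 => l _; exact: sqr_ge0.
apply: (@lt_le_trans _ _ (\sum_(k < m) w k ^+ 2 * tail_ratio n m)).
  apply: ltr_sum => [|k _]; first by apply/hasP; exists (Ordinal m0) => //; rewrite mem_index_enum.
  under eq_bigr do rewrite coefz Normc.normcM normc_real exprMn ger0_norm//.
  by rewrite -mulr_sumr ltr_pM2l// exprn_gt0.
rewrite -mulr_suml -/(wsum m) mulrC mulfVK ?gt_eqF ?wsum_gt0//.
rewrite -natrB; last by rewrite ltnW// (leq_trans qn).
by rewrite ler_nat -(subSS q m) leq_sub2l.
Qed.

Lemma kolmogorov_ge n m : (0 < n <= m)%N ->
  ((Num.sqrt (tail_ratio n m))%:E <= kolmogorov_number nX nY idfun n)%E.
Proof.
move=> /andP[n0 nm]; apply: le_ereal_inf_tmp => _ [L [[v [vi LE]] LY] <-].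
have vY i : (nY (v i) < +oo)%E.
  apply: LY; rewrite LE; exists (fun j => (j == i)%:R) => //.
  by rewrite (bigD1 i)//= eqxx scale1r big1 ?addr0// => j /negPf ->; rewrite scale0r.
have [|k hk] := span_far _ nm vY; first by rewrite prednK.
apply: le_ereal_sup_tmp; eexists.
  by exists ((w k)^-1%:C%C *: e k) => //; rewrite /unit_ball /= nX_e1.
apply: le_ereal_inf_tmp => _ [y Ly <-]; move: Ly; rewrite LE => -[c _ <-].
exact: hk.
Qed.

Lemma approximation_ge n m : (n <= m)%N ->
  ((Num.sqrt (tail_ratio n m))%:E <= approximation_number nX nY idfun n)%E.
Proof.
move=> nm; apply: le_ereal_inf_tmp => _ [A [[Alin [M AM]] [q qn [v [vi AE]]]] <-].
have vA i : exists2 x, nspace nX x & A x = v i.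
  have : (A @` nspace nX) (v i).
    rewrite AE; exists (fun j => (j == i)%:R) => //.
    by rewrite (bigD1 i)//= eqxx scale1r big1 ?addr0// => j /negPf ->; rewrite scale0r.
  by case=> x hx <-; exists x.
have vY i : (nY (v i) < +oo)%E.
  have [x hx <-] := vA i; apply: le_lt_trans (AM x hx) _.
  have : nX x \is a fin_num by rewrite ge0_fin_numE.
  by move=> /fineK <-; rewrite -EFinM ltry.
have [k hk] := span_far qn nm vY.
have kX : nspace nX ((w k)^-1%:C%C *: e k) by rewrite /nspace /= nX_e1 ltry.
apply: le_ereal_sup_tmp; eexists.
  by exists ((w k)^-1%:C%C *: e k) => //; rewrite /unit_ball /= nX_e1.
have : (A @` nspace nX) (A ((w k)^-1%:C%C *: e k)) by exists ((w k)^-1%:C%C *: e k).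
by rewrite AE => -[c _ <-]; exact: hk.
Qed.

(** [M] is the first index from [n] on at which [tail_ratio n] does not increase
    any more, that is [wsum M <= (M.+1 - n) * w M ^+ 2]. Minimality yields the
    upper bound on the earlier weights. *)
Lemma optimal_truncation n : (0 < n)%N -> exists M, [/\ (n <= M)%N,
  forall k, (k < M)%N -> tail_ratio n M * w k ^+ 2 <= 1 & 1 <= tail_ratio n M * w M ^+ 2].
Proof.
move=> n0.
pose P M := (n <= M)%N && (wsum M <= (M.+1 - n)%:R * w M ^+ 2).
have exP : exists M, P M.
  (* the first 2n weights are at most w M / 2, so that together their squares
     do not exceed n / 2 times w M ^+ 2 *)
  have [k hk] := wl_unbounded H (2 * w n.*2).
  pose M := maxn k n.*2; have kM : (k <= M)%N := leq_maxl _ _.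
  have nM : (n.*2 <= M)%N := leq_maxr _ _.
  have hM : 2 * w n.*2 <= w M by apply: le_trans hk _; exact: (wl_homo H).
  exists M; apply/andP; split; first by apply: leq_trans nM; rewrite -addnn leq_addr.
  rewrite /wsum -(subnKC nM) big_split_ord /= (subnKC nM).
  have h1 : \sum_(i < n.*2) w i ^+ 2 <= (n.*2)%:R * w n.*2 ^+ 2.
    rewrite mulr_natl -[X in _ <= _ *+ X]card_ord -sumr_const; apply: ler_sum => i _.
    by rewrite ler_sqr ?nnegrE// (wl_homo H)// ltnW.
  have h2 : \sum_(i < M - n.*2) w (n.*2 + i)%N ^+ 2 <= (M - n.*2)%:R * w M ^+ 2.
    rewrite mulr_natl -[X in _ <= _ *+ X]card_ord -sumr_const; apply: ler_sum => i _.
    rewrite ler_sqr ?nnegrE// (wl_homo H)//.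
    by rewrite ltnW// -ltn_subRL.
  have h3 : w n.*2 ^+ 2 <= w M ^+ 2 / 4 by have := w_ge0 n.*2; nra.
  have h4 : 0 <= w M ^+ 2 by exact: sqr_ge0.
  apply: le_trans (lerD h1 h2) _.
  move: (w n.*2 ^+ 2) (w M ^+ 2) h3 h4 => a b h3 h4.
  rewrite natrB// -mul2n natrM natrB; last by rewrite (leq_trans _ (leqW nM))// -addnn leq_addr.
  rewrite -[M.+1]addn1 natrD.
  have : 0 <= n%:R :> R by [].
  move: (n%:R : R) (M%:R : R) => x y x0.
  have : 0 <= x * (b / 4 - a) by rewrite mulr_ge0// subr_ge0.
  nra.
have [M /andP[nM hM] Mmin] := ex_minnP exP.
have SM : 0 < wsum M by rewrite wsum_gt0// (leq_trans n0).
exists M; split=> // [k kM|]; last first.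
  by rewrite /tail_ratio mulrAC ler_pdivlMr// mul1r.
rewrite /tail_ratio mulrAC ler_pdivrMr// mul1r.
case: M nM hM Mmin SM kM => [|M] nM hM Mmin SM kM //.
apply: (@le_trans _ _ ((M.+2 - n)%:R * w M ^+ 2)).
  by rewrite ler_wpM2l// ler_sqr ?nnegrE// (wl_homo H).
move: nM; rewrite leq_eqVlt => /predU1P[nE|nM].
  rewrite nE subSnn mul1r /wsum big_ord_recr /= lerDr.
  by apply: sumr_ge0 => i _; exact: sqr_ge0.
have : ~~ P M by apply/negP => /Mmin; rewrite ltnn.
rewrite /P -ltnS nM /= -ltNge => h.
rewrite subSn; last exact: leqW.
by rewrite -natr1 mulrDl mul1r /wsum big_ord_recr /= lerD2r ltW.
Qed.

(** The optimal subspace. With [rho2 := tail_ratio n M], [parseval_frame] yields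
    an orthonormal family [f] of [n - 1] vectors in the span of the first [M]
    unit vectors such that the projection [P] on it has
    [nY (e k - P (e k)) = rho * w k] for all [k < M]: the normalised vectors are
    all at the distance [rho]. The tail of [x] beyond [M] obeys the same bound
    since [1 <= rho * w M], and [wl_tail] adds the two estimates. *)
Lemma low_rank_projection n : (0 < n)%N -> exists M, exists f : 'I_n.-1 -> E,
  exists P : E -> E, [/\ (n <= M)%N, lin_indep f,
    forall i, (nY (f i) < +oo)%E,
    forall a x y, nspace nX x -> nspace nX y -> P (a *: x + y) = a *: P x + P y &
    forall x, (exists c, P x = \sum_i c i *: f i) /\
       (nY (x - P x)%R <= (Num.sqrt (tail_ratio n M))%:E * nX x)%E].
Proof.
move=> n0; have [M [nM lo hi]] := optimal_truncation n0.
set rho2 := tail_ratio n M in lo hi *; set rho := Num.sqrt rho2.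
have M0 : (0 < M)%N by exact: leq_trans nM.
have rho20 : 0 <= rho2 by exact: tail_ratio_ge0.
have rho0 : 0 <= rho by exact: sqrtr_ge0.
pose t k := 1 - rho2 * w k ^+ 2.
have [k kM||W [Wo Wn]] := @parseval_frame R n.-1 M t.
- by rewrite /t subr_ge0 lo// lerBlDr lerDl mulr_ge0// sqr_ge0.
- rewrite /t sumrB sumr_const card_ord -mulr_sumr -/(wsum M) /rho2 /tail_ratio.
  rewrite mulfVK ?gt_eqF ?wsum_gt0// -[1 *+ M]/(M%:R).
  case: n n0 nM {lo hi rho2 rho rho20 rho0 t} => // n _ nM /=.
  by rewrite subSS natrB ?(ltnW nM)//; ring.
pose f (i : 'I_n.-1) := \sum_(k < M) (W i k)%:C%C *: e k.
pose P x := \sum_(i < n.-1) (\sum_(k < M) (W i k)%:C%C * coef k x) *: f i.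
exists M, f, P.
have fE (c : 'I_n.-1 -> C) : \sum_i c i *: f i =
    \sum_(k < M) (\sum_i c i * (W i k)%:C%C) *: e k.
  under eq_bigr do rewrite scaler_sumr.
  rewrite exchange_big; apply: eq_bigr => k _; rewrite scaler_suml.
  by apply: eq_bigr => i _; rewrite scalerA.
split=> //.
- move=> c; rewrite fE => /comb_inj c0 j.
  transitivity (\sum_(k < M) (\sum_i c i * (W i k)%:C%C) * (W j k)%:C%C); last first.
    by apply: big1 => k _; rewrite c0 mul0r.
  under eq_bigr do rewrite mulr_suml.
  rewrite exchange_big (bigD1 j)//= [X in _ + X]big1 ?addr0 => [|i ij].
    under eq_bigr do rewrite -mulrA -rmorphM.
    by rewrite -mulr_sumr -rmorph_sum Wo// eqxx rmorph1 mulr1.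
  under eq_bigr do rewrite -mulrA -rmorphM.
  by rewrite -mulr_sumr -rmorph_sum Wo// val_eqE (negPf ij) rmorph0 mulr0.
- by move=> i; exact: nY_comb_lty.
- move=> a x y hx hy; rewrite /P scaler_sumr -big_split; apply: eq_bigr => i _ /=.
  rewrite scalerA -scalerDl; congr (_ *: _).
  rewrite mulr_sumr -big_split; apply: eq_bigr => k _ /=.
  by rewrite (wl_coef_X H)//; ring.
move=> x; split; first by eexists.
pose g (k : 'I_M) := e k - \sum_(i < n.-1) (W i k)%:C%C *: f i.
have gY (k : 'I_M) : (nY (g k) <= (rho * w k)%:E)%E.
  have -> : g k = \sum_(l < M) ((l == k)%:R - \sum_(i < n.-1) (W i k * W i l))%:C%C *: e l.
    rewrite /g (e_comb k) fE -sumrB; apply: eq_bigr => l _.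
    rewrite -scalerBl; congr (_ *: _); rewrite rmorphB rmorph_nat; congr (_ - _).
    by rewrite rmorph_sum; apply: eq_bigr => i _; rewrite rmorphM.
  rewrite (wl_Y_comb H) lee_fin.
  under eq_bigr do rewrite normc_real real_normK ?num_real//.
  have -> : \sum_(l < M) ((l == k)%:R - \sum_(i < n.-1) W i k * W i l) ^+ 2 = rho2 * w k ^+ 2.
    have Wk : \sum_(i < n.-1) W i k * W i k = t k.
      by rewrite -Wn//; apply: eq_bigr => i _; rewrite expr2.
    transitivity (\sum_(l < M) ((l == k)%:R - 2 * ((l == k)%:R * \sum_(i < n.-1) W i k * W i l)
       + \sum_(i < n.-1) W i k * (\sum_(j < n.-1) W j k * (W i l * W j l)))).
      apply: eq_bigr => l _; rewrite sqrrB -[X in _ + X = _]/(_ ^+ 2) expr2 mulr2n.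
      rewrite [X in _ + X = _](_ : _ = \sum_(i < n.-1) W i k * (\sum_(j < n.-1) W j k * (W i l * W j l))).
        have -> : (l == k)%:R * (l == k)%:R = (l == k)%:R :> R.
          by case: eqP => _; rewrite ?mulr1 ?mulr0.
        ring.
      rewrite expr2 mulr_suml; apply: eq_bigr => i _.
      rewrite mulr_sumr mulr_sumr; apply: eq_bigr => j _; ring.
    rewrite !big_split /= sumrN -mulr_sumr.
    rewrite (bigD1 k)//= eqxx big1 ?addr0 => [|l /negPf -> //].
    rewrite (bigD1 k)//= eqxx mul1r Wk big1 ?addr0 => [|l /negPf ->]; last by rewrite mul0r.
    rewrite exchange_big /=.
    rewrite (eq_bigr (fun i : 'I_n.-1 => W i k * W i k)) => [|i _].
      by rewrite Wk /t; ring.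
    rewrite -mulr_sumr; congr (_ * _); rewrite exchange_big /= (bigD1 i)//=.
    rewrite -mulr_sumr Wo// eqxx mulr1 big1 ?addr0// => j ji.
    by rewrite -mulr_sumr Wo// val_eqE eq_sym (negPf ji) mulr0.
  by rewrite sqrtrM// sqrtr_sqr ger0_norm.
set Sx := \sum_(k < M) coef k x *: e k.
have -> : x - P x = (x - Sx) + \sum_(k < M) coef k x *: g k.
  rewrite /g; under [in RHS]eq_bigr do rewrite scalerBr.
  rewrite sumrB -/Sx addrA subrK; congr (_ - _).
  under [RHS]eq_bigr do rewrite scaler_sumr.
  rewrite exchange_big /=; apply: eq_bigr => i _; rewrite scaler_suml.
  by apply: eq_bigr => k _; rewrite scalerA mulrC.
apply: le_trans (wl_Y_triangle H _ _) _.
apply: le_trans (leeD2l _ (nY_sum_le _ gY)) _.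
have h1 : (nY (x - Sx)%R <= rho%:E * ((w M)%:E * nY (x - Sx)%R))%E.
  rewrite muleA -EFinM -[leLHS]mul1e lee_wpmul2r// lee_fin.
  rewrite -(ler_pXn2r (ltn0Sn 1)) ?nnegrE ?mulr_ge0// expr1n exprMn sqr_sqrtr//.
apply: le_trans (leeD2r _ h1) _.
have -> : \sum_(i < M) normc (coef i x) * (rho * w i) = rho * \sum_(k < M) w k * normc (coef k x).
  by rewrite mulr_sumr; apply: eq_bigr => k _; ring.
rewrite EFinM -ge0_muleDr//; last by rewrite lee_fin sumr_ge0// => k _; rewrite mulr_ge0// normc_ge0.
by rewrite lee_wpmul2l// addeC; exact: (wl_tail H).
Qed.

Lemma kolmogorov_le n : (0 < n)%N -> exists2 M, (n <= M)%N &
  (kolmogorov_number nX nY idfun n <= (Num.sqrt (tail_ratio n M))%:E)%E.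
Proof.
move=> n0; have [M [f [P [nM fi fY _ hP]]]] := low_rank_projection n0.
exists M => //; apply: ge_ereal_inf; eexists.
  exists [set \sum_i c i *: f i | c in [set: 'I_n.-1 -> C]] => //; split.
    by exists f.
  by move=> _ [c _ <-]; exact: nY_sum_lty.
apply: ge_ereal_sup => _ [x x1 <-]; apply: ge_ereal_inf.
have [[c PE] h] := hP x; exists (nY (x - P x)).
  by exists (P x) => //; rewrite PE; exists c.
apply: le_trans h _; rewrite -[leRHS]mule1 lee_wpmul2l// lee_fin sqrtr_ge0//.
Qed.

Lemma approximation_le n : (0 < n)%N -> exists2 M, (n <= M)%N &
  (approximation_number nX nY idfun n <= (Num.sqrt (tail_ratio n M))%:E)%E.
Proof.
move=> n0; have [M [f [P [nM fi fY Plin hP]]]] := low_rank_projection n0.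
exists M => //; apply: ge_ereal_inf; exists (opnorm nX nY (fun x => x - P x)).
  exists P => //; split; last first.
    apply: (@finite_rank_lt _ _ _ nX _ _ P Plin n.-1 n f); rewrite ?prednK//.
    - by rewrite /nspace /= nX0.
    - exact: (wl_X_lin H).
    - by move=> x _; have [] := hP x.
  split=> //; exists ((w 0)^-1 + Num.sqrt (tail_ratio n M)) => x _.
  have -> : P x = x + (-1) *: (x - P x) by rewrite scaleN1r opprB addrC subrK.
  apply: le_trans (wl_Y_triangle H _ _) _.
  rewrite (wl_Y_homog H) normcN Normc.normc1 mul1e EFinD ge0_muleDl ?lee_fin ?invr_ge0 ?sqrtr_ge0//.
  rewrite leeD//; last by have [] := hP x.
  by have := nY_tail 0 x; rewrite big_ord0 subr0.
apply: ge_ereal_sup => _ [x x1 <-]; have [_ h] := hP x.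
apply: le_trans h _; rewrite -[leRHS]mule1 lee_wpmul2l// lee_fin sqrtr_ge0//.
Qed.

(** * Weyl numbers *)

Let l2_zero : nspace l2 (0 : nat -> C).
Proof.
rewrite /nspace /= (@l2_finite R 0) ?ltry//.
Qed.

Let l2_delta j : nspace l2 (@delta_seq R j).
Proof.
rewrite /nspace /= (@l2_finite R j.+1) ?ltry// => k jk.
by rewrite /delta_seq gtn_eqF.
Qed.

(** The map [A] to the first [n] coordinates, scaled by [c0], is a contraction
    by the Cauchy-Schwarz inequality. An operator of rank less than [n] kills a
    unit vector among the combinations of the first [n] unit sequences, and [A]
    maps it to a vector of l2 norm [c0]. *)
Lemma weyl_ge n : (0 < n)%N ->
  ((Num.sqrt (wsum n))^-1%:E <= weyl_number nX nY idfun n)%E.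
Proof.
move=> n0; set c0 := (Num.sqrt (wsum n))^-1; have S0 := wsum_gt0 n0.
have c00 : 0 < c0 by rewrite invr_gt0 sqrtr_gt0.
pose A (x : nat -> C) : E := \sum_(k < n) (c0%:C%C * x k) *: e k.
have nXA x : nX (A x) = (\sum_(k < n) w k * normc (c0%:C%C * x k))%:E by exact: (wl_X_comb H).
have AX x : (l2 x < +oo)%E -> (nX (A x) <= l2 x)%E.
  move=> hx; have xf : l2 x \is a fin_num by rewrite ge0_fin_numE// l2_ge0.
  rewrite nXA -(fineK xf) lee_fin.
  have -> : \sum_(k < n) w k * normc (c0%:C%C * x k) = c0 * \sum_(k < n) w k * normc (x k).
    rewrite mulr_sumr; apply: eq_bigr => k _.
    by rewrite Normc.normcM normc_real gtr0_norm//; ring.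
  rewrite ler_pdivrMl ?sqrtr_gt0//; apply: le_trans (wnorm_le _) _.
  rewrite ler_wpM2l ?sqrtr_ge0// -(ler_pXn2r (ltn0Sn 1)) ?nnegrE ?sqrtr_ge0 ?fine_ge0 ?l2_ge0//.
  by rewrite sqr_sqrtr ?sumr_ge0// => [|k _]; rewrite ?sqr_ge0// l2_partial// fineK.
have Alin a x y : A (a *: x + y) = a *: A x + A y.
  rewrite /A scaler_sumr -big_split; apply: eq_bigr => k _ /=.
  by rewrite scalerA -scalerDl; congr (_ *: _); rewrite -[(a *: x + y) k]/(a * x k + y k); ring.
apply: le_ereal_sup_tmp; eexists.
  exists A => //; split; last first.
    apply: ge_ereal_sup => _ [x x1 <-].
    have xoo : (l2 x < +oo)%E by apply: le_lt_trans x1 _; rewrite ltry.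
    exact: le_trans (AX x xoo) x1.
  by split=> //; exists 1 => x hx; rewrite mul1e AX.
apply: le_ereal_inf_tmp => _ [B [[Blin _] [m mn [v [_ BE]]]] <-].
have /choice[D hD] (j : 'I_n) : exists c : 'I_m -> C, B (delta_seq j) = \sum_i c i *: v i.
  have : (B @` nspace l2) (B (delta_seq j)) by exists (delta_seq j).
  by rewrite BE => -[c _ <-]; exists c.
have [u u0 uD] := kernel_row (\matrix_(j, i) D j i) mn.
set t := Num.sqrt (hs u).
have t0 : 0 < t.
  rewrite sqrtr_gt0 lt0r hs_ge0 andbT; apply: contra u0 => /eqP hu.
  apply/eqP/rowP => j; rewrite mxE; apply: Normc.eq0_normc.
  apply/eqP; rewrite -sqrf_eq0; apply/eqP; move: hu; rewrite /hs big_ord1.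
  move=> /(psumr_eq0P _) -> // => k _; exact: sqr_ge0.
pose x : nat -> C := \sum_(j < n) (u 0 j * t^-1%:C%C) *: delta_seq j.
have xn : \sum_(j < n) normc (u 0 j * t^-1%:C%C) ^+ 2 = 1.
  under eq_bigr do rewrite Normc.normcM normc_real exprMn real_normK ?num_real//.
  rewrite -mulr_suml exprVn sqr_sqrtr ?hs_ge0// /hs big_ord1 mulfV//.
  by move: t0; rewrite sqrtr_gt0 /hs big_ord1 => /lt0r_neq0.
have lx : l2 x = 1%E by rewrite l2_delta_comb xn sqrtr1.
have xk (k : 'I_n) : x k = u 0 k * t^-1%:C%C by rewrite /x delta_comb valK.
have Bx : B x = 0.
  have [_ ->] := operator_sum l2_zero (@l2_lin R) Blin
    (fun j : 'I_n => u 0 j * t^-1%:C%C) (fun j => l2_delta j).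
  under eq_bigr do rewrite hD scaler_sumr.
  rewrite exchange_big big1//= => i _.
  under eq_bigr do rewrite scalerA.
  rewrite -scaler_suml; have /rowP/(_ i) := uD; rewrite !mxE => h.
  rewrite (_ : \sum_(i0 < n) _ = t^-1%:C%C * \sum_j u 0 j * (\matrix_(j, i) D j i) j i).
    by rewrite h mulr0 scale0r.
  by rewrite mulr_sumr; apply: eq_bigr => j _; rewrite mxE; ring.
apply: le_ereal_sup_tmp; eexists.
  by exists x => //; rewrite /unit_ball /= lx.
rewrite /= Bx subr0 (wl_Y_comb H) lee_fin.
under eq_bigr do rewrite xk Normc.normcM exprMn normc_real real_normK ?num_real//.
by rewrite -mulr_sumr xn mulr1 sqrtr_sqr gtr0_norm.
Qed.

Section WeylUpper.
Local Open Scope sesquilinear_scope.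
Variables (A : (nat -> C) -> E) (n p : nat).
Hypothesis n0 : (0 < n)%N.
Hypothesis Abd : bounded_operator l2 nX A.
Hypothesis A1 : (opnorm l2 nX A <= 1)%E.

Let Alin := Abd.1.

Let A_contraction x : (l2 x < +oo)%E -> (nX (A x) <= l2 x)%E.
Proof.
move=> xoo; have xf : l2 x \is a fin_num by rewrite ge0_fin_numE// l2_ge0.
have [x0|xn0] := eqVneq (l2 x) 0%E.
  have [_ [M hM]] := Abd; have := hM _ xoo; by rewrite x0 mule0.
set r := fine (l2 x); have rE : l2 x = r%:E by rewrite fineK.
have r0 : 0 < r by rewrite -lte_fin -rE lt0e xn0 l2_ge0.
have rn : normc (r^-1)%:C%C = r^-1 by rewrite normc_real gtr0_norm// invr_gt0.
have lx' : l2 ((r^-1)%:C%C *: x) = 1%E.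
  by rewrite l2_homog// rn rE -EFinM mulVf// gt_eqF.
have : (nX (A ((r^-1)%:C%C *: x)) <= 1)%E.
  by apply: le_trans A1; apply: ereal_sup_ubound; exists ((r^-1)%:C%C *: x) => //;
     rewrite /unit_ball /= lx'.
rewrite -[_ *: x]addr0 (Alin _ xoo l2_zero).
rewrite (operator0 l2_zero Alin) addr0 (wl_X_homog H); last first.
  by apply: le_lt_trans (proj2_sig (cid Abd.2) _ xoo) _; rewrite rE -EFinM ltry.
by rewrite rn muleC lee_pdivrMr// mul1e rE.
Qed.

Let A_lty x : (l2 x < +oo)%E -> (nX (A x) < +oo)%E.
Proof. by move=> h; exact: le_lt_trans (A_contraction h) h. Qed.

(** The first [p] coordinates of [A x], and the matrix of the map that sends the
    first [m] entries of [x] to them. *)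
Let cvec (x : nat -> C) : 'cV[C]_p := \col_k coef k (A x).
Let B m : 'M[C]_(p, m) := \matrix_(k, j) coef k (A (delta_seq j)).

Let cvec_lin a x y : (l2 x < +oo)%E -> (l2 y < +oo)%E ->
  cvec (a *: x + y) = a *: cvec x + cvec y.
Proof.
move=> hx hy; apply/colP => k.
by rewrite !mxE Alin// (wl_coef_X H)//; exact: A_lty.
Qed.

Let cvec_delta m (u : 'I_m -> C) :
  cvec (\sum_j u j *: delta_seq j) = B m *m \col_j u j.
Proof.
apply/colP => k; rewrite !mxE.
have [_ ->] := operator_sum l2_zero (@l2_lin R) Alin u (fun j => l2_delta j).
rewrite coef_sumX => [|i]; last exact: A_lty (l2_delta i).
by apply: eq_bigr => j _; rewrite !mxE mulrC.
Qed.

Let cvec_le x r : l2 x = r%:E -> hs (cvec x) <= r ^+ 2.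
Proof.
move=> xr; have xoo : (l2 x < +oo)%E by rewrite xr ltry.
have h : ((Num.sqrt (hs (cvec x)))%:E <= r%:E)%E.
  rewrite -xr; apply: le_trans (A_contraction xoo).
  apply: (@le_trans _ _ (nY (A x))).
    have := wl_bessel H p (A x); congr (_%:E <= _)%E; congr Num.sqrt.
    by apply: eq_bigr => k _; rewrite big_ord1 mxE.
  have := nY_tail 0 (A x); rewrite big_ord0 subr0 => /le_trans; apply.
  rewrite -[leRHS]mul1e lee_wpmul2r// lee_fin invf_le1//; exact: (wl_ge1 H).
have r0 : 0 <= r by rewrite -lee_fin -xr l2_ge0.
by move: h; rewrite lee_fin -(ler_pXn2r (ltn0Sn 1)) ?nnegrE ?sqrtr_ge0// sqr_sqrtr ?hs_ge0.
Qed.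

Let B_weighted m :
  \sum_(k < p) w k ^+ 2 * \sum_j normc (B m k j) ^+ 2 <= 1.
Proof.
apply: (@hs_weighted_le1 R p m (fun k => w k)) => // x.
pose X : nat -> C := \sum_j x j 0 *: delta_seq j.
have lX : l2 X = (Num.sqrt (hs x))%:E.
  by rewrite l2_delta_comb; congr (Num.sqrt _)%:E; apply: eq_bigr => j _; rewrite big_ord1.
have BX : B m *m x = cvec X.
  by rewrite cvec_delta; congr (_ *m _); apply/colP => j; rewrite mxE.
have : ((\sum_(k < p) w k * normc ((B m *m x) k 0))%:E <= (Num.sqrt (hs x))%:E)%E.
  rewrite -lX; apply: le_trans (A_contraction _); last by rewrite lX ltry.
  apply: le_trans (nX_partial p _); rewrite lee_fin BX.
  by apply: ler_sum => k _; rewrite mxE.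
rewrite lee_fin => h; rewrite -[leRHS]sqr_sqrtr ?hs_ge0//.
rewrite ler_pXn2r ?nnegrE ?sqrtr_ge0// sumr_ge0// => k _.
by rewrite mulr_ge0// normc_ge0.
Qed.

Let B_le1 m : hs (B m) <= 1.
Proof.
apply: le_trans (B_weighted m); apply: ler_sum => k _.
rewrite -[leLHS]mul1r ler_wpM2r//; first by apply: sumr_ge0 => j _; exact: sqr_ge0.
by rewrite expr_ge1// (wl_ge1 H).
Qed.

Let B_add m M : hs (B (m + M)) = hs (B m) +
  \sum_(k < p) \sum_(j < M) normc (coef k (A (delta_seq (m + j)))) ^+ 2.
Proof.
rewrite /hs -big_split; apply: eq_bigr => k _; rewrite big_split_ord /=.
by congr (_ + _); apply: eq_bigr => j _; rewrite !mxE.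
Qed.

(** The squared norms [hs (B m)] increase and are bounded by 1, so that the
    columns of [B] beyond some [m] are small in the Hilbert-Schmidt norm. *)
Let tail_small (eta : R) : 0 < eta -> exists m, forall x, (l2 x <= 1)%E ->
  Num.sqrt (hs (cvec (tail_seq m x))) <= eta.
Proof.
move=> eta0.
pose S := [set hs (B m) | m in [set: nat]].
have supS : has_sup S.
  by split; [exists (hs (B 0)); exists 0%N|exists 1 => _ [m _ <-]].
have [_ [m _ <-] hm] := sup_adherent (exprn_gt0 2 eta0) supS.
have hM M : \sum_(k < p) \sum_(j < M) normc (coef k (A (delta_seq (m + j)))) ^+ 2 <= eta ^+ 2.
  have : hs (B (m + M)) <= sup S by apply: ub_le_sup; [exact: supS.2|exists (m + M)%N].
  by rewrite B_add; move: hm; lra.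
exists m => x x1.
have xoo : (l2 x < +oo)%E by apply: le_lt_trans x1 _; rewrite ltry.
set y := tail_seq m x.
have yoo : (l2 y < +oo)%E by exact: le_lt_trans (l2_tail_le _ _) xoo.
(* the vector y itself has a tail of norm at most th beyond m + M *)
apply/ler_addgt0Pr => th th0.
have [M hMt] := l2_tail yoo th0.
have hMt' : (l2 (tail_seq (m + M) y) <= th%:E)%E.
  apply: le_trans hMt; apply: l2_mono => k; rewrite /tail_seq.
  case: ifPn => [_|]; first by rewrite Normc.normc0; case: ifP; rewrite ?Normc.normc0 ?normc_ge0.
  rewrite -leqNgt => mMk; rewrite [in leRHS]ifF//.
  by apply/negbTE; rewrite -leqNgt (leq_trans (leq_addl _ _) mMk).
have headoo : (l2 (head_seq (m + M) y) < +oo)%E by exact: le_lt_trans (l2_head_le _ _) yoo.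
have tailoo : (l2 (tail_seq (m + M) y) < +oo)%E by exact: le_lt_trans (l2_tail_le _ _) yoo.
rewrite (head_tail (m + M) y) -[head_seq _ _]scale1r cvec_lin// scale1r.
apply: le_trans (hs_triangle _ _) _; apply: lerD; last first.
  have tf : l2 (tail_seq (m + M) y) \is a fin_num by rewrite ge0_fin_numE// l2_ge0.
  have := cvec_le (esym (fineK tf)); rewrite -(ler_sqrt _ (sqr_ge0 _)).
  move=> /le_trans; apply; rewrite sqrtr_sqr ger0_norm ?fine_ge0 ?l2_ge0//.
  by rewrite -lee_fin fineK.
rewrite -[leRHS]ger0_norm ?(ltW eta0)// -sqrtr_sqr ler_sqrt ?sqr_ge0//.
apply: le_trans (hM M).
rewrite head_seqE cvec_delta; apply: ler_sum => k _; rewrite big_ord1 mxE.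
rewrite big_split_ord /= big1 ?add0r => [|j _]; last by rewrite !mxE /y /tail_seq /= ltn_ord mulr0.
have yE (j : 'I_M) : y (m + j)%N = x (m + j)%N by rewrite /y /tail_seq ltnNge leq_addr.
set cs := fun j : 'I_M => normc (coef k (A (delta_seq (m + j)))).
apply: (@le_trans _ _ ((\sum_j cs j * normc (x (m + j)%N)) ^+ 2)).
  rewrite ler_pXn2r ?nnegrE ?normc_ge0//; last first.
    by apply: sumr_ge0 => j _; rewrite mulr_ge0// normc_ge0.
  apply: le_trans (normc_sum _ _) _; apply: ler_sum => j _.
  by rewrite Normc.normcM !mxE /= yE.
apply: le_trans (cauchy_schwarz_sum _ _) _.
rewrite -[leRHS]mulr1 ler_wpM2l//; first by apply: sumr_ge0 => j _; exact: sqr_ge0.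
have xf : l2 x \is a fin_num by rewrite ge0_fin_numE// l2_ge0.
have := l2_partial (m + M) (esym (fineK xf)); rewrite big_split_ord /= => h.
apply: (@le_trans _ _ (fine (l2 x) ^+ 2)).
  by apply: le_trans h; rewrite lerDr; apply: sumr_ge0 => j _; exact: sqr_ge0.
by rewrite expr_le1 ?fine_ge0 ?l2_ge0// -lee_fin fineK.
Qed.

(** Only finitely many entries of [x] and coordinates of [A x] matter up to
    [eta] each: the coordinates beyond [p] because [(w p)^-1 <= eta], the
    entries beyond [m] by [tail_small]. The remaining finite matrix [B m] is
    handled by [weighted_hs_lowrank]. *)
Lemma approximation_l2_le (eta : R) : 0 < eta -> (w p)^-1 <= eta ->
  (approximation_number l2 nY (idfun \o A) n <=
     ((Num.sqrt (wsum n))^-1 + (eta + eta))%:E)%E.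
Proof.
move=> eta0 wp.
have [m hm] := tail_small eta0.
have S0 := wsum_gt0 n0.
have [U [I [In Icontr hI]]] :=
  weighted_hs_lowrank w_gt0 (wl_homo H) n0 (B_weighted m).
set Q := U^t* *m diag_mx (\row_i (i \in I)%:R) *m U in Icontr.
pose Rk (x : nat -> C) : E := \sum_(k < p) (Q *m cvec x) k 0 *: e k.
pose f (i : 'I_#|I|) : E := \sum_(k < p) (U (enum_val i) k)^*%R *: e k.
have Rlin a x y : nspace l2 x -> nspace l2 y -> Rk (a *: x + y) = a *: Rk x + Rk y.
  move=> hx hy; rewrite /Rk cvec_lin// mulmxDr -scalemxAr scaler_sumr -big_split.
  by apply: eq_bigr => k _; rewrite /= scalerA -scalerDl; congr (_ *: _); rewrite !mxE.
have Rf x : Rk x = \sum_i (U *m cvec x) (enum_val i) 0 *: f i.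
  transitivity (\sum_(i in I) (U *m cvec x) i 0 *: \sum_(k < p) (U i k)^*%R *: e k); last first.
    by rewrite big_enum_val.
  under [RHS]eq_bigr do rewrite scaler_sumr.
  rewrite exchange_big; apply: eq_bigr => k _ /=.
  under [RHS]eq_bigr do rewrite scalerA.
  rewrite -scaler_suml; congr (_ *: _).
  rewrite /Q -!mulmxA mul_diag_mx [LHS]mxE [RHS]big_mkcond; apply: eq_bigr => i _.
  by rewrite [(U^t*) _ _]mxE [U^T _ _]mxE [(\matrix_(_, _) _) _ _]mxE [(\row__ _) _ _]mxE;
     case: (i \in I); rewrite ?mul1r ?mul0r ?mulr0// mulrC.
have hQ (z : 'cV[C]_p) : Num.sqrt (hs (Q *m z)) <= 2 * Num.sqrt (hs z).
  have -> : Q *m z = z + (Q *m z - z) by rewrite addrC subrK.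
  apply: le_trans (hs_triangle _ _) _; rewrite mulr_natl mulr2n lerD2l ler_sqrt ?hs_ge0//.
  have -> : hs (Q *m z - z) = hs (z - Q *m z); last exact: Icontr.
  by apply: eq_bigr => i _; apply: eq_bigr => j _; rewrite -normcN !mxE opprB.
apply: ge_ereal_inf; exists (opnorm l2 nY (fun x => A x - Rk x)).
  exists Rk => //; split; last first.
    apply: (finite_rank_lt l2_zero (@l2_lin R) Rlin In) => x _.
    by exists (fun i => (U *m cvec x) (enum_val i) 0); rewrite Rf.
  split=> //; exists 2 => x xoo.
  have xf : l2 x \is a fin_num by rewrite ge0_fin_numE// l2_ge0.
  rewrite (wl_Y_comb H) -(fineK xf) -EFinM lee_fin.
  have -> : \sum_(k < p) normc ((Q *m cvec x) k 0) ^+ 2 = hs (Q *m cvec x).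
    by apply: eq_bigr => k _; rewrite big_ord1.
  apply: le_trans (hQ _) _; rewrite ler_pM2l//.
  rewrite -[leRHS]ger0_norm ?fine_ge0 ?l2_ge0// -sqrtr_sqr ler_sqrt ?sqr_ge0//.
  by apply: cvec_le; rewrite fineK.
apply: ge_ereal_sup => _ [x x1 <-].
have xoo : (l2 x < +oo)%E by apply: le_lt_trans x1 _; rewrite ltry.
have hoo : (l2 (head_seq m x) < +oo)%E by exact: le_lt_trans (l2_head_le _ _) xoo.
have too : (l2 (tail_seq m x) < +oo)%E by exact: le_lt_trans (l2_tail_le _ _) xoo.
have -> : A x - Rk x = (A x - \sum_(k < p) coef k (A x) *: e k) +
    \sum_(k < p) (cvec x - Q *m cvec x) k 0 *: e k.
  rewrite -[RHS]addrA; congr (_ + _).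
  rewrite /Rk -sumrN -sumrN -big_split; apply: eq_bigr => k _ /=.
  have -> : (cvec x - Q *m cvec x) k 0 = coef k (A x) - (Q *m cvec x) k 0.
    by rewrite [LHS]mxE; congr (_ + _); rewrite [LHS]mxE.
  by rewrite scalerBl addKr.
apply: le_trans (wl_Y_triangle H _ _) _.
rewrite (wl_Y_comb H) addrA EFinD addeC; apply: leeD.
  apply: le_trans (nY_tail p (A x)) _; rewrite -[leRHS]mule1.
  apply: lee_pmul => //; first by rewrite lee_fin invr_ge0.
  exact: le_trans (A_contraction xoo) x1.
rewrite lee_fin.
have -> : \sum_k normc ((cvec x - Q *m cvec x) k 0) ^+ 2 = hs (cvec x - Q *m cvec x).
  by apply: eq_bigr => k _; rewrite big_ord1.
pose xc : 'cV[C]_m := \col_j x j.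
have -> : cvec x = B m *m xc + cvec (tail_seq m x).
  rewrite {1}(head_tail m x) -[head_seq _ _]scale1r cvec_lin// scale1r.
  by rewrite head_seqE cvec_delta.
rewrite mulmxDr opprD addrACA.
apply: le_trans (hs_triangle _ _) _; apply: lerD; last first.
  by apply: le_trans (hm x x1); rewrite ler_sqrt ?hs_ge0.
rewrite -sqrtrV ?(ltW S0)// ler_sqrt ?invr_ge0 ?(ltW S0)//.
rewrite -[leRHS]mul1r ler_pdivlMr// mulrC mulmxA; apply: le_trans (hI xc) _.
have xf : l2 x \is a fin_num by rewrite ge0_fin_numE// l2_ge0.
have := l2_partial m (esym (fineK xf)) => h.
apply: (@le_trans _ _ (fine (l2 x) ^+ 2)).
  by apply: le_trans h; apply: ler_sum => j _; rewrite big_ord1 mxE.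
by rewrite expr_le1 ?fine_ge0 ?l2_ge0// -lee_fin fineK.
Qed.
End WeylUpper.

Lemma weyl_le n : (0 < n)%N ->
  (weyl_number nX nY idfun n <= (Num.sqrt (wsum n))^-1%:E)%E.
Proof.
move=> n0; apply: ge_ereal_sup => _ [A [Abd A1] <-].
apply/lee_addgt0Pr => eta eta0.
have e2 : 0 < eta / 2 by rewrite divr_gt0.
have [p hp] := wl_unbounded H (eta / 2)^-1.
have wp : (w p)^-1 <= eta / 2 by rewrite invf_ple ?posrE.
have := approximation_l2_le n0 Abd A1 e2 wp.
by rewrite -splitr EFinD.
Qed.

End Diagonal.

(** * Integration against bounded functions *)

Section BoundedMeasurable.
Context d (T : measurableType d) (R : realType).
Implicit Types g h : T -> R.

(** A class of multipliers that is closed under sums and products and preserves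
    integrability. *)
Definition bounded_measurable h :=
  measurable_fun [set: T] h /\ exists M, forall x, `|h x| <= M.

Lemma bmD g h : bounded_measurable g -> bounded_measurable h ->
  bounded_measurable (fun x => g x + h x).
Proof.
move=> [mg [M hM]] [mh [N hN]]; split; first exact: measurable_funD.
by exists (M + N) => x; rewrite (le_trans (ler_normD _ _))// lerD.
Qed.

Lemma bmM g h : bounded_measurable g -> bounded_measurable h ->
  bounded_measurable (fun x => g x * h x).
Proof.
move=> [mg [M hM]] [mh [N hN]]; split; first exact: measurable_funM.
by exists (M * N) => x; rewrite normrM ler_pM.
Qed.

Lemma bm_cst c : bounded_measurable (fun _ : T => c).
Proof. by split; [exact: measurable_cst|exists `|c|]. Qed.

Lemma bmZ c h : bounded_measurable h -> bounded_measurable (fun x => c * h x).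
Proof. exact: (bmM (bm_cst c)). Qed.

Lemma bmB g h : bounded_measurable g -> bounded_measurable h ->
  bounded_measurable (fun x => g x - h x).
Proof.
move=> bg bh; rewrite (_ : (fun _ => _) = fun x => g x + (-1) * h x).
  by apply: bmD => //; exact: bmZ.
by apply/funext => x; rewrite mulN1r.
Qed.

Variable mu : {finite_measure set T -> \bar R}.

Definition Rintegrable (u : T -> R) := mu.-integrable [set: T] (EFin \o u).

Lemma Rintegrable_bm h : bounded_measurable h -> Rintegrable h.
Proof.
move=> [mh [M hM]]; apply: measurable_bounded_integrable => //.
  exact: fin_num_fun_lty.
exists M; split; first by rewrite num_real.
by move=> y My x _ /=; rewrite (le_trans (hM x))// ltW.
Qed.

Lemma RintegrableM u h : Rintegrable u -> bounded_measurable h ->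
  Rintegrable (fun x => u x * h x).
Proof.
move=> iu [mh [M hM]]; rewrite /Rintegrable.
rewrite (_ : EFin \o _ = ((EFin \o u) \* (EFin \o h))%E); last first.
  by apply/funext => x; rewrite /= EFinM.
apply: integrableMl => //.
exists M; split; first by rewrite num_real.
by move=> y My x _ /=; rewrite (le_trans (hM x))// ltW.
Qed.

Lemma RintegrableD u v : Rintegrable u -> Rintegrable v ->
  Rintegrable (fun x => u x + v x).
Proof.
move=> iu iv; rewrite /Rintegrable (_ : EFin \o _ = (EFin \o u) \+ (EFin \o v)).
  exact: integrableD.
by apply/funext => x; rewrite /= EFinD.
Qed.

Lemma RintegrableZ c u : Rintegrable u -> Rintegrable (fun x => c * u x).
Proof.
move=> iu; rewrite /Rintegrable (_ : EFin \o _ = (fun x => c%:E * (EFin \o u) x)%E).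
  exact: integrableZl.
by apply/funext => x; rewrite /= EFinM.
Qed.

Lemma RintegrableB u v : Rintegrable u -> Rintegrable v ->
  Rintegrable (fun x => u x - v x).
Proof.
move=> iu iv; rewrite (_ : (fun _ => _) = fun x => u x + (-1) * v x).
  by apply: RintegrableD => //; exact: RintegrableZ.
by apply/funext => x; rewrite mulN1r.
Qed.

Lemma RintD u v : Rintegrable u -> Rintegrable v ->
  \int[mu]_x (u x + v x) = \int[mu]_x u x + \int[mu]_x v x.
Proof. by move=> iu iv; rewrite RintegralD. Qed.

Lemma RintB u v : Rintegrable u -> Rintegrable v ->
  \int[mu]_x (u x - v x) = \int[mu]_x u x - \int[mu]_x v x.
Proof. by move=> iu iv; rewrite RintegralB. Qed.

Lemma RintZ c u : Rintegrable u ->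
  \int[mu]_x (c * u x) = c * \int[mu]_x u x.
Proof. by move=> iu; rewrite RintegralZl. Qed.

Lemma Rint_EFin u : Rintegrable u -> (\int[mu]_x (u x)%:E)%E = (\int[mu]_x u x)%:E.
Proof. by move=> iu; rewrite /Rintegral fineK// integrable_fin_num. Qed.

Lemma Rint_dominated (h : nat -> T -> R) (f g : T -> R) :
    (forall n, measurable_fun [set: T] (h n)) -> measurable_fun [set: T] f ->
    {ae mu, forall x, h ^~ x @ \oo --> f x} ->
    Rintegrable g -> (forall n x, `|h n x| <= g x) ->
  Rintegrable f /\ \int[mu]_x h n x @[n --> \oo] --> \int[mu]_x f x.
Proof.
move=> mh mf hf ig hg.
have mh' n : measurable_fun [set: T] (EFin \o h n) by exact/measurable_EFinP.
have mf' : measurable_fun [set: T] (EFin \o f) by exact/measurable_EFinP.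
have hf' : {ae mu, forall x, [set: T] x -> (EFin \o h n) x @[n --> \oo] --> (EFin \o f) x}.
  by apply: filterS hf => x hx _; apply: cvg_EFin => //; exact: nearW.
have hg' : {ae mu, forall x n, [set: T] x -> (`|(EFin \o h n) x| <= (EFin \o g) x)%E}.
  by apply: aeW => x n _; rewrite /= lee_fin.
have [if_ _ cv] := dominated_convergence measurableT mh' mf' hf' ig hg'.
split=> //; apply: (@fine_cvg _ _ _ _ (fun n => (\int[mu]_x (h n x)%:E)%E)).
by rewrite -Rint_EFin.
Qed.

Lemma Rint_ae (u v : T -> R) : measurable_fun [set: T] u -> measurable_fun [set: T] v ->
  {ae mu, forall x, u x = v x} -> \int[mu]_x u x = \int[mu]_x v x.
Proof.
move=> mu_ mv uv; rewrite /Rintegral; congr fine; apply: ae_eq_integral => //.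
- exact/measurable_EFinP.
- exact/measurable_EFinP.
- by apply: filterS uv => x /= ->.
Qed.

Lemma Rintegrable_ae (u v : T -> R) : measurable_fun [set: T] v ->
  {ae mu, forall x, u x = v x} -> Rintegrable u -> Rintegrable v.
Proof.
move=> mv uv iu; have mu_ : measurable_fun [set: T] u.
  by apply/measurable_EFinP; exact: measurable_int iu.
move: iu => /integrableP[_ fu]; apply/integrableP; split; first exact/measurable_EFinP.
rewrite (_ : (\int[mu]_x _ = \int[mu]_x `|(EFin \o u) x|)%E)//.
apply: ge0_ae_eq_integral => //.
- by apply: measurableT_comp => //; exact/measurable_EFinP.
- by apply: measurableT_comp => //; exact/measurable_EFinP.
- by apply: filterS uv => x /= ->.
Qed.

End BoundedMeasurable.

(** * Trigonometric integrals on the circle *)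

Section UniformCircle.
Context {R : realType}.
Local Notation U := (uniform_prob (@twopi_gt0 R)).
Local Notation mT := (measurableTypeR R).

Lemma bm_cos (k : R) : bounded_measurable (fun x : mT => cos (k * x)).
Proof.
split; last by exists 1 => x; rewrite ler_norml cos_geN1 cos_le1.
apply: (@measurableT_comp _ _ _ mT mT mT (@cos R) _ (fun x => k * x)); last exact: measurable_funM.
by apply: continuous_measurable_fun; exact: continuous_cos.
Qed.

Lemma bm_sin (k : R) : bounded_measurable (fun x : mT => sin (k * x)).
Proof.
split; last by exists 1 => x; rewrite ler_norml sin_geN1 sin_le1.
apply: (@measurableT_comp _ _ _ mT mT mT (@sin R) _ (fun x => k * x)); last exact: measurable_funM.
by apply: continuous_measurable_fun; exact: continuous_sin.
Qed.

Lemma Rint_uniform_FTC (f F : R -> R) :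
    bounded_measurable (f : mT -> R) -> continuous f ->
    (forall x : R, is_derive x 1 F (f x)) ->
  \int[U]_x f x = (2 * pi)^-1 * (F (2 * pi) - F 0).
Proof.
move=> [mf [M hM]] cf dF.
have b0 := @twopi_gt0 R.
have intf : lebesgue_measure.-integrable `[0, 2 * pi]%classic (EFin \o f).
  apply: continuous_compact_integrable; first exact: segment_compact.
  exact: continuous_subspaceT.
have cF : {within `[0, 2 * pi]%classic, continuous F}.
  apply: continuous_subspaceT => x; apply: differentiable_continuous.
  by apply/derivable1_diffP; have [] := dF x.
have FTC : (\int[lebesgue_measure]_(x in `[0%R, (2 * pi)%R]) (f x)%:E)%E = (F (2 * pi) - F 0)%:E.
  rewrite (@continuous_FTC2 _ f F)//.
  - exact: continuous_subspaceT.
  - split.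
    + by move=> x _; have [] := dF x.
    + by apply: cvg_at_right_filter; apply: differentiable_continuous;
        apply/derivable1_diffP; have [] := dF 0.
    + by apply: cvg_at_left_filter; apply: differentiable_continuous;
        apply/derivable1_diffP; have [] := dF (2 * pi).
  - by move=> x _; rewrite derive1E; exact: derive_val.
have iU : Rintegrable U f by apply: Rintegrable_bm; split=> //; exists M.
have iU1 : Rintegrable U (fun=> M) by exact/Rintegrable_bm/bm_cst.
(* the density formula for the uniform measure wants a nonnegative function *)
have E1 : \int[U]_x (f x + M) = \int[U]_x f x + M.
  rewrite RintD//; congr (_ + _); rewrite Rintegral_cst//.
  by rewrite [X in fine X]probability_setT mulr1.
have E2 : \int[U]_x (f x + M) = (2 * pi)^-1 * (F (2 * pi) - F 0) + M.
  rewrite /Rintegral integral_uniform; last 2 first.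
  - by apply/measurable_EFinP; apply: measurable_funD => //; exact: measurable_cst.
  - move=> x; rewrite lee_fin; have := hM x; rewrite ler_norml => /andP[]; lra.
  under eq_integral do rewrite EFinD.
  rewrite integralD//; last first.
    apply: (@continuous_compact_integrable _ (fun=> M)); first exact: segment_compact.
    by apply: continuous_subspaceT => x; exact: cvg_cst.
  rewrite FTC integral_cst//= lebesgue_measure_itv/= lte_fin b0 -!(EFinB, EFinM, EFinD) /=.
  by rewrite !subr0 mulrDr [X in _ + X]mulrC mulfK// gt_eqF.
by apply: (addIr M); rewrite -E1 E2.
Qed.

Lemma sin_int2pi (k : int) : sin (k%:~R * (2 * pi)) = 0 :> R.
Proof.
rewrite (mulr_natl pi 2).
have h n : sin (n%:R * (pi *+ 2)) = 0 :> R.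
  elim: n => [|n IH]; first by rewrite mul0r sin0.
  by rewrite -natr1 mulrDl mul1r sinD2pi.
case: k => n; first exact: h.
by rewrite NegzE rmorphN /= mulNr sinN h oppr0.
Qed.

Lemma cos_int2pi (k : int) : cos (k%:~R * (2 * pi)) = 1 :> R.
Proof.
rewrite (mulr_natl pi 2).
have h n : cos (n%:R * (pi *+ 2)) = 1 :> R.
  elim: n => [|n IH]; first by rewrite mul0r cos0.
  by rewrite -natr1 mulrDl mul1r cosD2pi.
case: k => n; first exact: h.
by rewrite NegzE rmorphN /= mulNr cosN h.
Qed.

Lemma Rint_uniform_cos (k : int) : \int[U]_x cos (k%:~R * x) = (k == 0)%:R.
Proof.
case: eqP => [->|/eqP k0].
  under eq_Rintegral do rewrite mul0r cos0.
  by rewrite Rintegral_cst// mul1r [X in fine X]probability_setT.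
have k0' : k%:~R != 0 :> R by rewrite intr_eq0.
have cc : continuous (fun x : R => cos (k%:~R * x)).
  by move=> x; apply: continuous_comp; [exact: mulrl_continuous|exact: continuous_cos].
have dF (x : R) : is_derive x 1 (fun x => k%:~R^-1 * sin (k%:~R * x)) (cos (k%:~R * x)).
  apply: is_derive_eq; rewrite /GRing.scale /= ?mulr0 ?addr0 ?add0r ?mulr1.
  by field.
rewrite (Rint_uniform_FTC (bm_cos _) cc dF).
by rewrite sin_int2pi (mulr0 k%:~R) sin0 !mulr0 subrr mulr0.
Qed.

Lemma Rint_uniform_sin (k : int) : \int[U]_x sin (k%:~R * x) = 0.
Proof.
have [->|k0] := eqVneq k 0.
  under eq_Rintegral do rewrite mul0r sin0.
  by rewrite Rintegral_cst// mul0r.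
have k0' : k%:~R != 0 :> R by rewrite intr_eq0.
have cs : continuous (fun x : R => sin (k%:~R * x)).
  by move=> x; apply: continuous_comp; [exact: mulrl_continuous|exact: continuous_sin].
have dF (x : R) : is_derive x 1 (fun x => - k%:~R^-1 * cos (k%:~R * x)) (sin (k%:~R * x)).
  apply: is_derive_eq; rewrite /GRing.scale /= ?mulr0 ?addr0 ?add0r ?mulr1.
  by field.
rewrite (Rint_uniform_FTC (bm_sin _) cs dF).
by rewrite cos_int2pi mulr0 cos0 subrr mulr0.
Qed.

Lemma bernoulli_ge (x : R) m : 0 <= x <= 1 -> 1 - m%:R * x <= (1 - x) ^+ m.
Proof.
move=> /andP[x0 x1]; elim: m => [|m IH]; first by rewrite mul0r subr0.
rewrite exprS -natr1; apply: le_trans (ler_wpM2l _ IH); last by rewrite subr_ge0.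
have : 0 <= m%:R :> R by []. move: (m%:R : R) => y y0; nra.
Qed.

Lemma bernoulli_le (x : R) m : 0 <= x <= 1 -> (1 - x) ^+ m * (1 + m%:R * x) <= 1.
Proof.
move=> /andP[x0 x1]; elim: m => [|m IH]; first by rewrite mul0r addr0 mulr1.
apply: le_trans IH; rewrite exprS -mulrA mulrCA ler_wpM2l ?exprn_ge0 ?subr_ge0//.
rewrite -natr1; have : 0 <= m%:R :> R by []. move: (m%:R : R) => y y0; nra.
Qed.

(** The polynomials [(1 - t ^+ n) ^+ (2 ^ n)], used by Brosowski and Deutsch to
    prove the Stone-Weierstrass theorem, approximate the indicator function of
    [t < 1/2]: inequalities of Bernoulli bound them in terms of [(2 * t) ^+ n],
    which tends to 0 below [1/2] and to infinity above. *)
Lemma cvg_peak (t : R) : 0 < t < 1 -> t != 2^-1 ->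
  (1 - t ^+ n) ^+ (2 ^ n) @[n --> \oo] --> ((t < 2^-1)%R%:R : R).
Proof.
move=> /andP[t0 t1] t2.
have t01 n : 0 <= t ^+ n <= 1 by rewrite exprn_ge0 ?exprn_ile1 ?ltW.
case: ltP => ht.
  apply: (@squeeze_cvgr _ _ _ _ (fun n => 1 - (2 * t) ^+ n) (fun=> 1)).
  - apply: nearW => n; rewrite exprMn -natrX.
    have /andP[? ?] := t01 n.
    by rewrite bernoulli_ge// exprn_ile1// ?subr_ge0// lerBlDr lerDl.
  - rewrite -[X in _ --> X]subr0; apply: cvgB; first exact: cvg_cst.
    apply: cvg_expr; rewrite ger0_norm ?mulr_ge0 ?ltW//; lra.
  - exact: cvg_cst.
have ht' : 2^-1 < t by rewrite lt_neqAle eq_sym t2.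
apply: (@squeeze_cvgr _ _ _ _ (fun=> 0) (fun n => (2 * t)^-1 ^+ n)).
- apply: nearW => n; have /andP[h0 h1] := t01 n.
  rewrite exprn_ge0 ?subr_ge0//= exprVn.
  have p0 : 0 < (2 * t) ^+ n by rewrite exprn_gt0// mulr_gt0.
  rewrite -[leRHS]mul1r ler_pdivlMr//.
  apply: le_trans (bernoulli_le (2 ^ n) (t01 n)).
  rewrite ler_wpM2l ?exprn_ge0 ?subr_ge0// exprMn natrX lerDr//.
- exact: cvg_cst.
- apply: cvg_expr; rewrite ger0_norm ?invr_ge0 ?mulr_ge0 ?ltW// invf_lt1 ?mulr_gt0//; lra.
Qed.

Lemma U_ae_interior (b : R) : {ae U, forall x : mT, 0 < x < 2 * pi /\ x != b}.
Proof.
pose N : set mT := ~` `]0, 2 * pi[%classic `|` [set b].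
have mN : measurable N by apply: measurableU => //; apply: measurableC.
exists N; split => //; last first.
  move=> x /= /not_andP[h|h]; [left|right].
    by move=> /=; rewrite in_itv /= => h'; apply: h.
  by apply/eqP; apply/negPn/negP.
have E A : measurable A -> U A = U (A `&` `[0, 2 * pi]%classic).
  move=> mA; rewrite /uniform_prob integral_uniform_pdf [RHS]integral_uniform_pdf.
  by rewrite -setIA setIid.
rewrite E//.
have mNI : measurable (N `&` `[0, 2 * pi]%classic) by exact: measurableI.
have null : lebesgue_measure (N `&` `[0, 2 * pi]%classic) = 0%E.
  apply: countable_lebesgue_measure0; apply: finite_set_countable.
  apply: (@sub_finite_set _ _ [set 0; 2 * pi; b]) => //.
  move=> x [[/= h|->]]; last by move=> _; right.
  rewrite /= in_itv/= => /andP[x0 x2]; left.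
  have [->|xn0] := eqVneq x 0; first by left.
  have [->|xn2] := eqVneq x (2 * pi); first by right.
  by exfalso; apply: h; rewrite in_itv/= lt0r xn0 x0 lt_neqAle xn2.
have := dominates_uniform_prob (@twopi_gt0 R).
by move=> /null_content_dominatesP/(_ _ mNI null).
Qed.

(** * Uniqueness of Fourier coefficients on the torus *)

Section Uniqueness1.
Variable u : mT -> R.
Hypothesis iu : Rintegrable U u.
Hypothesis ucos : forall k : int, \int[U]_x (u x * cos (k%:~R * x)) = 0.
Hypothesis usin : forall k : int, \int[U]_x (u x * sin (k%:~R * x)) = 0.

(** The multipliers [p] for which all the Fourier coefficients of [u * p] vanish
    are closed under products with [cos] and [sin]. *)
Let orth p := bounded_measurable p /\ forall k : int,
  \int[U]_x (u x * p x * cos (k%:~R * x)) = 0 /\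
  \int[U]_x (u x * p x * sin (k%:~R * x)) = 0.

Let iup p c : bounded_measurable p -> bounded_measurable c ->
  Rintegrable U (fun x => u x * p x * c x).
Proof. by move=> bp bc; do 2 apply: RintegrableM => //. Qed.

Let orth1 : orth (fun=> 1).
Proof.
split; first exact: bm_cst.
by move=> k; split; under eq_Rintegral do rewrite mulr1.
Qed.

Let orthD p q : orth p -> orth q -> orth (fun x => p x + q x).
Proof.
move=> [bp hp] [bq hq]; split; first exact: bmD.
move=> k; have [p1 p2] := hp k; have [q1 q2] := hq k; split.
- under eq_Rintegral do rewrite mulrDr mulrDl.
  by rewrite RintD ?p1 ?q1 ?addr0//; apply: iup => //; exact: bm_cos.
- under eq_Rintegral do rewrite mulrDr mulrDl.
  by rewrite RintD ?p2 ?q2 ?addr0//; apply: iup => //; exact: bm_sin.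
Qed.

Let orthZ c p : orth p -> orth (fun x => c * p x).
Proof.
move=> [bp hp]; split; first exact: bmZ.
move=> k; have [p1 p2] := hp k; split.
- under eq_Rintegral do rewrite mulrCA -mulrA.
  by rewrite RintZ ?p1 ?mulr0//; apply: iup => //; exact: bm_cos.
- under eq_Rintegral do rewrite mulrCA -mulrA.
  by rewrite RintZ ?p2 ?mulr0//; apply: iup => //; exact: bm_sin.
Qed.

Let cosS (k : int) (x : R) : cos ((k + 1)%:~R * x) = cos (k%:~R * x) * cos x - sin (k%:~R * x) * sin x.
Proof. by rewrite rmorphD mulrDl /= mul1r cosD. Qed.
Let cosP (k : int) (x : R) : cos ((k - 1)%:~R * x) = cos (k%:~R * x) * cos x + sin (k%:~R * x) * sin x.
Proof. by rewrite rmorphB mulrBl /= mul1r cosB. Qed.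
Let sinS (k : int) (x : R) : sin ((k + 1)%:~R * x) = sin (k%:~R * x) * cos x + cos (k%:~R * x) * sin x.
Proof. by rewrite rmorphD mulrDl /= mul1r sinD. Qed.
Let sinP (k : int) (x : R) : sin ((k - 1)%:~R * x) = sin (k%:~R * x) * cos x - cos (k%:~R * x) * sin x.
Proof. by rewrite rmorphB mulrBl /= mul1r sinB. Qed.

Let bc : bounded_measurable (fun x : mT => cos x).
Proof. by have := bm_cos 1; under eq_fun do rewrite mul1r. Qed.
Let bs : bounded_measurable (fun x : mT => sin x).
Proof. by have := bm_sin 1; under eq_fun do rewrite mul1r. Qed.

Let orth_cos p : orth p -> orth (fun x => p x * cos x).
Proof.
move=> [bp hp]; split; first exact: bmM.
move=> k; have [p1 p2] := hp (k + 1); have [q1 q2] := hp (k - 1); split.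
- rewrite (_ : (fun x => _) = fun x => 2^-1 * (u x * p x * cos ((k + 1)%:~R * x) + u x * p x * cos ((k - 1)%:~R * x))).
    rewrite RintZ ?RintD ?p1 ?q1 ?addr0 ?mulr0//; try by apply: iup => //; exact: bm_cos.
    by apply: RintegrableD; apply: iup => //; exact: bm_cos.
  by apply/funext => x; rewrite cosS cosP; field.
- rewrite (_ : (fun x => _) = fun x => 2^-1 * (u x * p x * sin ((k + 1)%:~R * x) + u x * p x * sin ((k - 1)%:~R * x))).
    rewrite RintZ ?RintD ?p2 ?q2 ?addr0 ?mulr0//; try by apply: iup => //; exact: bm_sin.
    by apply: RintegrableD; apply: iup => //; exact: bm_sin.
  by apply/funext => x; rewrite sinS sinP; field.
Qed.

Let orth_sin p : orth p -> orth (fun x => p x * sin x).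
Proof.
move=> [bp hp]; split; first exact: bmM.
move=> k; have [p1 p2] := hp (k + 1); have [q1 q2] := hp (k - 1); split.
- rewrite (_ : (fun x => _) = fun x => 2^-1 * (u x * p x * sin ((k + 1)%:~R * x) - u x * p x * sin ((k - 1)%:~R * x))).
    rewrite RintZ ?RintB ?p2 ?q2 ?subr0 ?mulr0//; try by apply: iup => //; exact: bm_sin.
    by apply: RintegrableB; apply: iup => //; exact: bm_sin.
  by apply/funext => x; rewrite sinS sinP; field.
- rewrite (_ : (fun x => _) = fun x => 2^-1 * (u x * p x * cos ((k - 1)%:~R * x) - u x * p x * cos ((k + 1)%:~R * x))).
    rewrite RintZ ?RintB ?p1 ?q1 ?subr0 ?mulr0//; try by apply: iup => //; exact: bm_cos.
    by apply: RintegrableB; apply: iup => //; exact: bm_cos.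
  by apply/funext => x; rewrite cosS cosP; field.
Qed.

Section Arc.
Variable b : R.
Hypothesis b02 : 0 <= b <= 2 * pi.
Let h := b / 2.
Let D (x : R) := cos (x - h) - cos h.
(** On [0, 2pi] the arc below [b] is the part where [cos (x - h) > cos h]. Hence
    the trigonometric polynomial [g] separates it from the rest: its values lie
    in ]0, 1[, below 1/2 on the arc and above 1/2 outside. *)
Let g (x : R) := 2^-1 - D x / 8.

Let orth_g p : orth p -> orth (fun x => g x * p x).
Proof.
move=> hp; rewrite (_ : (fun x => _) = fun x => (2^-1 + cos h / 8) * p x +
   ((- cos h / 8) * (p x * cos x) + (- sin h / 8) * (p x * sin x))).
  by apply: orthD; [exact: orthZ|apply: orthD; apply: orthZ; [exact: orth_cos|exact: orth_sin]].
by apply/funext => x; rewrite /g /D cosB; field.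
Qed.

Let orth_gX n p : orth p -> orth (fun x => g x ^+ n * p x).
Proof.
elim: n p => [|n IH] p hp; first by under eq_fun do rewrite mul1r.
by under eq_fun do rewrite exprSr -mulrA; apply: IH; exact: orth_g.
Qed.

Let orth_peak n m : orth (fun x => (1 - g x ^+ n) ^+ m).
Proof.
elim: m => [|m IH]; first exact: orth1.
rewrite (_ : (fun x => _) = fun x => (1 - g x ^+ n) ^+ m + (-1) * (g x ^+ n * (1 - g x ^+ n) ^+ m)).
  by apply: orthD => //; apply: orthZ; exact: orth_gX.
by apply/funext => x; rewrite exprS; ring.
Qed.

Let g_range x : 0 < g x < 1.
Proof.
have := cos_geN1 (x - h); have := cos_le1 (x - h); have := cos_geN1 h; have := cos_le1 h.
rewrite /g /D => *; apply/andP; split; lra.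
Qed.

Let DE x : D x = 2 * sin (x / 2) * sin ((b - x) / 2).
Proof.
rewrite /D (_ : x - h = x / 2 - (b - x) / 2); last by rewrite /h; field.
rewrite (_ : cos h = cos (x / 2 + (b - x) / 2)); last by congr cos; rewrite /h; field.
by rewrite cosB cosD; ring.
Qed.

Let g_lt x : 0 < x < 2 * pi -> x != b -> (g x != 2^-1) /\ (g x < 2^-1) = (x < b).
Proof.
move=> /andP[x0 x2] xb; have /andP[b0 b2] := b02.
have s1 : 0 < sin (x / 2) by apply: sin_gt0_pi; apply/andP; split; lra.
have [xltb|bltx] := ltP x b.
  have s2 : 0 < sin ((b - x) / 2) by apply: sin_gt0_pi; apply/andP; split; lra.
  have D0 : 0 < D x by rewrite DE !mulr_gt0.
  have gl : g x < 2^-1 by rewrite /g; lra.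
  by rewrite gl lt_eqF.
have bltx' : b < x by rewrite lt_neqAle eq_sym xb.
have s2 : 0 < sin ((x - b) / 2) by apply: sin_gt0_pi; apply/andP; split; lra.
have D0 : D x < 0.
  rewrite DE (_ : (b - x) / 2 = - ((x - b) / 2)); last by field.
  by rewrite sinN mulrN oppr_lt0 !mulr_gt0.
have gl : 2^-1 < g x by rewrite /g; lra.
by rewrite gt_eqF// ltNge (ltW gl).
Qed.

(** The peak polynomials of [g] are trigonometric polynomials, orthogonal to
    [u], and converge boundedly to the indicator function of the arc. *)
Lemma integral_below_arc : \int[U]_x (u x * (x < b)%R%:R) = 0.
Proof.
have mu_ : measurable_fun [set: mT] u by apply/measurable_EFinP; exact: measurable_int iu.
have bmp n : bounded_measurable (fun x => (1 - g x ^+ n) ^+ (2 ^ n)) by have [] := orth_peak n (2 ^ n).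
have hn n : \int[U]_x (u x * (1 - g x ^+ n) ^+ (2 ^ n)) = 0.
  have [_ /(_ 0)[]] := orth_peak n (2 ^ n).
  by under eq_Rintegral do rewrite mul0r cos0 mulr1.
have [|||||_] := @Rint_dominated _ mT R U
  (fun n x => u x * (1 - g x ^+ n) ^+ (2 ^ n)) (fun x => u x * (x < b)%R%:R) (fun x => `|u x|).
- by move=> n; apply: measurable_funM => //; have [] := bmp n.
- apply: measurable_funM => //.
  rewrite (_ : (fun x => _) = \1_(`]-oo, b[%classic : set mT)); first exact: measurable_indic.
  by apply/funext => x; rewrite indicE; congr (nat_of_bool _)%:R; apply/idP/idP; rewrite inE /= in_itv.
- apply: filterS (U_ae_interior b) => x [x02 xb].
  have [g1 g2] := g_lt x02 xb.
  by apply: cvgM; [exact: cvg_cst|rewrite -g2; exact: cvg_peak].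
- by have := integrable_norm iu.
- move=> n x; rewrite normrM -[leRHS]mulr1 ler_wpM2l//.
  have /andP[g0 g1] := g_range x.
  have y0 : 0 <= g x ^+ n by rewrite exprn_ge0// ltW.
  have y1 : g x ^+ n <= 1 by rewrite exprn_ile1// ltW.
  by rewrite ger0_norm ?exprn_ge0 ?subr_ge0// exprn_ile1 ?subr_ge0// gerBl.
rewrite (_ : (fun n => _) = fun=> 0); last exact/funext.
by move=> /cvg_lim <-//; rewrite lim_cst.
Qed.

End Arc.

Lemma integral_below (b : R) : \int[U]_x (u x * (x < b)%R%:R) = 0.
Proof.
have mu_ : measurable_fun [set: mT] u by apply/measurable_EFinP; exact: measurable_int iu.
have mb (c : R) : measurable_fun [set: mT] (fun x => u x * (x < c)%R%:R).
  apply: measurable_funM => //.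
  rewrite (_ : (fun x => _) = \1_(`]-oo, c[%classic : set mT)); first exact: measurable_indic.
  by apply/funext => x; rewrite indicE; congr (nat_of_bool _)%:R; apply/idP/idP; rewrite inE /= in_itv.
pose b' := Num.max 0 (Num.min b (2 * pi)).
transitivity (\int[U]_x (u x * (x < b')%R%:R)); last first.
  apply: integral_below_arc.
  by rewrite /b' le_max lexx/= ge_max ge_min lexx orbT andbT ltW// twopi_gt0.
apply: Rint_ae => //; apply: filterS (U_ae_interior 0) => x [/andP[x0 x2] _].
by rewrite /b' lt_max lt_min x2 andbT [x < 0]ltNge (ltW x0).
Qed.

(** The sets on which [u] has integral zero form a Dynkin system, which contains
    the rays by [integral_below] and hence all the Borel sets. *)
Lemma uniqueness1 : {ae U, forall x, u x = 0}.
Proof.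
have mu_ : measurable_fun [set: mT] u by apply/measurable_EFinP; exact: measurable_int iu.
pose P (E : set mT) := \int[U]_x (u x * \1_E x) = 0.
have bi (E : set mT) : measurable E -> bounded_measurable (\1_E : mT -> R).
  move=> mE; split; first exact: measurable_indic.
  by exists 1 => x; rewrite indicE normr_nat; case: (_ \in _).
have iE (E : set mT) : measurable E -> Rintegrable U (fun x => u x * \1_E x).
  by move=> mE; apply: RintegrableM => //; exact: bi.
have PT : P setT.
  rewrite /P; have := ucos 0; under eq_Rintegral do rewrite mul0r cos0 mulr1.
  by under [in X in _ -> X]eq_Rintegral do rewrite indicT mulr1.
have hP : forall S, <<s @RGenInftyO.G R >> S -> P S.
  apply: (@dynkin_induction _ mT (@RGenInftyO.G R)) => //.
  - exact: RGenInftyO.measurableE.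
  - move=> A B [x ->] [y ->]; exists (Num.min x y).
    by apply/seteqP; split => z /=; rewrite !in_itv/= lt_min => /andP.
  - move=> _ [b ->]; rewrite /P -[RHS](integral_below b); apply: eq_Rintegral => x _.
    by rewrite indicE; congr (_ * (nat_of_bool _)%:R); apply/idP/idP; rewrite inE /= in_itv.
  - move=> S mS PS; rewrite /P.
    have -> : \int[U]_x (u x * \1_(~` S) x) = \int[U]_x (u x * \1_setT x - u x * \1_S x).
      apply: eq_Rintegral => x _; rewrite !indicE in_setT in_setC.
      by case: (x \in S); rewrite /= ?mulr1 ?mulr0 ?subrr ?subr0.
    by rewrite RintB ?PT ?PS ?subr0//; apply: iE.
  - move=> F mF tF PF.
    have mU n : measurable (\big[setU/set0]_(i < n) F i) by exact: bigsetU_measurable.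
    have Pn n : P (\big[setU/set0]_(i < n) F i).
      elim: n => [|n IH]; rewrite /P.
        by rewrite big_ord0; under eq_Rintegral do rewrite indic0 mulr0; rewrite Rintegral_cst// mul0r.
      have -> : \int[U]_x (u x * \1_(\big[setU/set0]_(i < n.+1) F i) x) =
          \int[U]_x (u x * \1_(\big[setU/set0]_(i < n) F i) x + u x * \1_(F n) x).
        apply: eq_Rintegral => x _; rewrite -mulrDr; congr (_ * _).
        rewrite big_ord_recr /= !indicE in_setU.
        have [/= xn|_] := boolP (x \in F n); last by rewrite orbF addr0.
        rewrite orbT; suff -> : (x \in \big[setU/set0]_(i < n) F i) = false by rewrite add0r.
        apply/negbTE/negP; rewrite inE -bigcup_mkord => -[i /= ilt Fix].
        have /trivIsetP/(_ i n I I) := tF; rewrite ltn_eqF// => /(_ isT).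
        move=> E; have : (F i `&` F n) x by split => //; exact/set_mem.
        by rewrite E.
      by rewrite RintD ?PF ?IH ?addr0//; apply: iE.
    have [|||||_] := @Rint_dominated _ mT R U
      (fun n x => u x * \1_(\big[setU/set0]_(i < n) F i) x)
      (fun x => u x * \1_(\bigcup_k F k) x) (fun x => `|u x|).
    + by move=> n; apply: measurable_funM => //; exact: measurable_indic.
    + by apply: measurable_funM => //; apply: measurable_indic; exact: bigcupT_measurable.
    + apply: aeW => x; apply: cvgM; first exact: cvg_cst.
      have [[k _ Fkx]|nF] := pselect ((\bigcup_k F k) x).
        apply: cvg_near_cst; exists k.+1 => // n /= kn.
        rewrite !indicE mem_set; last by rewrite -bigcup_mkord; exists k.
        by rewrite mem_set//; exists k.
      apply: cvg_near_cst; apply: nearW => n; rewrite !indicE !memNset//.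
      by rewrite -bigcup_mkord => -[k _ Fkx]; apply: nF; exists k.
    + by have := integrable_norm iu.
    + move=> n x; rewrite normrM -[leRHS]mulr1 ler_wpM2l// indicE normr_nat.
      by case: (_ \in _).
    rewrite (_ : (fun n => _) = fun=> 0); last by apply/funext => n; exact: Pn.
    rewrite /P; by move=> /cvg_lim <-//; rewrite lim_cst.
have ae0 : ae_eq U setT (EFin \o u) (cst 0%E).
  apply: integral_ae_eq => //.
  move=> E _ mE; rewrite integral_mkcond integral0.
  have -> : (EFin \o u) \_ E = EFin \o (fun x => u x * \1_E x).
    by apply/funext => x; rewrite patchE /= indicE; case: ifP => _; rewrite ?mulr1 ?mulr0.
  rewrite Rint_EFin; last exact: iE.
  rewrite hP//.
  by have := mE; rewrite -[X in X -> _]/((@ocitv R).-sigma.-measurable E) RGenInftyO.measurableE.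
by apply: filterS ae0 => x /= /(_ I) [].
Qed.

End Uniqueness1.

End UniformCircle.

Section Torus.
Context {R : realType}.
Local Notation U := (uniform_prob (@twopi_gt0 R)).
Local Notation mT := (measurableTypeR R).
Local Notation mu d := (@torus_measure R d).

Definition tcons d (z : mT * d.-tuple mT) : d.+1.-tuple mT := [tuple of z.1 :: z.2].

Lemma measurable_tcons d : measurable_fun [set: mT * d.-tuple mT] (@tcons d).
Proof. exact: measurable_consR. Qed.

(** The torus measure in dimension [d.+1] is the image of this one under
    [tcons]. *)
Definition prod_torus d : probability (mT * d.-tuple mT)%type R := (U \x mu d)%E.

Local Notation prodT d := (prod_torus d).

Lemma torusS_integrable d (f : d.+1.-tuple mT -> R) :
  Rintegrable (mu d.+1) f -> Rintegrable (prodT d) (f \o @tcons d).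
Proof.
have mtc := @measurable_tcons d.
move=> /integrableP[mf ff]; apply/integrableP; split.
  by rewrite (_ : EFin \o _ = (EFin \o f) \o @tcons d)//; exact: (measurableT_comp mf).
by move: ff; rewrite ge0_integral_pushforward//; exact: measurableT_comp.
Qed.

Lemma torusS_integral d (f : d.+1.-tuple mT -> R) :
  Rintegrable (mu d.+1) f -> \int[mu d.+1]_x f x = \int[prodT d]_z f (tcons z).
Proof.
move=> fi; rewrite /Rintegral; congr fine.
have mtc := @measurable_tcons d.
rewrite [LHS]integral_pushforward//.
- by case/integrableP : fi.
- exact: torusS_integrable.
Qed.

Definition phase d (k : d.-tuple int) (x : d.-tuple mT) : R :=
  \sum_(i < d) (tnth k i)%:~R * tnth x i.

Lemma phaseS d (k0 : int) (k : d.-tuple int) (z : mT * d.-tuple mT) :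
  phase [tuple of k0 :: k] (tcons z) = k0%:~R * z.1 + phase k z.2.
Proof.
rewrite /phase big_ord_recl !tnth0; congr (_ + _).
by apply: eq_bigr => i _; rewrite !tnthS.
Qed.

Lemma phaseN d (k : d.-tuple int) x : phase [tuple - tnth k i | i < d] x = - phase k x.
Proof.
rewrite /phase -sumrN; apply: eq_bigr => i _.
by rewrite tnth_mktuple rmorphN mulNr.
Qed.

Lemma measurable_phase d (k : d.-tuple int) : measurable_fun [set: d.-tuple mT] (phase k).
Proof.
rewrite /phase; apply: measurable_sum => i; apply: measurable_funM => //.
exact: measurable_tnth.
Qed.

Lemma bm_cos_phase d (k : d.-tuple int) : bounded_measurable (fun x => cos (phase k x)).
Proof.
split; last by exists 1 => x; rewrite ler_norml cos_geN1 cos_le1.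
apply: (@measurableT_comp _ _ _ _ _ _ (@cos R : mT -> mT)); last exact: measurable_phase.
by apply: continuous_measurable_fun; exact: continuous_cos.
Qed.

Lemma bm_sin_phase d (k : d.-tuple int) : bounded_measurable (fun x => sin (phase k x)).
Proof.
split; last by exists 1 => x; rewrite ler_norml sin_geN1 sin_le1.
apply: (@measurableT_comp _ _ _ _ _ _ (@sin R : mT -> mT)); last exact: measurable_phase.
by apply: continuous_measurable_fun; exact: continuous_sin.
Qed.

Lemma bm_fst d (g : mT -> R) : bounded_measurable g ->
  bounded_measurable (fun z : mT * d.-tuple mT => g z.1).
Proof.
move=> [mg [M hM]]; split; last by exists M.
by apply: measurableT_comp => //; exact: measurable_fst.
Qed.

Lemma bm_snd d (g : d.-tuple mT -> R) : bounded_measurable g ->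
  bounded_measurable (fun z : mT * d.-tuple mT => g z.2).
Proof.
move=> [mg [M hM]]; split; last by exists M.
by apply: measurableT_comp => //; exact: measurable_snd.
Qed.

Lemma Rint_fubini d (f : mT * d.-tuple mT -> R) : Rintegrable (prodT d) f ->
  \int[prodT d]_z f z = fine (\int[mu d]_y (\int[U]_x (f (x, y))%:E))%E.
Proof.
move=> fi; rewrite /Rintegral; congr fine.
by rewrite -(integral21_prod_meas1 fi).
Qed.

Lemma Rint_prod d (g : mT -> R) (h : d.-tuple mT -> R) :
    bounded_measurable g -> bounded_measurable h ->
  \int[prodT d]_z (g z.1 * h z.2) = \int[U]_x g x * \int[mu d]_y h y.
Proof.
move=> bg bh; rewrite Rint_fubini; last first.
  by apply: Rintegrable_bm; exact: (bmM (bm_fst d bg) (bm_snd bh)).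
have -> : (\int[mu d]_y (\int[U]_x (g x * h y)%:E) = \int[mu d]_y ((\int[U]_x g x) * h y)%:E)%E.
  apply: eq_integral => y _ /=; rewrite (Rint_EFin (RintegrableM _ _)); last 2 first.
  - exact: Rintegrable_bm.
  - exact: bm_cst.
  congr EFin; under eq_Rintegral do rewrite mulrC.
  by rewrite (RintZ (h y) (Rintegrable_bm U bg)) mulrC.
rewrite Rint_EFin; last by apply: Rintegrable_bm; exact: bmZ.
by rewrite (RintZ _ (Rintegrable_bm (mu d) bh)).
Qed.

Lemma Rintegrable_prod d (g : mT -> R) (h : d.-tuple mT -> R) :
    bounded_measurable g -> bounded_measurable h ->
  Rintegrable (prodT d) (fun z => g z.1 * h z.2).
Proof.
by move=> bg bh; apply: Rintegrable_bm; exact: (bmM (bm_fst d bg) (bm_snd bh)).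
Qed.

(** By induction on the dimension, with the addition theorems separating the
    first variable. *)
Lemma Rint_torus_char d (k : d.-tuple int) :
  \int[mu d]_x cos (phase k x) = (k == [tuple 0 | i < d])%:R /\
  \int[mu d]_x sin (phase k x) = 0.
Proof.
elim: d k => [|d IH] k.
  have p0 x : phase k x = 0 by rewrite /phase big_ord0.
  split; under eq_Rintegral do rewrite p0 ?cos0 ?sin0.
    rewrite Rintegral_cst// mul1r [X in fine X]probability_setT.
    by rewrite (_ : k == _)//; apply/eqP/eq_from_tnth => -[].
  by rewrite Rintegral_cst// mul0r.
case/tupleP: k => k0 k; have [IHc IHs] := IH k.
have kE : (cons_tuple k0 k == [tuple 0 | i < d.+1]) = (k0 == 0) && (k == [tuple 0 | i < d]).
  apply/eqP/andP => [/(congr1 (@tnth _ _))E|[/eqP -> /eqP ->]].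
    split; apply/eqP.
      by have := congr1 (fun f => f ord0) E; rewrite tnth0 tnth_mktuple.
    apply/eq_from_tnth => i.
    by have := congr1 (fun f => f (lift ord0 i)) E; rewrite tnthS !tnth_mktuple.
  apply/eq_from_tnth => i; rewrite tnth_mktuple.
  case: (unliftP ord0 i) => [j ->|->]; last by rewrite tnth0.
  by rewrite tnthS tnth_mktuple.
have bc := bm_cos_phase k; have bs := bm_sin_phase k.
have bc0 := @bm_cos R k0%:~R; have bs0 := @bm_sin R k0%:~R.
split.
- rewrite torusS_integral; last exact/Rintegrable_bm/bm_cos_phase.
  under eq_Rintegral do rewrite phaseS cosD.
  rewrite RintB; [|exact: (Rintegrable_prod bc0 bc)|exact: (Rintegrable_prod bs0 bs)].
  rewrite (Rint_prod bc0 bc) (Rint_prod bs0 bs) Rint_uniform_cos Rint_uniform_sin IHc mul0r subr0.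
  by rewrite kE -natrM mulnb.
- rewrite torusS_integral; last exact/Rintegrable_bm/bm_sin_phase.
  under eq_Rintegral do rewrite phaseS sinD.
  rewrite RintD; [|exact: (Rintegrable_prod bs0 bc)|exact: (Rintegrable_prod bc0 bs)].
  by rewrite (Rint_prod bc0 bs) (Rint_prod bs0 bc) Rint_uniform_sin IHs mul0r mulr0 addr0.
Qed.

Definition slice_int d (w : mT * d.-tuple mT -> R) (y : d.-tuple mT) : R :=
  \int[U]_x w (x, y).

Lemma ae_slice d (w : mT * d.-tuple mT -> R) : Rintegrable (prodT d) w ->
  {ae mu d, forall y, Rintegrable U (fun x => w (x, y))}.
Proof. by move=> iw; have := @ae_integrable2 _ _ _ _ _ U (mu d) _ iw. Qed.

Lemma measurable_slice_int d (w : mT * d.-tuple mT -> R) : Rintegrable (prodT d) w ->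
  measurable_fun [set: d.-tuple mT] (slice_int w).
Proof.
move=> iw; apply: (@measurableT_comp _ _ _ _ _ _ fine _ (fubini_G U (EFin \o w))).
  exact: fine_measurable.
exact: (measurable_fubini_G iw).
Qed.

Lemma Rintegrable_slice d (w : mT * d.-tuple mT -> R) : Rintegrable (prodT d) w ->
  Rintegrable (mu d) (slice_int w).
Proof.
move=> iw; have ms := measurable_slice_int iw.
have mw : measurable_fun setT w by apply/measurable_EFinP; case/integrableP : (iw).
have mG : measurable_fun setT (fun y => (\int[U]_x `|w (x, y)|%:E)%E).
  apply: (@measurable_fun_fubini_tonelli_G _ _ _ _ _ U (fun z => `|w z|%:E)) => //.
  by apply/measurable_EFinP; exact: measurableT_comp.
apply/integrableP; split; first exact/measurable_EFinP.
have /(le_lt_trans _) : (\int[mu d]_y \int[U]_x `|w (x, y)|%:E < +oo)%E.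
  rewrite -(@fubini_tonelli2 _ _ _ _ _ U (mu d) (fun z => `|w z|%:E))//; last first.
    by apply/measurable_EFinP; exact: measurableT_comp.
  by case/integrableP : iw.
apply; apply: ge0_le_integral => //.
- by apply: measurableT_comp => //; exact/measurable_EFinP.
- move=> y _; apply: (@le_trans _ _ `|\int[U]_x (w (x, y))%:E|%E).
    by rewrite /slice_int /Rintegral /=; case: (\int[U]_x _)%E => [a| |]; rewrite /= ?leey.
  apply: le_trans (le_abse_integral _ _ _) _ => //.
  by apply/measurable_EFinP; exact: measurableT_comp.
Qed.

Lemma Rint_slice d (w : mT * d.-tuple mT -> R) (h : d.-tuple mT -> R) :
    Rintegrable (prodT d) w -> bounded_measurable h ->
  \int[mu d]_y (slice_int w y * h y) = \int[prodT d]_z (w z * h z.2).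
Proof.
move=> iw bh.
have iwh : Rintegrable (prodT d) (fun z => w z * h z.2).
  by apply: RintegrableM => //; exact: (bm_snd bh).
rewrite (Rint_fubini iwh) {1}/Rintegral; congr fine; apply: ae_eq_integral => //.
- apply/measurable_EFinP; apply: measurable_funM; first exact: measurable_slice_int.
  by case: bh.
- exact: (measurable_fubini_G iwh).
- apply: filterS (ae_slice iw) => y iy _.
  rewrite Rint_EFin; last exact: (RintegrableM iy (bm_cst _ (h y))).
  congr EFin; under [RHS]eq_Rintegral do rewrite mulrC.
  by rewrite (RintZ (h y) iy) mulrC.
Qed.

(** By induction on the dimension. For a fixed frequency in the first variable,
    integrating that variable out leaves a function of the others all of whose
    Fourier coefficients vanish, so that it is zero almost everywhere. The
    frequencies are countable: almost every slice in the first variable has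
    zero coefficients, and [uniqueness1] applies to it. *)
Lemma torus_uniqueness d (u : d.-tuple mT -> R) :
    Rintegrable (mu d) u ->
    (forall k, \int[mu d]_x (u x * cos (phase k x)) = 0) ->
    (forall k, \int[mu d]_x (u x * sin (phase k x)) = 0) ->
  {ae mu d, forall x, u x = 0}.
Proof.
elim: d u => [|d IH] u iu uc us.
  have mu_ : measurable_fun setT (EFin \o u) by case/integrableP : iu.
  have := uc [tuple]; rewrite /Rintegral /=.
  under eq_integral do rewrite /phase big_ord0 cos0 mulr1.
  rewrite integral_dirac// diracT mul1e => /= u0.
  by apply: aeW => x; rewrite (tuple0 x).
pose v z := u (tcons z).
have mu_ : measurable_fun setT u by apply/measurable_EFinP; case/integrableP : iu.
have iv : Rintegrable (prodT d) v by exact: torusS_integrable.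
have tc k : \int[prodT d]_z (v z * cos (phase k (tcons z))) = 0.
  rewrite -(uc k) torusS_integral//.
  by apply: RintegrableM => //; exact: bm_cos_phase.
have ts k : \int[prodT d]_z (v z * sin (phase k (tcons z))) = 0.
  rewrite -(us k) torusS_integral//.
  by apply: RintegrableM => //; exact: bm_sin_phase.
have ig (g : mT -> R) h : bounded_measurable g -> bounded_measurable h ->
    Rintegrable (prodT d) (fun z => v z * (g z.1 * h z.2)).
  by move=> bg bh; apply: RintegrableM => //; exact: (bmM (bm_fst d bg) (bm_snd bh)).
(* the frequencies (k0, k) and (- k0, k) separate the four products *)
have key k0 k :
    [/\ \int[prodT d]_z (v z * (cos (k0%:~R * z.1) * cos (phase k z.2))) = 0,
        \int[prodT d]_z (v z * (cos (k0%:~R * z.1) * sin (phase k z.2))) = 0,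
        \int[prodT d]_z (v z * (sin (k0%:~R * z.1) * cos (phase k z.2))) = 0 &
        \int[prodT d]_z (v z * (sin (k0%:~R * z.1) * sin (phase k z.2))) = 0].
  have bc := bm_cos_phase k; have bs := bm_sin_phase k.
  have bc0 := @bm_cos R k0%:~R; have bs0 := @bm_sin R k0%:~R.
  have icc := ig _ _ bc0 bc; have ics := ig _ _ bc0 bs.
  have isc := ig _ _ bs0 bc; have iss := ig _ _ bs0 bs.
  have e1 := tc [tuple of k0 :: k].
  have e2 := tc [tuple of (- k0) :: k].
  have e3 := ts [tuple of k0 :: k].
  have e4 := ts [tuple of (- k0) :: k].
  move: e1 e2 e3 e4.
  under eq_Rintegral do rewrite phaseS cosD mulrBr.
  under [X in _ -> X = _ -> _]eq_Rintegral do
    rewrite phaseS cosD rmorphN /= mulNr cosN sinN mulNr opprK mulrDr.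
  under [X in _ -> _ -> X = _ -> _]eq_Rintegral do rewrite phaseS sinD mulrDr.
  under [X in _ -> _ -> _ -> X = _ -> _]eq_Rintegral do
    rewrite phaseS sinD rmorphN /= mulNr cosN sinN mulNr mulrDr mulrN addrC.
  rewrite (RintB icc iss) (RintD icc iss) (RintD isc ics) (RintB ics isc).
  have cancel (a b : R) : a - b = 0 -> a + b = 0 -> a = 0 /\ b = 0 by move=> *; split; lra.
  move=> e1 e2 e3 e4; have [? ?] := cancel _ _ e1 e2.
  by have [] := cancel _ _ e4 (etrans (addrC _ _) e3).
have bmc (k : int) := @bm_cos R k%:~R; have bms (k : int) := @bm_sin R k%:~R.
have slice0 (g : mT -> R) : bounded_measurable g ->
    (forall k, \int[prodT d]_z (v z * (g z.1 * cos (phase k z.2))) = 0) ->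
    (forall k, \int[prodT d]_z (v z * (g z.1 * sin (phase k z.2))) = 0) ->
    {ae mu d, forall y, slice_int (fun z => v z * g z.1) y = 0}.
  move=> bg gc gs.
  have iw : Rintegrable (prodT d) (fun z => v z * g z.1).
    by apply: RintegrableM => //; exact: (bm_fst d bg).
  apply: IH; first exact: Rintegrable_slice.
  - move=> k; rewrite (Rint_slice iw (bm_cos_phase k)) -(gc k).
    by apply: eq_Rintegral => z _; rewrite mulrA.
  - move=> k; rewrite (Rint_slice iw (bm_sin_phase k)) -(gs k).
    by apply: eq_Rintegral => z _; rewrite mulrA.
have cn : {ae mu d, forall y, forall n : nat,
    slice_int (fun z => v z * cos (n%:Z%:~R * z.1)) y = 0}.
  apply/ae_foralln => n; apply: (slice0 _ (bmc n)) => k; first by have [] := key n k.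
  by have [] := key n k.
have sn : {ae mu d, forall y, forall n : nat,
    slice_int (fun z => v z * sin (n%:Z%:~R * z.1)) y = 0}.
  apply/ae_foralln => n; apply: (slice0 _ (bms n)) => k; first by have [] := key n k.
  by have [] := key n k.
have mv : measurable_fun setT v by apply/measurable_EFinP; case/integrableP : iv.
have v0 : {ae mu d, forall y, (\int[U]_x `|v (x, y)|%:E = 0)%E}.
  have iy := ae_slice iv.
  move: iy; apply: filter_app; move: cn; apply: filter_app.
  apply: filterS sn => y hs hc iy.
  have ae0 : {ae U, forall x, v (x, y) = 0}.
    apply: uniqueness1 => // -[n|n].
    - exact: hc.
    - under eq_Rintegral do rewrite NegzE rmorphN /= mulNr cosN.
      exact: hc.
    - exact: hs.
    - under eq_Rintegral do rewrite NegzE rmorphN /= mulNr sinN mulrN -mulN1r.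
      rewrite RintZ; last by apply: RintegrableM => //; exact: (bms n.+1).
      by rewrite [X in _ * X](hs n.+1) mulr0.
  rewrite (_ : 0%E = \int[U]_x (cst 0 x : \bar R))%E; last by rewrite integral0.
  apply: ge0_ae_eq_integral => //.
  - by apply/measurable_EFinP; apply: measurableT_comp => //; exact: measurableT_comp.
  - by apply: filterS ae0 => x ->; rewrite normr0.
have uE : ae_eq (mu d.+1) setT (EFin \o u) (cst 0%E).
  apply/ae_eq_integral_abs => //; first exact/measurable_EFinP.
  have mtc := @measurable_tcons d.
  rewrite ge0_integral_pushforward//; last first.
    by apply: measurableT_comp => //; exact/measurable_EFinP.
  rewrite preimage_setT (@fubini_tonelli2 _ _ _ _ _ U (mu d) (fun z => `|v z|%:E))//; last first.
    by apply/measurable_EFinP; exact: measurableT_comp.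
  rewrite (_ : 0%E = \int[mu d]_x (cst 0 x : \bar R))%E; last by rewrite integral0.
  apply: ge0_ae_eq_integral => //.
  - apply: (@measurable_fun_fubini_tonelli_G _ _ _ _ _ U (fun z => `|v z|%:E)) => //.
    by apply/measurable_EFinP; exact: measurableT_comp.
  - by move=> y _; exact: integral_ge0.
  - by apply: filterS v0 => y.
by apply: filterS uE => x /= /(_ I) [].
Qed.

End Torus.

(** * Complex-valued integrals and the norms of classes of functions *)

Local Notation Re := complex.Re.
Local Notation Im := complex.Im.
Local Notation normc := Normc.normc.

Section ComplexArith.
Context {R : rcfType}.
Implicit Types z u v : R[i].

Lemma cReD u v : Re (u + v) = Re u + Re v. Proof. by case: u v => [? ?] []. Qed.
Lemma cImD u v : Im (u + v) = Im u + Im v. Proof. by case: u v => [? ?] []. Qed.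
Lemma cReM u v : Re (u * v) = Re u * Re v - Im u * Im v. Proof. by case: u v => [? ?] []. Qed.
Lemma cImM u v : Im (u * v) = Re u * Im v + Im u * Re v. Proof. by case: u v => [? ?] []. Qed.
Lemma cReN u : Re (- u) = - Re u. Proof. by case: u. Qed.
Lemma cImN u : Im (- u) = - Im u. Proof. by case: u. Qed.

Lemma Re_sum (I : Type) (r : seq I) (F : I -> R[i]) :
  Re (\sum_(i <- r) F i) = \sum_(i <- r) Re (F i).
Proof. by elim/big_ind2: _ => // u1 u2 v1 v2 <- <-; rewrite cReD. Qed.

Lemma Im_sum (I : Type) (r : seq I) (F : I -> R[i]) :
  Im (\sum_(i <- r) F i) = \sum_(i <- r) Im (F i).
Proof. by elim/big_ind2: _ => // u1 u2 v1 v2 <- <-; rewrite cImD. Qed.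

Lemma normcE z : normc z = Num.sqrt (Re z ^+ 2 + Im z ^+ 2).
Proof. by case: z. Qed.

Lemma normRe_le z : `|Re z| <= normc z.
Proof.
rewrite normcE -sqrtr_sqr; apply: ler_wsqrtr.
by rewrite lerDl sqr_ge0.
Qed.

Lemma normIm_le z : `|Im z| <= normc z.
Proof.
rewrite normcE -sqrtr_sqr; apply: ler_wsqrtr.
by rewrite lerDr sqr_ge0.
Qed.

Lemma normc_le_add z : normc z <= `|Re z| + `|Im z|.
Proof.
rewrite -[leRHS]ger0_norm ?addr_ge0// -[leRHS]sqrtr_sqr normcE; apply: ler_wsqrtr.
rewrite sqrrD !real_normK ?num_real// lerD2r lerDl mulrn_wge0// mulr_ge0//.
Qed.

End ComplexArith.

Section ComplexIntegral.
Context d (T : measurableType d) (R : realType).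
Variable P : probability T R.
Implicit Types f g : T -> R[i].

Definition cintegrable f := Rintegrable P (fun x => Re (f x)) /\ Rintegrable P (fun x => Im (f x)).

Definition cint f : R[i] := ((\int[P]_x Re (f x)) +i* (\int[P]_x Im (f x)))%C.

Definition cbounded f := bounded_measurable (fun x => Re (f x)) /\ bounded_measurable (fun x => Im (f x)).

Lemma cintegrable_measurable f : cintegrable f -> measurable_fun [set: T] f.
Proof.
move=> [fr fi]; apply/measurable_complexP.
by split; apply/measurable_EFinP; [case/integrableP: fr|case/integrableP: fi].
Qed.

Lemma cbounded_measurable f : cbounded f -> measurable_fun [set: T] f.
Proof. by move=> [[? _] [? _]]; apply/measurable_complexP. Qed.

Lemma cboundedM f g : cbounded f -> cbounded g -> cbounded (fun x => f x * g x).
Proof.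
move=> [fr fi] [gr gi]; split.
  by under eq_fun do rewrite cReM; apply: bmB; exact: bmM.
by under eq_fun do rewrite cImM; apply: bmD; exact: bmM.
Qed.

Lemma cboundedD f g : cbounded f -> cbounded g -> cbounded (fun x => f x + g x).
Proof.
move=> [fr fi] [gr gi]; split.
  by under eq_fun do rewrite cReD; exact: bmD.
by under eq_fun do rewrite cImD; exact: bmD.
Qed.

Lemma cbounded_cst c : cbounded (fun=> c).
Proof. by split; exact: bm_cst. Qed.

Lemma cbounded_sum (I : Type) (r : seq I) (F : I -> T -> R[i]) :
  (forall i, cbounded (F i)) -> cbounded (fun x => \sum_(i <- r) F i x).
Proof.
move=> bF; elim: r => [|i r IH].
  by under eq_fun do rewrite big_nil; exact: cbounded_cst.
by under eq_fun do rewrite big_cons; apply: cboundedD.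
Qed.

Lemma cbounded_integrable f : cbounded f -> cintegrable f.
Proof. by move=> [fr fi]; split; exact: Rintegrable_bm. Qed.

Lemma cintegrableM f g : cintegrable f -> cbounded g -> cintegrable (fun x => f x * g x).
Proof.
move=> [fr fi] [gr gi]; split.
  by under eq_fun do rewrite cReM; apply: RintegrableB; exact: RintegrableM.
by under eq_fun do rewrite cImM; apply: RintegrableD; exact: RintegrableM.
Qed.

Lemma cintegrableD f g : cintegrable f -> cintegrable g -> cintegrable (fun x => f x + g x).
Proof.
move=> [fr fi] [gr gi]; split.
  by under eq_fun do rewrite cReD; exact: RintegrableD.
by under eq_fun do rewrite cImD; exact: RintegrableD.
Qed.

Lemma cintegrableZ a f : cintegrable f -> cintegrable (fun x => a * f x).
Proof.
move=> fi; under eq_fun do rewrite mulrC.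
by apply: cintegrableM => //; exact: cbounded_cst.
Qed.

Lemma cintD f g : cintegrable f -> cintegrable g ->
  cint (fun x => f x + g x) = cint f + cint g.
Proof.
move=> [fr fi] [gr gi]; rewrite /cint.
under eq_Rintegral do rewrite cReD; rewrite RintD//.
by under [X in (_ +i* X)%C]eq_Rintegral do rewrite cImD; rewrite RintD.
Qed.

Lemma cintZ a f : cintegrable f -> cint (fun x => a * f x) = a * cint f.
Proof.
move=> [fr fi]; rewrite /cint; case: a => a b.
under eq_Rintegral do rewrite cReM/=.
rewrite RintB ?RintZ//; try exact: RintegrableZ.
under [X in (_ +i* X)%C]eq_Rintegral do rewrite cImM/=.
by rewrite RintD ?RintZ//; exact: RintegrableZ.
Qed.

Lemma cint_ae f g : measurable_fun [set: T] f -> measurable_fun [set: T] g ->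
  {ae P, forall x, f x = g x} -> cint f = cint g.
Proof.
move=> /measurable_complexP[mfr mfi] /measurable_complexP[mgr mgi] fg.
by rewrite /cint; congr (_ +i* _)%C; apply: Rint_ae => //; apply: filterS fg => x ->.
Qed.

Lemma cintegrable_ae f g : measurable_fun [set: T] g ->
  {ae P, forall x, f x = g x} -> cintegrable f -> cintegrable g.
Proof.
move=> /measurable_complexP[mgr mgi] fg [fr fi]; split.
  by apply: Rintegrable_ae fr => //; apply: filterS fg => x ->.
by apply: Rintegrable_ae fi => //; apply: filterS fg => x ->.
Qed.

Lemma cint_sum (I : Type) (r : seq I) (F : I -> T -> R[i]) :
  (forall i, cintegrable (F i)) ->
  cintegrable (fun x => \sum_(i <- r) F i x) /\
  cint (fun x => \sum_(i <- r) F i x) = \sum_(i <- r) cint (F i).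
Proof.
move=> iF; elim: r => [|i r [IH1 IH2]].
  split; first by under eq_fun do rewrite big_nil; apply: cbounded_integrable; exact: cbounded_cst.
  rewrite big_nil /cint; under eq_Rintegral do rewrite big_nil.
  by under [X in (_ +i* X)%C]eq_Rintegral do rewrite big_nil; rewrite !Rintegral_cst// mul0r.
have E : (fun x => \sum_(j <- i :: r) F j x) = (fun x => F i x + \sum_(j <- r) F j x).
  by apply/funext => x; rewrite big_cons.
rewrite E; split; first exact: cintegrableD.
by rewrite cintD// IH2 big_cons.
Qed.

Lemma measurable_sqrtr : measurable_fun [set: measurableTypeR R] (@Num.sqrt R : measurableTypeR R -> measurableTypeR R).
Proof. by apply: continuous_measurable_fun; exact: sqrt_continuous. Qed.

Lemma measurable_normc f : measurable_fun [set: T] f ->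
  measurable_fun [set: T] (fun x => normc (f x)).
Proof.
move=> /measurable_complexP[mr mi]; under eq_fun do rewrite normcE.
have h : measurable_fun [set: T] (fun x => Re (f x) ^+ 2 + Im (f x) ^+ 2).
  by apply: measurable_funD; exact: measurable_funX.
exact: (measurableT_comp measurable_sqrtr h).
Qed.

Lemma measurable_EFin_normc f : measurable_fun [set: T] f ->
  measurable_fun [set: T] (fun x => (normc (f x))%:E).
Proof. by move=> mf; apply/measurable_EFinP; exact: measurable_normc. Qed.

Lemma cintegrableP f : measurable_fun [set: T] f ->
  cintegrable f <-> (\int[P]_x (normc (f x))%:E < +oo)%E.
Proof.
move=> mf; have mn := measurable_EFin_normc mf.
have [mr mi] := (measurable_complexP f).1 mf; split.
- move=> [fr fi].
  have /integrableP[_] : Rintegrable P (fun x => `|Re (f x)| + `|Im (f x)|).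
    by apply: RintegrableD; apply: integrable_norm.
  apply: le_lt_trans; apply: ge0_le_integral => //.
  + by move=> x _; rewrite lee_fin normc_ge0.
  + apply: measurableT_comp => //; apply/measurable_EFinP.
    by apply: measurable_funD; exact: measurableT_comp.
  + by move=> x _; rewrite /= lee_fin ger0_norm ?addr_ge0// normc_le_add.
- move=> fl; split; (apply/integrableP; split; first exact/measurable_EFinP);
    apply: le_lt_trans fl; apply: ge0_le_integral => //.
  + by apply/measurable_EFinP; exact: measurableT_comp.
  + by move=> x _; rewrite lee_fin normRe_le.
  + by apply/measurable_EFinP; exact: measurableT_comp.
  + by move=> x _; rewrite lee_fin normIm_le.
Qed.

End ComplexIntegral.

Section L0Norms.
Context d (T : measurableType d) (R : realType).
Variable P : probability T R.
Implicit Types f g : L0 P.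

Lemma L0_linE a f g : {ae P, forall x, (a *: f + g : L0 P) x = a * f x + g x}.
Proof.
have h1 : {ae P, forall x, (a *: f + g : L0 P) x = (a *: f : L0 P) x + g x} by exact: to_L0E.
have h2 : {ae P, forall x, (a *: f : L0 P) x = a * f x} by exact: to_L0E.
by move: h1; apply: filter_app; apply: filterS h2 => x -> ->.
Qed.

Lemma L0_zeroE : {ae P, forall x, (0 : L0 P) x = 0}.
Proof. exact: to_L0E. Qed.

Lemma L0_scaleE a f : {ae P, forall x, (a *: f : L0 P) x = a * f x}.
Proof. exact: to_L0E. Qed.

Lemma L0_addE f g : {ae P, forall x, (f + g : L0 P) x = f x + g x}.
Proof. exact: to_L0E. Qed.

Lemma L0_combE N (a : 'I_N -> R[i]) (e : nat -> T -> R[i]) (me : forall k, measurable_fun [set: T] (e k)) :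
  {ae P, forall x, (\sum_(k < N) a k *: to_L0 P (me k) : L0 P) x = \sum_(k < N) a k * e k x}.
Proof.
elim: N a => [|N IH] a.
  by rewrite big_ord0; apply: filterS L0_zeroE => x ->; rewrite big_ord0.
have -> : \sum_(k < N.+1) a k *: to_L0 P (me k) =
    a ord_max *: to_L0 P (me N) + \sum_(k < N) a (widen_ord (leqnSn N) k) *: to_L0 P (me k).
  by rewrite big_ord_recr addrC.
have h := IH (fun k => a (widen_ord (leqnSn N) k)).
have h2 := to_L0E P (me N).
move: h; apply: filter_app; move: h2; apply: filter_app.
apply: filterS (L0_linE (a ord_max) (to_L0 P (me N)) (\sum_(i < N) a (widen_ord (leqnSn N) i) *: to_L0 P (me i))).
by move=> x -> -> ->; rewrite big_ord_recr /= addrC.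
Qed.

Lemma Lp1E f : Lp_norm 1 f = (\int[P]_x (normc (f x))%:E)%E.
Proof.
rewrite /Lp_norm Lnorm1; apply: eq_integral => x _.
by rewrite gee0_abs// lee_fin normc_ge0.
Qed.

Lemma Lp1_cintegrable f : (Lp_norm 1 f < +oo)%E <-> cintegrable P f.
Proof. by rewrite Lp1E; split => /(cintegrableP P (measurable_L0 f)). Qed.

Lemma Lp2E f : Lp_norm 2%:E f = ((\int[P]_x (normc (f x) ^+ 2)%:E) `^ 2^-1)%E.
Proof.
rewrite /Lp_norm unlock; congr (_ `^ _)%E; apply: eq_integral => x _.
by rewrite gee0_abs ?lee_fin ?normc_ge0// poweR_EFin powR_mulrn ?normc_ge0.
Qed.

Lemma measurable_normc2 (f : T -> R[i]) : measurable_fun [set: T] f ->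
  measurable_fun [set: T] (fun x => (normc (f x) ^+ 2)%:E).
Proof. by move=> mf; apply/measurable_EFinP; apply: measurable_funX; exact: measurable_normc. Qed.

Lemma Lp2_fun f (g : T -> R[i]) (r : R) : measurable_fun [set: T] g ->
  {ae P, forall x, f x = g x} -> (\int[P]_x (normc (g x) ^+ 2)%:E = r%:E)%E ->
  Lp_norm 2%:E f = (Num.sqrt r)%:E.
Proof.
move=> mg fg gr; rewrite Lp2E.
have -> : (\int[P]_x (normc (f x) ^+ 2)%:E = r%:E)%E.
  rewrite -gr; apply: ae_eq_integral => //.
  - exact/measurable_normc2/measurable_L0.
  - exact: measurable_normc2.
  - by apply: filterS fg => x -> _.
have r0 : 0 <= r.
  by rewrite -lee_fin -gr; apply: integral_ge0 => x _; rewrite lee_fin sqr_ge0.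
by rewrite poweR_EFin powR12_sqrt.
Qed.

Lemma Lp2_triangle f g : (Lp_norm 2%:E (f + g)%R <= Lp_norm 2%:E f + Lp_norm 2%:E g)%E.
Proof.
have mf := measurable_normc (measurable_L0 f).
have mg := measurable_normc (measurable_L0 g).
have := @eminkowski _ _ _ P (fun x => normc (f x)) (fun x => normc (g x)) 2%:E mf mg.
rewrite lee_fin ler1n => /(_ isT); apply: le_trans.
rewrite /Lp_norm unlock.
have itv (h : T -> \bar R) : (\int[P]_x (`|h x| `^ 2))%E \in `[0%E, +oo%E].
  by rewrite in_itv /= leey andbT; apply: integral_ge0 => x _; rewrite poweR_ge0.
have half : 0 <= 2^-1 :> R by [].
apply: (gt0_ler_poweR half (itv _) (itv _)).
have mpow (h : T -> R) : measurable_fun [set: T] h -> measurable_fun [set: T] (fun x => (`|(h x)%:E| `^ 2)%E).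
  move=> mh; under eq_fun do rewrite abse_EFin poweR_EFin powR_mulrn//.
  by apply/measurable_EFinP; apply: measurable_funX; exact: measurableT_comp.
apply: ae_ge0_le_integral => //.
- by move=> x _; exact: poweR_ge0.
- by apply: mpow; exact/measurable_normc/measurable_L0.
- by move=> x _; exact: poweR_ge0.
- by apply: mpow; exact: measurable_funD.
- apply: filterS (L0_addE f g) => x -> _.
  rewrite !abse_EFin !poweR_EFin lee_fin ge0_ler_powR ?nnegrE//.
  by rewrite !ger0_norm ?addr_ge0 ?normc_ge0// le_normcD.
Qed.

Lemma Lp2_homog a f : Lp_norm 2%:E (a *: f) = ((normc a)%:E * Lp_norm 2%:E f)%E.
Proof.
rewrite !Lp2E.
have -> : (\int[P]_x (normc ((a *: f : L0 P) x) ^+ 2)%:E = (normc a ^+ 2)%:E * \int[P]_x (normc (f x) ^+ 2)%:E)%E.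
  rewrite -ge0_integralZl//; last 3 first.
  - exact/measurable_normc2/measurable_L0.
  - by move=> x _; rewrite lee_fin sqr_ge0.
  - by rewrite lee_fin sqr_ge0.
  apply: ae_eq_integral => //.
  - exact/measurable_normc2/measurable_L0.
  - by apply: emeasurable_funM => //; exact/measurable_normc2/measurable_L0.
  - by apply: filterS (L0_scaleE a f) => x -> _; rewrite Normc.normcM exprMn EFinM.
rewrite poweRM ?lee_fin ?sqr_ge0//; last first.
  by apply: integral_ge0 => x _; rewrite lee_fin sqr_ge0.
by rewrite poweR_EFin powR12_sqrt ?sqr_ge0// sqrtr_sqr ger0_norm ?normc_ge0.
Qed.

Lemma Lp2_eq0 f : Lp_norm 2%:E f = 0%E -> f = 0.
Proof.
move=> /Lnorm_eq0_eq0; have mf := measurable_EFin_normc (measurable_L0 f).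
have two : (0 < 2%:E :> \bar R)%E by rewrite lte_fin ltr0n.
move=> /(_ mf two) f0; apply: L0_eq.
move: f0; apply: filter_app; apply: filterS L0_zeroE => x -> /(_ I) /= [].
exact: Normc.eq0_normc.
Qed.

(** On a probability space, [normc (f x) <= 1 + normc (f x) ^+ 2] suffices. *)
Lemma Lp2_cintegrable f : (Lp_norm 2%:E f < +oo)%E -> cintegrable P f.
Proof.
rewrite Lp2E => f2; apply/(cintegrableP P (measurable_L0 f)).
have {}f2 : (\int[P]_x (normc (f x) ^+ 2)%:E < +oo)%E.
  rewrite ltey; apply/eqP => E; move: f2; rewrite E poweRyr; last by rewrite invr_neq0.
  by rewrite ltxx.
have m1 := measurable_normc2 (measurable_L0 f).
apply: (@le_lt_trans _ _ (\int[P]_x ((1 : R)%:E + (normc (f x) ^+ 2)%:E))%E).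
  apply: ge0_le_integral => //.
  - by move=> x _; rewrite lee_fin normc_ge0.
  - exact/measurable_EFin_normc/measurable_L0.
  - by apply: emeasurable_funD.
  - move=> x _; rewrite -EFinD lee_fin; have := sqr_ge0 (normc (f x) - 1).
    by have := normc_ge0 (f x); nra.
rewrite ge0_integralD//; last by move=> x _; rewrite lee_fin sqr_ge0.
by rewrite integral_cst// mul1e [X in (X + _)%E]probability_setT lte_add_pinfty// ltry.
Qed.

End L0Norms.

(** * The trigonometric system *)

Section TorusSystem.
Context {R : realType} (d : nat).
Local Notation mT := (measurableTypeR R).
Local Notation mu := (@torus_measure R d).
Local Notation C := R[i].
Implicit Types (k l : d.-tuple int) (g : d.-tuple mT -> C).

Lemma expiD (a b : R) : expi (a + b) = expi a * expi b.
Proof. by rewrite /expi cosD sinD; apply/eqP; rewrite eq_complex /= [sin a * _ + _]addrC !eqxx. Qed.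

Lemma expiN (a : R) : expi (- a) = ((expi a)^*)%C.
Proof. by rewrite /expi cosN sinN. Qed.

Lemma normc_expi (a : R) : normc (expi a) = 1.
Proof. by rewrite /= cos2Dsin2 sqrtr1. Qed.

Definition chi k (x : d.-tuple mT) : C := expi (phase k x).

Lemma cbounded_chi k : cbounded (chi k).
Proof. by split; [exact: bm_cos_phase|exact: bm_sin_phase]. Qed.

Lemma cbounded_chiN k : cbounded (fun x : d.-tuple mT => expi (- phase k x)).
Proof.
rewrite (_ : (fun x => _) = (fun x => expi (phase [tuple - tnth k i | i < d] x))).
  exact: cbounded_chi.
by apply/funext => x; rewrite phaseN.
Qed.

Lemma measurable_chi k : measurable_fun [set: d.-tuple mT] (chi k).
Proof. exact: cbounded_measurable (cbounded_chi k). Qed.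

(** The Fourier coefficient, for functions rather than classes of functions. *)
Definition fc g k : C := cint mu (fun x => g x * expi (- phase k x)).

Lemma fourier_coefE (f : L0 mu) k : fourier_coef f k = fc f k.
Proof. by []. Qed.

Lemma fc_lin a g h k : cintegrable mu g -> cintegrable mu h ->
  fc (fun x => a * g x + h x) k = a * fc g k + fc h k.
Proof.
move=> ig ih; rewrite /fc.
have ige := cintegrableM ig (cbounded_chiN k).
have ihe := cintegrableM ih (cbounded_chiN k).
rewrite -cintZ// -cintD//; last exact: cintegrableZ.
by congr cint; apply/funext => x; rewrite mulrDl mulrA.
Qed.

Lemma fc_ae g h k : measurable_fun [set: d.-tuple mT] g -> measurable_fun [set: d.-tuple mT] h ->
  {ae mu, forall x, g x = h x} -> fc g k = fc h k.
Proof.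
move=> mg mh gh; apply: cint_ae.
- have [mg1 mg2] := (measurable_complexP g).1 mg.
  have [[c1 _] [c2 _]] := cbounded_chiN k.
  apply/measurable_complexP; split.
    by under eq_fun do rewrite cReM; apply: measurable_funB; exact: measurable_funM.
  by under eq_fun do rewrite cImM; apply: measurable_funD; exact: measurable_funM.
- have [mg1 mg2] := (measurable_complexP h).1 mh.
  have [[c1 _] [c2 _]] := cbounded_chiN k.
  apply/measurable_complexP; split.
    by under eq_fun do rewrite cReM; apply: measurable_funB; exact: measurable_funM.
  by under eq_fun do rewrite cImM; apply: measurable_funD; exact: measurable_funM.
- by apply: filterS gh => x ->.
Qed.

Lemma fc_chi k l : fc (chi k) l = (k == l)%:R.
Proof.
rewrite /fc /chi.
have -> : (fun x : d.-tuple mT => expi (phase k x) * expi (- phase l x)) =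
    (fun x : d.-tuple mT => expi (phase [tuple tnth k i - tnth l i | i < d] x)).
  apply/funext => x; rewrite -expiD; congr expi.
  rewrite /phase -sumrN -big_split /=; apply: eq_bigr => i _.
  by rewrite tnth_mktuple rmorphB /= mulrBl.
rewrite /cint /= !(Rint_torus_char _).1 (Rint_torus_char _).2.
have -> : ([tuple tnth k i - tnth l i | i < d] == [tuple 0 | i < d]) = (k == l).
  apply/eqP/eqP => [E|->].
    apply/eq_from_tnth => i; have := congr1 (fun t => tnth t i) E.
    by rewrite !tnth_mktuple => /subr0_eq.
  by apply/eq_from_tnth => i; rewrite !tnth_mktuple subrr.
by case: (k == l).
Qed.

(** The coefficients at [k] and [- k] determine the four real integrals of the
    real and imaginary parts against cosine and sine. *)
Lemma torus_cuniqueness g : cintegrable mu g -> (forall k, fc g k = 0) ->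
  {ae mu, forall x, g x = 0}.
Proof.
move=> ig g0; have [ir ii] := ig.
have key k : [/\ \int[mu]_x (Re (g x) * cos (phase k x)) = 0,
                 \int[mu]_x (Im (g x) * sin (phase k x)) = 0,
                 \int[mu]_x (Im (g x) * cos (phase k x)) = 0 &
                 \int[mu]_x (Re (g x) * sin (phase k x)) = 0].
  have bc := bm_cos_phase (R := R) k; have bs := bm_sin_phase (R := R) k.
  have rc := RintegrableM ir bc; have rs := RintegrableM ir bs.
  have ic := RintegrableM ii bc; have is_ := RintegrableM ii bs.
  have := g0 k; have := g0 [tuple - tnth k i | i < d].
  rewrite /fc /cint.
  under eq_Rintegral do rewrite cReM phaseN opprK.
  under [X in (_ +i* X)%C = _ -> _]eq_Rintegral do rewrite cImM phaseN opprK.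
  rewrite /= (RintB rc is_) (RintD rs ic) => -[e1 e2].
  under eq_Rintegral do rewrite cReM /= cosN sinN mulrN opprK.
  under [X in (_ +i* X)%C = _ -> _]eq_Rintegral do rewrite cImM /= cosN sinN mulrN addrC.
  rewrite (RintD rc is_) (RintB ic rs) => -[e3 e4].
  have cancel (a b : R) : a - b = 0 -> a + b = 0 -> a = 0 /\ b = 0 by move=> *; split; lra.
  have [? ?] := cancel _ _ e1 e3.
  by have [] := cancel _ _ e4 (etrans (addrC _ _) e2).
have hr : {ae mu, forall x, Re (g x) = 0}.
  by apply: torus_uniqueness => // k; have [] := key k.
have hi : {ae mu, forall x, Im (g x) = 0}.
  by apply: torus_uniqueness => // k; have [] := key k.
move: hr; apply: filter_app; apply: filterS hi => x; case: (g x) => a b /= -> ->.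
by [].
Qed.

Variable kk : nat -> d.-tuple int.
Hypothesis kk_bij : bijective kk.

Lemma kk_eq i j : (kk i == kk j) = (i == j).
Proof. exact: (inj_eq (bij_inj kk_bij)). Qed.

Definition comb N (a : 'I_N -> C) x := \sum_(k < N) a k * chi (kk k) x.

Lemma cbounded_comb N (a : 'I_N -> C) : cbounded (comb a).
Proof.
apply: cbounded_sum => k; apply: cboundedM; first exact: cbounded_cst.
exact: cbounded_chi.
Qed.

Lemma fc_comb N (a : 'I_N -> C) j :
  fc (comb a) (kk j) = if insub j is Some k then a k else 0.
Proof.
rewrite /fc /comb.
have -> : (fun x => (\sum_(k < N) a k * chi (kk k) x) * expi (- phase (kk j) x)) =
   (fun x => \sum_(k < N) (a k * (chi (kk k) x * expi (- phase (kk j) x)))).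
  by apply/funext => x; rewrite mulr_suml; apply: eq_bigr => k _; rewrite mulrA.
have ib (k : 'I_N) : cintegrable mu (fun x => chi (kk k) x * expi (- phase (kk j) x)).
  by apply: cbounded_integrable; apply: cboundedM; [exact: cbounded_chi|exact: cbounded_chiN].
have [|_ ->] := @cint_sum _ _ R mu _ (index_enum 'I_N)
  (fun (k : 'I_N) x => a k * (chi (kk k) x * expi (- phase (kk j) x))).
  by move=> k; exact: cintegrableZ.
under eq_bigr => k _ do rewrite cintZ// -/(fc (chi (kk k)) (kk j)) fc_chi kk_eq.
case: insubP => [k _ kj|jN].
  rewrite (bigD1 k)//= kj eqxx mulr1 big1 ?addr0// => i ik.
  by rewrite -kj (inj_eq val_inj) (negbTE ik) mulr0.
rewrite big1// => i _; rewrite [_ == _](_ : _ = false) ?mulr0//.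
by apply/eqP => E; move: jN; rewrite -E ltn_ord.
Qed.

Lemma fc_combE N (a : 'I_N -> C) (k : 'I_N) : fc (comb a) (kk k) = a k.
Proof.
rewrite fc_comb; case: insubP => [i _ ik|]; last by rewrite ltn_ord.
by congr a; exact/val_inj.
Qed.

Lemma cint_conj_comb g N (a : 'I_N -> C) : cintegrable mu g ->
  cintegrable mu (fun x => g x * ((comb a x)^*)%C) /\
  cint mu (fun x => g x * ((comb a x)^*)%C) = \sum_(k < N) ((a k)^*)%C * fc g (kk k).
Proof.
move=> ig.
have -> : (fun x => g x * ((comb a x)^*)%C) =
   (fun x => \sum_(k < N) ((a k)^*)%C * (g x * expi (- phase (kk k) x))).
  apply/funext => x; rewrite /comb rmorph_sum mulr_sumr; apply: eq_bigr => k _.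
  by rewrite rmorphM /chi expiN mulrCA.
have ib (k : 'I_N) := cintegrableM ig (cbounded_chiN (kk k)).
have [|h ->] := @cint_sum _ _ R mu _ (index_enum 'I_N)
  (fun (k : 'I_N) x => ((a k)^*)%C * (g x * expi (- phase (kk k) x))).
  by move=> k; exact: cintegrableZ.
by split=> //; apply: eq_bigr => k _; rewrite cintZ.
Qed.

Lemma Re_cint g : Re (cint mu g) = \int[mu]_x Re (g x). Proof. by []. Qed.

Lemma conj_mul_normc (z : C) : Re ((z^*)%C * z) = normc z ^+ 2.
Proof. by rewrite normcE2; case: z => a b /=; ring. Qed.

Lemma mul_conj_normc (z : C) : Re (z * (z^*)%C) = normc z ^+ 2.
Proof. by rewrite mulrC conj_mul_normc. Qed.

Lemma parseval_comb N (a : 'I_N -> C) :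
  Rintegrable mu (fun x => normc (comb a x) ^+ 2) /\
  \int[mu]_x (normc (comb a x) ^+ 2) = \sum_(k < N) normc (a k) ^+ 2.
Proof.
have ib := cbounded_integrable mu (cbounded_comb a).
have [[ir _] E] := cint_conj_comb a ib.
have F : (fun x => normc (comb a x) ^+ 2) = (fun x => Re (comb a x * ((comb a x)^*)%C)).
  by apply/funext => x; rewrite mul_conj_normc.
rewrite F; split=> //.
rewrite -(Re_cint (fun x => comb a x * ((comb a x)^*)%C)) E Re_sum.
by apply: eq_bigr => k _; rewrite fc_combE conj_mul_normc.
Qed.

(** The distance of [g] from the partial sum of its Fourier series is
    nonnegative. *)
Lemma bessel g N : cintegrable mu g -> Rintegrable mu (fun x => normc (g x) ^+ 2) ->
  \sum_(k < N) normc (fc g (kk k)) ^+ 2 <= \int[mu]_x (normc (g x) ^+ 2).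
Proof.
move=> ig ig2; pose a (k : 'I_N) := fc g (kk k).
have [iS ES] := parseval_comb a.
have [[iX _] EX] := cint_conj_comb a ig.
have EX' : \int[mu]_x Re (g x * ((comb a x)^*)%C) = \sum_(k < N) normc (a k) ^+ 2.
  rewrite -(Re_cint (fun x => g x * ((comb a x)^*)%C)) EX Re_sum.
  by apply: eq_bigr => k _; rewrite conj_mul_normc.
have : 0 <= \int[mu]_x ((normc (g x) ^+ 2 + normc (comb a x) ^+ 2) - 2 * Re (g x * ((comb a x)^*)%C)).
  apply: Rintegral_ge0 => x _.
  case: (g x) (comb a x) => [u v] [u' v']; rewrite !normcE2 /=.
  by have := sqr_ge0 (u - u'); have := sqr_ge0 (v - v'); nra.
rewrite RintB; [|exact: RintegrableD|exact: RintegrableZ].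
by rewrite RintD// RintZ// ES EX' -/a; lra.
Qed.

End TorusSystem.

(** * Weighted Wiener algebras as weighted l1 spaces *)

Section WienerSystem.
Context {R : realType} (d : nat).
Local Notation mT := (measurableTypeR R).
Local Notation mu := (@torus_measure R d).
Local Notation C := R[i].
Variables (w : d.-tuple int -> R) (kk : nat -> d.-tuple int).
Hypothesis kk_bij : bijective kk.
Hypothesis w_ge1 : forall k, 1 <= w k.
Hypothesis w_mono : {homo (fun j => w (kk j)) : i j / (i <= j)%N >-> i <= j}.
Hypothesis w_unbounded : forall M, exists j, M <= w (kk j).

Let wj j := w (kk j).
Let e j : L0 mu := to_L0 mu (measurable_chi (R := R) (kk j)).
Let coef j (f : L0 mu) : C := fourier_coef f (kk j).

Let w_gt0 j : 0 < wj j. Proof. exact: lt_le_trans ltr01 (w_ge1 _). Qed.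

Let term_ge0 (f : L0 mu) j : (0 <= (wj j * normc (coef j f))%:E)%E.
Proof. by rewrite lee_fin mulr_ge0 ?normc_ge0// ltW. Qed.

Lemma wiener_norm_series (f : L0 mu) : cintegrable mu f ->
  wiener_norm w f = (\sum_(0 <= j <oo) (wj j * normc (coef j f))%:E)%E.
Proof.
move=> fi; rewrite /wiener_norm ((Lp1_cintegrable f).2 fi) nneseries_esumT//.
apply: reindex_esum; split=> //.
- by move=> i j _ _ /(bij_inj kk_bij).
- by move=> k _; have [h h1 h2] := kk_bij; exists (h k).
Qed.

Lemma wiener_cintegrable (f : L0 mu) : (wiener_norm w f < +oo)%E -> cintegrable mu f.
Proof. by rewrite /wiener_norm; case: ifPn => // /Lp1_cintegrable. Qed.

Let cintegrable_lin a (f g : L0 mu) : cintegrable mu f -> cintegrable mu g ->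
  cintegrable mu (a *: f + g : L0 mu).
Proof.
move=> fi gi; apply: (@cintegrable_ae _ _ _ mu (fun x => a * f x + g x)).
- exact: measurable_L0.
- by apply: filterS (L0_linE a f g) => x ->.
- by apply: cintegrableD => //; exact: cintegrableZ.
Qed.

Let cintegrable_scale a (f : L0 mu) : cintegrable mu f -> cintegrable mu (a *: f : L0 mu).
Proof.
move=> fi; apply: (@cintegrable_ae _ _ _ mu (fun t => a * f t)).
- exact: measurable_L0.
- by apply: filterS (L0_scaleE a f) => t ->.
- exact: cintegrableZ.
Qed.

Let coef_lin j a (f g : L0 mu) : cintegrable mu f -> cintegrable mu g ->
  coef j (a *: f + g) = a * coef j f + coef j g.
Proof.
move=> fi gi; rewrite /coef !fourier_coefE -fc_lin//; apply: fc_ae.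
- exact: measurable_L0.
- by apply: (@cintegrable_measurable _ _ _ mu); apply: cintegrableD => //; exact: cintegrableZ.
- exact: L0_linE.
Qed.

Let coefZ j a (f : L0 mu) : cintegrable mu f -> coef j (a *: f) = a * coef j f.
Proof.
move=> fi; have z : cintegrable mu (0 : L0 mu).
  apply: (@cintegrable_ae _ _ _ mu (fun=> 0)); first exact: measurable_L0.
    by apply: filterS (L0_zeroE mu) => x ->.
  exact/cbounded_integrable/cbounded_cst.
have z0 : coef j (0 : L0 mu) = 0.
  have := coef_lin j 1 z z; rewrite scaler0 addr0 mul1r => E.
  by apply: (addrI (coef j 0)); rewrite addr0 -E.
by have := coef_lin j a fi z; rewrite addr0 z0 addr0.
Qed.

Let comb_ae N (a : 'I_N -> C) : {ae mu, forall x, (\sum_(k < N) a k *: e k : L0 mu) x = comb kk a x}.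
Proof.
have h := @L0_combE _ _ R mu N a (fun j => chi (kk j)) (fun j => measurable_chi (R := R) (kk j)).
by apply: filterS h => x ->.
Qed.

Let cintegrable_comb N (a : 'I_N -> C) : cintegrable mu (\sum_(k < N) a k *: e k : L0 mu).
Proof.
apply: (@cintegrable_ae _ _ _ mu (comb kk a)); first exact: measurable_L0.
  by apply: filterS (comb_ae a) => x ->.
exact/cbounded_integrable/cbounded_comb.
Qed.

Let coef_comb N (a : 'I_N -> C) j :
  coef j (\sum_(k < N) a k *: e k) = if insub j is Some k then a k else 0.
Proof.
rewrite -(fc_comb kk_bij a j) /coef fourier_coefE; apply: fc_ae.
- exact: measurable_L0.
- exact/cbounded_measurable/cbounded_comb.
- exact: comb_ae.
Qed.

Let wiener_comb N (a : 'I_N -> C) :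
  wiener_norm w (\sum_(k < N) a k *: e k : L0 mu) = (\sum_(k < N) wj k * normc (a k))%:E.
Proof.
rewrite wiener_norm_series; last exact: cintegrable_comb.
rewrite (nneseries_split 0 N)// add0n [X in (_ + X)%E]eseries0 ?adde0; last first.
  move=> j Nj _; rewrite coef_comb insubF ?Normc.normc0 ?mulr0//.
  by rewrite ltnNge Nj.
rewrite big_mkord sumEFin; congr EFin; apply: eq_bigr => k _.
rewrite coef_comb; case: insubP => [i _ ik|]; last by rewrite ltn_ord.
by do 3 congr (_ _); exact/val_inj.
Qed.

Let L2_comb N (a : 'I_N -> C) :
  L2_norm (\sum_(k < N) a k *: e k : L0 mu) = (Num.sqrt (\sum_(k < N) normc (a k) ^+ 2))%:E.
Proof.
have [i E] := parseval_comb kk_bij a.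
apply: (Lp2_fun (g := comb kk a)) => //.
- exact/cbounded_measurable/cbounded_comb.
- by rewrite (Rint_EFin i) E.
Qed.

Let L2_finite (y : L0 mu) : (L2_norm y < +oo)%E ->
  [/\ cintegrable mu y, Rintegrable mu (fun x => normc (y x) ^+ 2) &
    L2_norm y = (Num.sqrt (\int[mu]_x (normc (y x) ^+ 2)))%:E].
Proof.
move=> yf; have yi := Lp2_cintegrable yf; have my := measurable_L0 y.
have iy : Rintegrable mu (fun x => normc (y x) ^+ 2).
  apply/integrableP; split; first exact: measurable_normc2.
  rewrite (eq_integral (fun x => (normc (y x) ^+ 2)%:E)); last first.
    by move=> x _; rewrite /= ger0_norm// sqr_ge0.
  move: yf; rewrite /L2_norm Lp2E !ltey; apply: contra => /eqP ->.
  by rewrite poweRyr// invr_neq0.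
split=> //; apply: (Lp2_fun (g := y)) => //.
  by apply: aeW.
by rewrite Rint_EFin.
Qed.

Let L2_bessel N (y : L0 mu) :
  ((Num.sqrt (\sum_(k < N) normc (coef k y) ^+ 2))%:E <= L2_norm y)%E.
Proof.
have [/L2_finite[yi iy ->]|] := ltP (L2_norm y) +oo%E; last by rewrite leye_eq => /eqP ->; rewrite leey.
by rewrite lee_fin; apply: ler_wsqrtr; exact: bessel.
Qed.

Let normc_cvg (z : nat -> C) (l : C) :
  Re (z n) @[n --> \oo] --> Re l -> Im (z n) @[n --> \oo] --> Im l ->
  normc (z n) @[n --> \oo] --> normc l.
Proof.
move=> hr hi; rewrite normcE; under eq_fun do rewrite normcE.
apply: (cvg_comp _ (@Num.sqrt R)); last exact: sqrt_continuous.
by apply: cvgD; rewrite /GRing.exp /=; exact: cvgM.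
Qed.

(** The integral of a bounded limit, for integrals that are eventually
    constant. *)
Lemma cint_eventually (G : nat -> d.-tuple mT -> C) F (B : R) (c : C) (N : nat) :
    (forall n, cbounded (G n)) -> measurable_fun [set: d.-tuple mT] F ->
    (forall n t, normc (G n t) <= B) ->
    (forall t, Re (G n t) @[n --> \oo] --> Re (F t)) ->
    (forall t, Im (G n t) @[n --> \oo] --> Im (F t)) ->
    (forall n, (N <= n)%N -> cint mu (G n) = c) -> cint mu F = c.
Proof.
move=> bG /measurable_complexP[mr mi] GB gr gi Gc.
have [|||||_ hr] := @Rint_dominated _ _ _ mu (fun n t => Re (G n t)) (fun t => Re (F t)) (fun=> B) => //.
- by move=> n; have [[]] := bG n.
- exact: aeW.
- exact/Rintegrable_bm/bm_cst.
- by move=> n t; exact: le_trans (normRe_le _) (GB n t).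
have [|||||_ hi] := @Rint_dominated _ _ _ mu (fun n t => Im (G n t)) (fun t => Im (F t)) (fun=> B) => //.
- by move=> n; have [_ []] := bG n.
- exact: aeW.
- exact/Rintegrable_bm/bm_cst.
- by move=> n t; exact: le_trans (normIm_le _) (GB n t).
apply/eqP; rewrite eq_complex; apply/andP; split; apply/eqP.
- apply: (cvg_unique _ hr) => //; apply: cvg_near_cst; exists N => // n /= Nn.
  by rewrite -(Gc n Nn).
- apply: (cvg_unique _ hi) => //; apply: cvg_near_cst; exists N => // n /= Nn.
  by rewrite -(Gc n Nn).
Qed.

(** Absolute convergence makes the Fourier series of [x] converge to some bounded
    function [F] with the coefficients of [x]; by uniqueness of the coefficients
    it is [x] itself, and the remainders of the series are bounded by those of
    the sum of the absolute values. *)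
Lemma fourier_tail (x : L0 mu) (N : nat) (tau : R) : cintegrable mu x ->
    (\sum_(0 <= j <oo) (normc (coef j x))%:E < +oo)%E ->
    (\sum_(N <= j <oo) (normc (coef j x))%:E <= tau%:E)%E ->
  {ae mu, forall t, normc (x t - \sum_(k < N) coef k x * chi (kk k) t) <= tau}.
Proof.
move=> xi cf tl; pose c j := coef j x.
pose S n t := \sum_(k < n) c k * chi (kk k) t.
have SE n t : S n t = \sum_(0 <= k < n) c k * chi (kk k) t by rewrite big_mkord.
have cS : cvgn (series (fun j => normc (c j))).
  by apply: nnseries_is_cvg => // j; exact: normc_ge0.
have ndS n : \sum_(0 <= j < n) normc (c j) <= limn (series (fun j => normc (c j))).
  apply: (nondecreasing_cvgn_le _ cS n).
  by apply: nondecreasing_series => j _ _; exact: normc_ge0.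
pose B := limn (series (fun j => normc (c j))).
have nct k t : normc (c k * chi (kk k) t) = normc (c k).
  by rewrite Normc.normcM normc_expi mulr1.
have Sb n t : normc (S n t) <= B.
  apply: le_trans (ndS n); rewrite SE; apply: le_trans (normc_sum _ _) _.
  by apply: ler_sum => k _; rewrite nct.
have cv (proj : C -> R) t : (forall z, `|proj z| <= normc z) ->
    cvgn (series (fun j => proj (c j * chi (kk j) t))).
  move=> hp; apply: normed_cvg; apply: series_le_cvg cS.
  - by move=> j; exact: normr_ge0.
  - by move=> j; exact: normc_ge0.
  - by move=> j; rewrite -[leRHS](nct j t); exact: hp.
pose F t : C := (limn (series (fun j => Re (c j * chi (kk j) t))) +i*
                 limn (series (fun j => Im (c j * chi (kk j) t))))%C.
have SR t : Re (S n t) @[n --> \oo] --> Re (F t).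
  under eq_fun do rewrite SE Re_sum; exact: (cv _ t (@normRe_le R)).
have SI t : Im (S n t) @[n --> \oo] --> Im (F t).
  under eq_fun do rewrite SE Im_sum; exact: (cv _ t (@normIm_le R)).
have bS n : cbounded (S n) := cbounded_comb kk (fun k : 'I_n => c k).
have mF : measurable_fun setT F.
  apply/measurable_complexP; split.
    by apply: (measurable_fun_cvg (h := fun n t => Re (S n t))) => [n|t _]; [case: (bS n) => -[]|exact: SR].
  by apply: (measurable_fun_cvg (h := fun n t => Im (S n t))) => [n|t _]; [case: (bS n) => _ []|exact: SI].
have Fb t : normc (F t) <= B.
  by apply: (cvgr_to_le (normc_cvg (SR t) (SI t))); apply: nearW => n.
have bF : cbounded F.
  have [mr mi] := (measurable_complexP F).1 mF.
  split; split=> //; exists B => t.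
    exact: le_trans (normRe_le _) (Fb t).
  exact: le_trans (normIm_le _) (Fb t).
have FN t : normc (F t - S N t) <= tau.
  have cN : normc (S n t - S N t) @[n --> \oo] --> normc (F t - S N t).
    apply: normc_cvg.
      under eq_fun do rewrite cReD cReN.
      by rewrite cReD cReN; apply: cvgB; [exact: SR|exact: cvg_cst].
    under eq_fun do rewrite cImD cImN.
    by rewrite cImD cImN; apply: cvgB; [exact: SI|exact: cvg_cst].
  apply: (cvgr_to_le cN); exists N => // n /= Nn.
  rewrite !SE (big_cat_nat _ (n := N))//= addrAC subrr add0r.
  apply: le_trans (normc_sum _ _) _; rewrite -lee_fin; apply: le_trans tl.
  rewrite (eq_bigr (fun k => normc (c k))); last by move=> k _; rewrite nct.
  rewrite -sumEFin; apply: (le_trans _ (nneseries_lim_ge _ _)) => //.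
  by move=> k _ _; rewrite lee_fin normc_ge0.
have fcF k : fc F k = fourier_coef x k.
  have [h hK Kh] := kk_bij; rewrite -(Kh k).
  have fS n : (h k < n)%N -> fc (S n) (kk (h k)) = c (h k).
    by move=> hn; rewrite -(fc_combE kk_bij (fun k : 'I_n => c k) (Ordinal hn)).
  apply: (@cint_eventually (fun n t => S n t * expi (- phase (kk (h k)) t)) _ B _ (h k).+1).
  - by move=> n; apply: cboundedM => //; exact: cbounded_chiN.
  - by apply: cbounded_measurable; apply: cboundedM => //; exact: cbounded_chiN.
  - by move=> n t; rewrite Normc.normcM normc_expi mulr1.
  - move=> t; under eq_fun do rewrite cReM; rewrite cReM.
    by apply: cvgB; (apply: cvgM; last exact: cvg_cst); [exact: SR|exact: SI].
  - move=> t; under eq_fun do rewrite cImM; rewrite cImM.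
    by apply: cvgD; (apply: cvgM; last exact: cvg_cst); [exact: SR|exact: SI].
  - exact: fS.
have iF := cbounded_integrable mu bF.
have ae0 : {ae mu, forall t, (-1) * F t + x t = 0}.
  apply: torus_cuniqueness => [|k].
    by apply: cintegrableD => //; exact: cintegrableZ.
  by rewrite fc_lin// fcF fourier_coefE mulN1r addNr.
by apply: filterS ae0 => t; rewrite mulN1r addrC => /subr0_eq ->; exact: FN.
Qed.

(** The l2 norm of the remainder of the Fourier series is at most its supremum,
    hence at most the sum of the coefficients beyond [N], whose weights are at
    least [wj N]. *)
Let wiener_tail N (x : L0 mu) :
  ((\sum_(k < N) wj k * normc (coef k x))%:E
      + (wj N)%:E * L2_norm (x - \sum_(k < N) coef k x *: e k)%R <= wiener_norm w x)%E.
Proof.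
have [xf|] := ltP (wiener_norm w x) +oo%E; last by rewrite leye_eq => /eqP ->; rewrite leey.
have xi := wiener_cintegrable xf.
move: xf; rewrite wiener_norm_series// => xf.
have tl0 M : (0 <= \sum_(M <= j <oo) (wj j * normc (coef j x))%:E)%E.
  by apply: nneseries_ge0 => j _ _.
have nt0 M : (0 <= \sum_(M <= j <oo) (normc (coef j x))%:E)%E.
  by apply: nneseries_ge0 => j _ _; rewrite lee_fin normc_ge0.
have sp := @nneseries_split R (fun j => (wj j * normc (coef j x))%:E) 0 N (fun j _ => term_ge0 x j).
rewrite sp big_mkord add0n sumEFin leeD2l//.
have le1 M : (\sum_(M <= j <oo) (normc (coef j x))%:E <= \sum_(M <= j <oo) (wj j * normc (coef j x))%:E)%E.
  apply: lee_nneseries => j _ ; rewrite lee_fin ?normc_ge0//.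
  by rewrite ler_peMl ?normc_ge0//; exact: w_ge1.
have leN : ((wj N)%:E * \sum_(N <= j <oo) (normc (coef j x))%:E <= \sum_(N <= j <oo) (wj j * normc (coef j x))%:E)%E.
  rewrite -nneseriesZl//; last by move=> j _; rewrite lee_fin normc_ge0.
  rewrite eseries_cond [leRHS]eseries_cond; apply: lee_nneseries => j.
    by move=> _ _; rewrite mule_ge0// lee_fin ?normc_ge0// ltW.
  by move=> /andP[_ Nj]; rewrite lee_fin ler_wpM2r ?normc_ge0//; exact: w_mono.
have cf : (\sum_(0 <= j <oo) (normc (coef j x))%:E < +oo)%E by exact: le_lt_trans (le1 0) xf.
have Tf : (\sum_(N <= j <oo) (normc (coef j x))%:E < +oo)%E.
  apply: le_lt_trans (le1 N) _; apply: le_lt_trans xf.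
  by rewrite sp leeDr// sumEFin lee_fin sumr_ge0// => j _; rewrite -lee_fin.
apply: le_trans leN; rewrite lee_pmul2l// ?lte_fin//.
move: cf Tf (nt0 N) (@fourier_tail x N); case: (\sum_(N <= j <oo) _)%E => // tau cf _.
rewrite lee_fin => tau0 /(_ tau xi cf (lexx _)) ae.
rewrite /L2_norm Lp2E.
have -> : tau%:E = ((\int[mu]_x (tau ^+ 2)%:E) `^ 2^-1)%E.
  rewrite integral_cst//= probability_setT mule1 poweR_EFin powR12_sqrt ?sqr_ge0//.
  by rewrite sqrtr_sqr ger0_norm.
have itv (h : d.-tuple mT -> R) : (\int[mu]_x (h x ^+ 2)%:E)%E \in `[0%E, +oo%E].
  by rewrite in_itv /= leey andbT; apply: integral_ge0 => t _; rewrite lee_fin sqr_ge0.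
have half : 0 <= 2^-1 :> R by [].
apply: (gt0_ler_poweR half (itv _) (itv _)).
apply: ae_ge0_le_integral => //.
- by move=> t _; rewrite lee_fin sqr_ge0.
- exact/measurable_normc2/measurable_L0.
- by move=> t _; rewrite lee_fin sqr_ge0.
have h1 := comb_ae (fun k : 'I_N => coef k x).
have h2 := L0_linE (-1) (\sum_(k < N) coef k x *: e k : L0 mu) x.
move: ae; apply: filter_app; move: h1; apply: filter_app; apply: filterS h2 => t.
rewrite scaleN1r addrC => -> -> + _.
rewrite mulN1r addrC lee_fin => h; rewrite ler_pXn2r ?nnegrE ?normc_ge0//.
Qed.

Lemma wiener_system : weighted_l1_in_l2 (wiener_norm w) (@L2_norm R d) wj coef e.
Proof.
split.
- by move=> k; exact: w_ge1.
- exact: w_mono.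
- exact: w_unbounded.
- move=> a x y xf yf.
  have xi := wiener_cintegrable xf; have yi := wiener_cintegrable yf.
  rewrite wiener_norm_series; last exact: cintegrable_lin.
  apply: (@le_lt_trans _ _ ((normc a)%:E * wiener_norm w x + wiener_norm w y)%E).
    rewrite !wiener_norm_series// -nneseriesZl// -nneseriesD//; last first.
      by move=> j _ _; rewrite mule_ge0// lee_fin normc_ge0.
    apply: lee_nneseries => j; first by move=> _ _; exact: term_ge0.
    move=> _; rewrite coef_lin// -EFinM -EFinD lee_fin mulrCA -mulrDr ler_wpM2l//; first exact: ltW.
    by rewrite -Normc.normcM le_normcD.
  rewrite lte_add_pinfty//; have x0 : (0 <= wiener_norm w x)%E.
    by rewrite wiener_norm_series//; apply: nneseries_ge0.
  by move: xf x0; case: (wiener_norm w x) => [u| |]//= _ _; rewrite -EFinM ltry.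
- move=> a x xf; have xi := wiener_cintegrable xf.
  have axi := cintegrable_scale a xi.
  rewrite !wiener_norm_series// -nneseriesZl//; apply: eq_eseriesr => j _.
  by rewrite coefZ// Normc.normcM -EFinM mulrCA.
- exact: Lp2_triangle.
- exact: Lp2_homog.
- exact: Lp2_eq0.
- move=> k a x y xf yf; apply: coef_lin; exact: wiener_cintegrable.
- move=> k a x y xf yf; apply: coef_lin; exact: Lp2_cintegrable.
- exact: coef_comb.
- exact: wiener_comb.
- exact: L2_comb.
- exact: L2_bessel.
- exact: wiener_tail.
Qed.

End WienerSystem.

(** * Sums of powers of logarithms *)

Section LogSums.
Context {R : realType}.
Implicit Types (T a b : R) (m n : nat).

Lemma subX_ge m a b : 0 <= b <= a -> m.+1%:R * b ^+ m * (a - b) <= a ^+ m.+1 - b ^+ m.+1.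
Proof.
move=> /andP[b0 ba]; rewrite subrXX mulrC ler_wpM2l ?subr_ge0//.
rewrite -[m.+1 in leLHS]card_ord -sum1_card natr_sum mulr_suml; apply: ler_sum => i _.
rewrite mul1r /= -[X in b ^+ X <= _](subnK (ltn_ord i : (i <= m)%N)) exprD.
by rewrite ler_wpM2r ?exprn_ge0// lerXn2r// ?nnegrE// (le_trans b0).
Qed.

Lemma subX_le m a b : 0 <= b <= a -> a ^+ m.+1 - b ^+ m.+1 <= m.+1%:R * a ^+ m * (a - b).
Proof.
move=> /andP[b0 ba]; rewrite subrXX [leRHS]mulrC ler_wpM2l ?subr_ge0//.
have a0 := le_trans b0 ba.
rewrite -[m.+1 in leRHS]card_ord -sum1_card natr_sum mulr_suml; apply: ler_sum => i _.
rewrite mul1r /= -[X in _ <= a ^+ X](subnK (ltn_ord i : (i <= m)%N)) exprD.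
by rewrite ler_wpM2l ?exprn_ge0// lerXn2r// ?nnegrE.
Qed.

Lemma ln_succ_le n : ln (n.+2%:R / n.+1%:R : R) <= n.+1%:R^-1.
Proof.
rewrite (_ : _ / _ = 1 + n.+1%:R^-1); last first.
  by rewrite -[n.+2]addn1 natrD mulrDl mul1r divff// pnatr_eq0.
by apply: le_ln1Dx; rewrite (lt_le_trans _ (_ : 0 <= _))// ?ltrN10// invr_ge0.
Qed.

Lemma ln_succ_ge n : n.+2%:R^-1 <= ln (n.+2%:R / n.+1%:R : R).
Proof.
rewrite -[leRHS]opprK -lnV ?posrE ?divr_gt0// lerNr invf_div.
rewrite (_ : _ / _ = 1 + - n.+2%:R^-1); last first.
  have n2 : n.+2%:R != 0 :> R by rewrite pnatr_eq0.
  by apply: (mulIf n2); rewrite divfK// mulrBl mul1r mulVf// -[n.+2%:R]natr1 addrK.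
by apply: le_ln1Dx; rewrite ltrN2 invf_lt1// ltr1n.
Qed.

Lemma ln_quot T n : 0 < T -> ln (T / n.+1%:R) - ln (T / n.+2%:R) = ln (n.+2%:R / n.+1%:R).
Proof. by move=> T0; rewrite !ln_div ?posrE//; ring. Qed.

(** The sums are Riemann sums of the primitive [- ln (T / x) ^+ m.+1 / m.+1] of
    [ln (T / x) ^+ m / x], compared term by term by means of
    [m.+1 * b ^+ m * (a - b) <= a ^+ m.+1 - b ^+ m.+1 <= m.+1 * a ^+ m * (a - b)]
    for successive values [a], [b] of [ln (T / j)]. *)
Lemma logsum_le m n T : n.+1%:R <= T ->
  \sum_(1 <= j < n.+2) ln (T / j%:R) ^+ m / j%:R <=
    (ln T ^+ m.+1 - ln (T / n.+1%:R) ^+ m.+1) / m.+1%:R + ln T ^+ m.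
Proof.
elim: n => [|n IH] nT; first by rewrite big_nat1 !divr1 subrr mul0r add0r.
have T0 : 0 < T by apply: lt_le_trans nT.
rewrite big_nat_recr//=.
have nT' : n.+1%:R <= T by apply: le_trans nT; rewrite ler_nat.
apply: le_trans (lerD (IH nT') (lexx _)) _.
set a := ln (T / n.+1%:R); set b := ln (T / n.+2%:R).
have b0 : 0 <= b by apply: ln_ge0; rewrite ler_pdivlMr// mul1r.
have ba : a - b = ln (n.+2%:R / n.+1%:R) by exact: ln_quot.
have lo := ln_succ_ge n.
have ab : b <= a by rewrite -subr_ge0 ba (le_trans _ lo)// invr_ge0.
have h := @subX_ge m a b; rewrite b0 ab in h; have {}h := h isT.
have h2 : b ^+ m / n.+2%:R <= (a ^+ m.+1 - b ^+ m.+1) / m.+1%:R.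
  rewrite ler_pdivlMr//; apply: le_trans h; rewrite ba mulrC mulrA.
  by rewrite ler_wpM2l// mulr_ge0// exprn_ge0.
have -> : (ln T ^+ m.+1 - b ^+ m.+1) / m.+1%:R =
    (ln T ^+ m.+1 - a ^+ m.+1) / m.+1%:R + (a ^+ m.+1 - b ^+ m.+1) / m.+1%:R.
  by rewrite -mulrDl subrKA.
by rewrite addrAC lerD2r lerD2l.
Qed.

Lemma logsum_ge m n T : n.+1%:R <= T ->
  (ln T ^+ m.+1 - ln (T / n.+1%:R) ^+ m.+1) / m.+1%:R <=
    \sum_(1 <= j < n.+1) ln (T / j%:R) ^+ m / j%:R.
Proof.
elim: n => [|n IH] nT; first by rewrite big_geq// divr1 subrr mul0r.
have T0 : 0 < T by apply: lt_le_trans nT.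
rewrite big_nat_recr//=.
have nT' : n.+1%:R <= T by apply: le_trans nT; rewrite ler_nat.
apply: le_trans (lerD (IH nT') (lexx _)).
set a := ln (T / n.+1%:R); set b := ln (T / n.+2%:R).
have b0 : 0 <= b by apply: ln_ge0; rewrite ler_pdivlMr// mul1r.
have ba : a - b = ln (n.+2%:R / n.+1%:R) by exact: ln_quot.
have lo := ln_succ_ge n; have hi := ln_succ_le n.
have ab : b <= a by rewrite -subr_ge0 ba (le_trans _ lo)// invr_ge0.
have h := @subX_le m a b; rewrite b0 ab in h; have {}h := h isT.
have h2 : (a ^+ m.+1 - b ^+ m.+1) / m.+1%:R <= a ^+ m / n.+1%:R.
  rewrite ler_pdivrMr//; apply: le_trans h _; rewrite ba [leRHS]mulrC mulrA.
  by rewrite ler_wpM2l// mulr_ge0// exprn_ge0// (le_trans b0).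
by rewrite -[X in X / _ <= _](subrKA (a ^+ m.+1)) mulrDl lerD2l.
Qed.

Lemma logsum_trunc_le m T : 1 <= T ->
  \sum_(1 <= j < (Num.truncn T).+1) ln (T / j%:R) ^+ m / j%:R <=
    ln T ^+ m.+1 / m.+1%:R + ln T ^+ m.
Proof.
move=> T1; have T0 : 0 <= T := le_trans ler01 T1.
have /andP[nT Tn] := truncn_itv T0.
case E : (Num.truncn T) => [|n]; first by move: Tn; rewrite E ltNge T1.
rewrite E in nT; apply: le_trans (logsum_le m nT) _.
rewrite lerD2r mulrBl gerBl// divr_ge0// exprn_ge0// ln_ge0//.
by rewrite ler_pdivlMr// mul1r.
Qed.

Lemma logsum_trunc_ge m T : 1 <= T ->
  ln T ^+ m.+1 / m.+1%:R - 1 <=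
    \sum_(1 <= j < Num.truncn T) ln (T / j%:R) ^+ m / j%:R.
Proof.
move=> T1; have T0 : 0 <= T := le_trans ler01 T1.
have /andP[nT Tn] := truncn_itv T0.
case E : (Num.truncn T) => [|n]; first by move: Tn; rewrite E ltNge T1.
rewrite E in nT Tn; apply: le_trans (logsum_ge m nT).
rewrite mulrBl lerD2l lerNl opprK.
have a1 : 1 <= T / n.+1%:R by rewrite ler_pdivlMr// mul1r.
have a2 : T / n.+1%:R <= 2.
  rewrite ler_pdivrMr// (le_trans (ltW Tn))// -natrM ler_nat; lia.
have l0 := ln_ge0 a1.
have l1 : ln (T / n.+1%:R) <= 1.
  move: (T / n.+1%:R) a1 a2 {l0} => y a1 a2.
  by rewrite -[y](subrK 1) addrC; apply: le_trans (le_ln1Dx _) _; lra.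
rewrite ler_pdivrMr// mul1r (@le_trans _ _ 1)// ?exprn_ile1// ler1n//.
Qed.

Lemma sum_lt_indicator M J : \sum_(1 <= j < M) (j < J)%:R <= J%:R :> R.
Proof.
suff h : (\sum_(1 <= j < M) (j < J) <= minn M J)%N.
  rewrite -natr_sum ler_nat; apply: leq_trans h _; exact: geq_minr.
elim: M => [|M IH]; first by rewrite big_geq.
case: M IH => [|M] IH; first by rewrite big_geq.
rewrite big_nat_recr//=; move: IH; move: (\sum_(_ <= _ < _) _)%N => S; lia.
Qed.

(** Lower powers of the logarithm are negligible: for large [T] each term is
    at most half of [eps * T * ln T ^+ m.+1], and for the others the left side
    is bounded. *)
Lemma absorb (K eps : R) m : 0 <= K -> 0 < eps -> exists2 C, 0 <= C &
  forall T, 1 <= T -> K * T * ln T ^+ m + K * T <= eps * T * ln T ^+ m.+1 + C.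
Proof.
move=> K0 e0; pose L0 := 2 * K / eps + 1.
have L00 : 0 <= 2 * K / eps by rewrite divr_ge0 ?mulr_ge0// ltW.
have L01 : 1 <= L0 by rewrite /L0 lerDr.
exists (K * expR L0 * (L0 ^+ m + 1)).
  by rewrite !mulr_ge0 ?expR_ge0 ?addr_ge0 ?exprn_ge0// (le_trans ler01).
move=> T T1; have l0 := ln_ge0 T1.
have T0 : 0 < T := lt_le_trans ltr01 T1.
have Tp : T \is Num.pos by rewrite posrE.
have [LL|LL] := leP L0 (ln T).
  have C0 : 0 <= K * expR L0 * (L0 ^+ m + 1).
    by rewrite !mulr_ge0 ?expR_ge0 ?addr_ge0 ?exprn_ge0// (le_trans ler01).
  have h1 : 1 <= ln T ^+ m by apply: exprn_ege1; exact: le_trans LL.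
  have h2 : 2 * K <= eps * ln T.
    have : 2 * K / eps <= ln T by apply: le_trans LL; rewrite lerDl.
    by rewrite ler_pdivrMr// [X in _ <= X -> _]mulrC.
  rewrite exprS; move: (ln T ^+ m) h1 C0 => X h1 C0.
  have : K * T <= K * T * X by rewrite ler_peMr// mulr_ge0// ltW.
  have : 2 * K * (T * X) <= eps * ln T * (T * X).
    by rewrite ler_wpM2r// mulr_ge0 ?(ltW T0)// (le_trans ler01).
  nra.
have h1 : ln T ^+ m <= L0 ^+ m.
  by rewrite lerXn2r ?nnegrE ?(ltW LL)//; exact: le_trans ler01 L01.
have h2 : T <= expR L0 by rewrite -(lnK Tp) ler_expR ltW.
have h3 : 0 <= eps * T * ln T ^+ m.+1 by rewrite !mulr_ge0 ?exprn_ge0// ltW.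
apply: le_trans (_ : K * expR L0 * (L0 ^+ m + 1) <= _); last by rewrite lerDr.
rewrite -[X in _ + X]mulr1 -mulrDr ler_pM ?mulr_ge0 ?addr_ge0 ?exprn_ge0// ?(ltW T0)//.
  by rewrite ler_wpM2l.
by rewrite lerD2r.
Qed.

End LogSums.

(** * Adding one dimension to a counting function *)

Section Counting.
Context {R : realType}.

(** Half of [F T ~ A * T * ln T ^+ m], with an additive constant that makes the
    inequality hold for all [T >= 1]; it can then be summed over the values
    [T / j]. *)
Definition asym_le (F : R -> R) (A : R) (m : nat) := forall eps, 0 < eps ->
  exists2 C, 0 <= C & forall T, 1 <= T -> F T <= (A + eps) * T * ln T ^+ m + C.

Definition asym_ge (F : R -> R) (A : R) (m : nat) := forall eps, 0 < eps ->
  exists2 C, 0 <= C & forall T, 1 <= T -> (A - eps) * T * ln T ^+ m - C <= F T.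

Variable p : nat -> R.
Hypothesis p0 : p 0%N = 1.
Hypothesis p_ge1 : forall j, 1 <= p j.
Hypothesis p_ge : forall j, j%:R <= p j.
Hypothesis p_asym : forall eps, 0 < eps -> exists J, forall j, (J <= j)%N -> p j <= (1 + eps) * j%:R.

Let p_gt0 j : 0 < p j. Proof. exact: lt_le_trans (p_ge1 j). Qed.

Section Step.
Variables (F G : R -> R).
Hypothesis F_mono : forall a b, a <= b -> F a <= F b.
Hypothesis F_ge0 : forall a, 0 <= F a.
Hypothesis GE : forall T, 1 <= T ->
  G T = F T + 2 * \sum_(1 <= j < (Num.truncn T).+1) F (T / p j).

(** As [p j >= j], the values [F (T / p j)] are at most [F (T / j)]; the sum of
    [A * (T / j) * ln (T / j) ^+ m] over [j <= T] is about
    [A * T * ln T ^+ m.+1 / m.+1], and the rest is absorbed. *)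
Lemma asym_step_le A m : 0 < A -> asym_le F A m -> asym_le G (2 * A / m.+1%:R) m.+1.
Proof.
move=> A0 FA eps e0; have e40 : 0 < eps / 4 by rewrite divr_gt0.
have [C1 C10 hC1] := FA _ e40.
pose K := 3 * (A + eps / 4) + 3 * C1.
have K0 : 0 <= K by rewrite /K; lra.
have e20 : 0 < eps / 2 by rewrite divr_gt0.
have [C C0 hC] := absorb m K0 e20.
exists C => // T T1; have l0 := ln_ge0 T1.
have T0 : 0 < T := lt_le_trans ltr01 T1.
have Lm0 : 0 <= ln T ^+ m by rewrite exprn_ge0.
have Lm1 : 0 <= ln T ^+ m.+1 by rewrite exprn_ge0.
rewrite GE//.
have S : \sum_(1 <= j < (Num.truncn T).+1) F (T / p j) <=
    (A + eps / 4) * T * (ln T ^+ m.+1 / m.+1%:R + ln T ^+ m) + C1 * T.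
  have /andP[nT _] := truncn_itv (ltW T0).
  apply: (@le_trans _ _ (\sum_(1 <= j < (Num.truncn T).+1)
      ((A + eps / 4) * T * (ln (T / j%:R) ^+ m / j%:R) + C1))).
    apply: ler_sum_nat => j /andP[j1 jT].
    have j0 : 0 < j%:R :> R by rewrite ltr0n.
    have jT' : j%:R <= T by apply: le_trans nT; rewrite ler_nat.
    apply: (@le_trans _ _ (F (T / j%:R))).
      by apply: F_mono; rewrite ler_wpM2l ?(ltW T0)// lef_pV2 ?posrE.
    have := hC1 (T / j%:R); rewrite ler_pdivlMr// mul1r => /(_ jT').
    by rewrite !mulrA -![_ / j%:R * _]mulrA [j%:R^-1 * _]mulrC !mulrA.
  rewrite big_split /= -mulr_sumr; apply: lerD.
    by rewrite ler_wpM2l ?mulr_ge0 ?(ltW T0)//; [lra|exact: logsum_trunc_le].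
  by rewrite sumr_const_nat subn1 /= -[leLHS]mulr_natr ler_wpM2l.
have hT := hC1 T T1; have hA := hC T T1.
have m1 : 1 <= m.+1%:R :> R by rewrite ler1n.
have iv : m.+1%:R^-1 <= 1 :> R by rewrite invf_le1.
have iv0 : 0 <= m.+1%:R^-1 :> R by rewrite invr_ge0.
move: hA S hT; rewrite /K.
move: (ln T ^+ m) (ln T ^+ m.+1) (m.+1%:R^-1) Lm0 Lm1 iv iv0 => X Y v X0 Y0 v1 v0 hA S hT.
have : C1 <= C1 * T by rewrite ler_peMr.
have : 0 <= T * Y * (1 - v) * eps by rewrite !mulr_ge0 ?subr_ge0// ltW.
nra.
Qed.

Lemma shift_mono (delta : R) (J : nat) T j : 0 < delta ->
  (forall j, (J <= j)%N -> p j <= (1 + delta) * j%:R) -> (0 < j)%N -> (J <= j)%N ->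
  0 <= T -> F (T / (1 + delta) / j%:R) <= F (T / p j).
Proof.
move=> d0 hJ j0 Jj T0; apply: F_mono; rewrite -mulrA ler_wpM2l// -invfM lef_pV2 ?posrE ?hJ//.
by rewrite mulr_gt0 ?ltr0n// addr_gt0.
Qed.

Lemma truncn_mono (a b : R) : 0 <= a -> a <= b -> (Num.truncn a <= Num.truncn b)%N.
Proof.
move=> a0 ab; rewrite truncn_ge_nat ?(le_trans a0)//.
by apply: le_trans ab; rewrite truncn_le.
Qed.

(** As [p j <= (1 + dl) * j] from some [J] on, the values [F (T / p j)] are at
    least [F (T' / j)] for [T' = T / (1 + dl)]; the finitely many [j < J] and the
    loss from [T] to [T'] are absorbed. *)
Lemma asym_step_ge A m : 0 < A -> asym_ge F A m -> asym_ge G (2 * A / m.+1%:R) m.+1.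
Proof.
move=> A0 FA eps e0.
pose e1 := Num.min (eps / 8) A.
have e1A : e1 <= A by rewrite /e1 ge_min lexx orbT.
have e1e : e1 <= eps / 8 by rewrite /e1 ge_min lexx.
have e10 : 0 < e1 by rewrite /e1 lt_min A0 divr_gt0.
pose dl := eps / (8 * A).
have dl0 : 0 < dl by rewrite /dl divr_gt0// mulr_gt0.
have dlA : A * dl = eps / 8 by rewrite /dl; field; rewrite gt_eqF.
have [J hJ] := p_asym dl0.
have [C1 C10 hC1] := FA _ e10.
pose K := 2 * (A * dl + J%:R * A + A + C1).
have Ad0 : 0 <= A * dl by rewrite mulr_ge0// ltW.
have JA0 : 0 <= J%:R * A by rewrite mulr_ge0// ltW.
have K0 : 0 <= K by rewrite /K; lra.
have e20 : 0 < eps / 2 by rewrite divr_gt0.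
have [C C0 hC] := absorb m K0 e20.
have m1 : 1 <= m.+1%:R :> R by rewrite ler1n.
have iv : m.+1%:R^-1 <= 1 :> R by rewrite invf_le1.
have iv0 : 0 < m.+1%:R^-1 :> R by rewrite invr_gt0.
(* covers the values of T below 1 + dl, where T' is too small *)
pose C2 := 2 * A * (1 + dl) * dl ^+ m.+1.
have C20 : 0 <= C2 by rewrite /C2 !mulr_ge0 ?exprn_ge0 ?addr_ge0// ltW.
exists (C + C2); first by rewrite addr_ge0.
move=> T T1; have l0 := ln_ge0 T1.
have T0 : 0 < T := lt_le_trans ltr01 T1.
have Lm0 : 0 <= ln T ^+ m by rewrite exprn_ge0.
have Lm1 : 0 <= ln T ^+ m.+1 by rewrite exprn_ge0.
have d1 : 0 < 1 + dl by rewrite addr_gt0.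
have ld : ln (1 + dl) <= dl by apply: le_ln1Dx; lra.
have G0 : 0 <= G T by rewrite GE// addr_ge0// mulr_ge0// sumr_ge0.
pose T' := T / (1 + dl).
have [T'1|T'1] := ltP T' 1.
  have Td : T < 1 + dl by move: T'1; rewrite /T' ltr_pdivrMr// mul1r.
  have Ld : ln T <= dl.
    by apply: le_trans ld; rewrite ler_ln ?posrE// ltW.
  apply: le_trans G0; rewrite subr_le0; apply: (@le_trans _ _ C2); last by rewrite lerDr.
  have h1 : ln T ^+ m.+1 <= dl ^+ m.+1 by rewrite lerXn2r// ?nnegrE// ltW.
  have h2 : (2 * A / m.+1%:R - eps) * T <= 2 * A * (1 + dl).
    apply: (@le_trans _ _ (2 * A * T)).
      rewrite ler_wpM2r ?(ltW T0)//.
      have : 2 * A / m.+1%:R <= 2 * A by rewrite ler_piMr// mulr_ge0// ltW.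
      by move: (2 * A / m.+1%:R) => x; lra.
    by rewrite ler_wpM2l ?mulr_ge0// ltW.
  apply: (@le_trans _ _ (2 * A * (1 + dl) * ln T ^+ m.+1)); first by rewrite ler_wpM2r.
  by rewrite ler_wpM2l// !mulr_ge0// ltW.
have T'0 : 0 < T' := lt_le_trans ltr01 T'1.
have T'T : T' <= T by rewrite ler_pdivrMr// ler_peMr ?(ltW T0)// lerDl ltW.
have LE : ln T' = ln T - ln (1 + dl) by rewrite /T' ln_div ?posrE.
have l'0 := ln_ge0 T'1.
have ld0 : 0 <= ln (1 + dl) by apply: ln_ge0; rewrite lerDl ltW.
have LT : ln T' <= ln T by rewrite LE gerBl.
have sumge : (A - e1) * T' * (ln T' ^+ m.+1 / m.+1%:R - 1) - C1 * T - J%:R * A * T * ln T ^+ m <=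
    \sum_(1 <= j < (Num.truncn T).+1) F (T / p j).
  have tt : (Num.truncn T' <= Num.truncn T)%N by apply: truncn_mono; rewrite // ltW.
  have /andP[nT' _] := truncn_itv (ltW T'0).
  have /andP[nT _] := truncn_itv (ltW T0).
  apply: (@le_trans _ _ (\sum_(1 <= j < Num.truncn T') F (T / p j))); last first.
    have [c1|c1] := leqP 1 (Num.truncn T'); last by rewrite big_geq ?sumr_ge0// ltnW.
    rewrite [leRHS](big_cat_nat _ (n := Num.truncn T'))//=; last exact: leq_trans tt _.
    by rewrite lerDl sumr_ge0.
  apply: (@le_trans _ _ (\sum_(1 <= j < Num.truncn T')
      ((A - e1) * T' * (ln (T' / j%:R) ^+ m / j%:R) - C1 - (A * T * ln T ^+ m) * (j < J)%:R))).
    rewrite !big_split /= -mulr_sumr !sumrN -mulr_sumr; apply: lerB; first apply: lerB.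
    - by rewrite ler_wpM2l ?logsum_trunc_ge// mulr_ge0 ?(ltW T'0)// subr_ge0.
    - rewrite sumr_const_nat -[leLHS]mulr_natr ler_wpM2l//.
      by apply: le_trans nT; rewrite ler_nat (leq_trans _ tt)// leq_subr.
    - have -> : J%:R * A * T * ln T ^+ m = A * T * ln T ^+ m * J%:R by ring.
      rewrite ler_wpM2l//; last exact: sum_lt_indicator.
      by rewrite !mulr_ge0// ltW.
  apply: ler_sum_nat => j /andP[j1 jT].
  have j0 : 0 < j%:R :> R by rewrite ltr0n.
  have jT' : j%:R <= T' by apply: le_trans nT'; rewrite ler_nat ltnW.
  have a1 : 1 <= T' / j%:R by rewrite ler_pdivlMr// mul1r.
  have la0 := ln_ge0 a1.
  have lnle : ln (T' / j%:R) <= ln T.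
    rewrite ler_ln ?posrE ?divr_gt0//; apply: le_trans T'T.
    by rewrite ler_pdivrMr// ler_peMr ?(ltW T'0)// ler1n.
  have X0 : 0 <= (A - e1) * T' * (ln (T' / j%:R) ^+ m / j%:R).
    by rewrite !mulr_ge0 ?subr_ge0 ?exprn_ge0 ?invr_ge0// ltW.
  have [Jj|Jj] := leqP J j.
    rewrite mulr0 subr0; apply: le_trans (shift_mono dl0 hJ j1 Jj (ltW T0)).
    apply: le_trans (hC1 _ a1); rewrite -/T' lerD2r.
    by rewrite !mulrA -![_ / j%:R * _]mulrA [j%:R^-1 * _]mulrC !mulrA.
  rewrite mulr1; apply: le_trans (F_ge0 _); rewrite subr_le0 lerBlDr.
  apply: ler_wpDr => //; rewrite -[leLHS]mulrA -[leRHS]mulrA.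
  have Y1 : ln (T' / j%:R) ^+ m / j%:R <= ln T ^+ m.
    rewrite ler_pdivrMr//; apply: le_trans (_ : ln T ^+ m * 1 <= _).
      by rewrite mulr1 lerXn2r// nnegrE.
    by rewrite ler_wpM2l// ler1n.
  apply: ler_pM; rewrite ?subr_ge0//.
  - by apply: mulr_ge0; [exact: ltW|rewrite mulr_ge0 ?exprn_ge0 ?invr_ge0].
  - by rewrite gerBl ltW.
  - by apply: ler_pM => //; rewrite ?(ltW T'0)// mulr_ge0 ?exprn_ge0 ?invr_ge0.
have powge : ln T ^+ m.+1 / m.+1%:R - dl * ln T ^+ m <= ln T' ^+ m.+1 / m.+1%:R.
  have := @subX_le R m (ln T) (ln T'); rewrite l'0 LT => /(_ isT).
  have -> : ln T - ln T' = ln (1 + dl) by rewrite LE subKr.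
  move=> h; have h2 : m.+1%:R * ln T ^+ m * ln (1 + dl) <= m.+1%:R * ln T ^+ m * dl.
    by rewrite ler_wpM2l// mulr_ge0.
  rewrite lerBlDr -(@ler_pM2r _ m.+1%:R)// mulrDl !divfK ?pnatr_eq0//.
  rewrite -lerBlDl; apply: le_trans h _; apply: le_trans h2 _.
  by rewrite mulrC [in leRHS]mulrC mulrCA [dl * _]mulrC mulrCA.
have hA := hC T T1.
have T'lo : (1 - dl) * T <= T'.
  rewrite /T' ler_pdivlMr// mulrAC -[leRHS]mul1r ler_wpM2r ?(ltW T0)//; nra.
rewrite GE//; have FT := F_ge0 T.
set S := \sum_(1 <= j < _) _ in sumge *.
have main : (A - eps / 4) * T * (ln T ^+ m.+1 / m.+1%:R) - A * dl * T * ln T ^+ m - A * T <=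
    (A - e1) * T' * (ln T' ^+ m.+1 / m.+1%:R - 1).
  have q0 : 0 <= A - e1 by rewrite subr_ge0.
  have t1 : (A - e1) * T' <= A * T by apply: ler_pM => //; rewrite ?(ltW T'0)// gerBl ltW.
  have t0 : 0 <= (A - e1) * T' by rewrite mulr_ge0// ltW.
  have t2 : (A - eps / 4) * T <= (A - e1) * T'.
    have := ler_wpM2l q0 T'lo; apply: le_trans; rewrite mulrA ler_wpM2r ?(ltW T0)//.
    have : 0 <= e1 * dl by rewrite mulr_ge0// ltW.
    nra.
  have Y0 : 0 <= ln T ^+ m.+1 / m.+1%:R by rewrite mulr_ge0// ltW.
  move: (ln T ^+ m.+1 / m.+1%:R) (ln T' ^+ m.+1 / m.+1%:R) (ln T ^+ m) ((A - e1) * T') powge Lm0 Y0 t0 t1 t2.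
  move=> Y Y' X Z h X0 Y0 z0 z1 z2.
  have : Z * (Y - dl * X) <= Z * Y' by rewrite ler_wpM2l.
  have : (A - eps / 4) * T * Y <= Z * Y by rewrite ler_wpM2r.
  have : Z * (dl * X) <= A * T * (dl * X) by rewrite ler_wpM2r// mulr_ge0// ltW.
  nra.
move: hA; rewrite /K.
have Y0 : 0 <= ln T ^+ m.+1 / m.+1%:R by rewrite mulr_ge0// ltW.
have YY : eps * T * (ln T ^+ m.+1 / m.+1%:R) <= eps * T * ln T ^+ m.+1.
  by rewrite ler_wpM2l ?mulr_ge0 ?ler_piMr// ltW.
rewrite (_ : (2 * A / m.+1%:R - eps) * T * ln T ^+ m.+1 =
  2 * A * T * (ln T ^+ m.+1 / m.+1%:R) - eps * T * ln T ^+ m.+1); last by move: (m.+1%:R^-1) => v; ring.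
have P1 : 0 <= (A + C1) * (T * ln T ^+ m) by rewrite !mulr_ge0 ?addr_ge0// ltW.
have P2 : 0 <= (A * dl + J%:R * A) * T by rewrite mulr_ge0 ?addr_ge0// ltW.
move: main sumge YY FT C20 P1 P2; clear.
move: (ln T ^+ m.+1) (m.+1%:R^-1) (ln T ^+ m) ((A - e1) * T' * _) => Y1 v X Z.
lra.
Qed.

End Step.

End Counting.

(** * Lattice points in hyperbolic crosses *)

Section LatticePoints.
Context {R : realType}.
Variable p : nat -> R.
Hypothesis p0 : p 0%N = 1.
Hypothesis p_ge1 : forall j, 1 <= p j.
Hypothesis p_ge : forall j, j%:R <= p j.
Hypothesis p_asym : forall eps, 0 < eps -> exists J, forall j, (J <= j)%N -> p j <= (1 + eps) * j%:R.

Let p_gt0 j : 0 < p j. Proof. exact: lt_le_trans (p_ge1 j). Qed.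

Definition int_range (B : nat) : seq int := map Posz (iota 0 B.+1) ++ map Negz (iota 0 B).

Lemma mem_int_range B (k : int) : (k \in int_range B) = (`|k| <= B)%N.
Proof.
rewrite mem_cat; case: k => n.
  rewrite mem_map; last by move=> ? ? [].
  rewrite mem_iota/= ltnS orb_idr// => /mapP[j _]//.
rewrite orbC mem_map; last by move=> ? ? [].
by rewrite mem_iota /= orb_idr// => /mapP[j _].
Qed.

Lemma uniq_int_range B : uniq (int_range B).
Proof.
rewrite cat_uniq !map_inj_uniq ?iota_uniq/= ?andbT; try by move=> ? ? [].
by apply/hasPn => _ /mapP[j _ ->]; apply/negP => /mapP[].
Qed.

Definition mixed_prod d (k : d.-tuple int) : R := \prod_(i < d) p `|tnth k i|%N.

(** The hyperbolic cross, the set of the points with [mixed_prod k <= T]. As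
    [p j >= j], the first coordinate is at most [T] in absolute value. *)
Fixpoint cross d (T : R) : seq (d.-tuple int) :=
  match d with
  | 0 => if 1 <= T then [:: [tuple]] else [::]
  | d'.+1 => [seq cons_tuple k t | k <- int_range (Num.truncn T), t <- cross d' (T / p `|k|%N)]
  end.

Lemma crossS d T : cross d.+1 T =
  [seq cons_tuple k t | k <- int_range (Num.truncn T), t <- cross d (T / p `|k|%N)].
Proof. by []. Qed.

Lemma mixed_prod_ge1 d (k : d.-tuple int) : 1 <= mixed_prod k.
Proof.
rewrite /mixed_prod; elim/big_ind : _ => // x y x1 y1.
by rewrite -[leLHS]mulr1 ler_pM.
Qed.

Lemma mixed_prodS d (k : int) (t : d.-tuple int) :
  mixed_prod (cons_tuple k t) = p `|k|%N * mixed_prod t.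
Proof.
rewrite /mixed_prod big_ord_recl tnth0; congr (_ * _).
by apply: eq_bigr => i _; rewrite tnthS.
Qed.

Lemma mem_cross d (T : R) (t : d.-tuple int) : (t \in cross d T) = (mixed_prod t <= T).
Proof.
elim: d T t => [|d IH] T t.
  by rewrite (tuple0 t) /mixed_prod big_ord0 /=; case: ifP => _; rewrite ?mem_seq1 ?in_nil ?eqxx.
case/tupleP: t => k t; rewrite mixed_prodS.
apply/allpairsPdep/idP => [[k' [t' [_ ht /(congr1 val)/= [-> tt']]]]|h].
  by rewrite (val_inj tt') mulrC -ler_pdivlMr// -IH.
have ht : mixed_prod t <= T / p `|k|%N by rewrite ler_pdivlMr// mulrC.
exists k, t; split; rewrite ?IH//.
have kT : `|k|%N%:R <= T.
  apply: le_trans h; apply: le_trans (p_ge _) _.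
  by rewrite ler_peMr ?mixed_prod_ge1// ltW.
by rewrite mem_int_range truncn_ge_nat// (le_trans _ kT).
Qed.

Lemma uniq_cross d (T : R) : uniq (cross d T).
Proof.
elim: d T => [|d IH] T; first by rewrite /=; case: ifP.
rewrite crossS; apply: allpairs_uniq_dep => //; first exact: uniq_int_range.
by move=> [k t] [k' t'] _ _ /= /(congr1 val)/= [-> /val_inj ->].
Qed.

Definition cross_count d (T : R) : R := (size (cross d T))%:R.

Lemma cross_count_mono d a b : a <= b -> cross_count d a <= cross_count d b.
Proof.
move=> ab; rewrite ler_nat; apply: uniq_leq_size; first exact: uniq_cross.
by move=> t; rewrite !mem_cross => /le_trans; exact.
Qed.

Lemma cross_count_ge0 d T : 0 <= cross_count d T. Proof. exact: ler0n. Qed.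

Lemma cross_countS d T :
  cross_count d.+1 T = cross_count d T +
    2 * \sum_(1 <= j < (Num.truncn T).+1) cross_count d (T / p j).
Proof.
rewrite /cross_count crossS size_allpairs_dep sumnE big_map natr_sum /int_range big_cat !big_map /=.
rewrite big_cons /= p0 divr1 -addrA; congr (_ + _).
rewrite mulr_natl mulr2n; congr (_ + _).
  by rewrite /index_iota subn1.
rewrite /index_iota subn1 /= (iotaDl 1 0) big_map; apply: eq_bigr => j _.
by rewrite add1n.
Qed.

Lemma cross_count1_le : asym_le (cross_count 1) 2 0.
Proof.
move=> eps e0; exists 1 => // T T1; have T0 : 0 <= T := le_trans ler01 T1.
rewrite cross_countS expr0 mulr1.
have h a : cross_count 0 a <= 1 by rewrite /cross_count /=; case: ifP.
have S : \sum_(1 <= j < (Num.truncn T).+1) cross_count 0 (T / p j) <= T.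
  have /andP[nT _] := truncn_itv T0; apply: le_trans nT.
  apply: (@le_trans _ _ (\sum_(1 <= j < (Num.truncn T).+1) 1)); first by apply: ler_sum => j _; exact: h.
  by rewrite sumr_const_nat subn1 /=.
have := h T; have : 0 <= eps * T by rewrite mulr_ge0// ltW.
by rewrite mulrDl; lra.
Qed.

Lemma cross_count1_ge : asym_ge (cross_count 1) 2 0.
Proof.
move=> eps e0; have e20 : 0 < eps / 2 by rewrite divr_gt0.
have [J hJ] := p_asym e20.
exists (2 * (2 + J%:R)); first by rewrite mulr_ge0// addr_ge0.
move=> T T1; have T0 : 0 < T := lt_le_trans ltr01 T1.
rewrite cross_countS expr0 mulr1.
have d1 : 0 < 1 + eps / 2 by rewrite addr_gt0.
pose T' := T / (1 + eps / 2).
have T'0 : 0 < T' by rewrite divr_gt0.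
have T'T : T' <= T by rewrite ler_pdivrMr// ler_peMr ?(ltW T0)// lerDl ltW.
have S : T' - 2 - J%:R <= \sum_(1 <= j < (Num.truncn T).+1) cross_count 0 (T / p j).
  have tt : (Num.truncn T' <= Num.truncn T)%N by apply: truncn_mono; rewrite // ltW.
  have /andP[nT' T'n] := truncn_itv (ltW T'0).
  apply: (@le_trans _ _ (\sum_(1 <= j < (Num.truncn T').+1) (1 - (j < J)%:R))).
    rewrite big_split /= sumrN sumr_const_nat subn1 /=; apply: lerB; last exact: sum_lt_indicator.
    by move: T'n; rewrite -natr1; lra.
  rewrite [leRHS](big_cat_nat _ (n := (Num.truncn T').+1))//=.
  rewrite -[leLHS]addr0; apply: lerD; last by rewrite sumr_ge0.
  apply: ler_sum_nat => j /andP[j1 jT].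
  have [Jj|Jj] := leqP J j; last by rewrite subrr.
  rewrite subr0 /cross_count /= ifT// ler_pdivlMr// mul1r.
  apply: le_trans (hJ j Jj) _; rewrite mulrC -ler_pdivlMr//.
  by apply: le_trans nT'; rewrite ler_nat.
have T'lo : (1 - eps / 2) * T <= T'.
  rewrite /T' ler_pdivlMr// mulrAC -[leRHS]mul1r ler_wpM2r ?(ltW T0)//; nra.
have := cross_count_ge0 0 T; lra.
Qed.

(** Fixing the first coordinate to [j] or [- j] leaves a cross of parameter
    [T / p j] in one dimension less, so that each dimension multiplies the
    constant by [2] and divides it by the new exponent of the logarithm. *)
Lemma cross_count_asym m :
  asym_le (cross_count m.+1) (2 ^+ m.+1 / m`!%:R) m /\
  asym_ge (cross_count m.+1) (2 ^+ m.+1 / m`!%:R) m.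
Proof.
elim: m => [|m [IH1 IH2]].
  rewrite expr1 divr1; split; [exact: cross_count1_le|exact: cross_count1_ge].
have A0 : 0 < 2 ^+ m.+1 / m`!%:R :> R by rewrite divr_gt0// ?exprn_gt0// ltr0n fact_gt0.
have -> : 2 ^+ m.+2 / (m.+1)`!%:R = 2 * (2 ^+ m.+1 / m`!%:R) / m.+1%:R :> R.
  by rewrite factS natrM exprS -!mulrA; congr (_ * (_ * _)); rewrite invfM mulrC.
have mono : forall a b, a <= b -> cross_count m.+1 a <= cross_count m.+1 b.
  by move=> a b; exact: cross_count_mono.
have rec T : 1 <= T -> cross_count m.+2 T = cross_count m.+1 T +
    2 * \sum_(1 <= j < (Num.truncn T).+1) cross_count m.+1 (T / p j).
  by move=> _; exact: cross_countS.
split; first exact: (asym_step_le p_ge1 p_ge mono rec A0 IH1).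
exact: (asym_step_ge p_ge1 p_asym mono (@cross_count_ge0 _) rec A0 IH2).
Qed.

End LatticePoints.

(** * Enumeration by increasing weight *)

Section Enumeration.
Context {R : realType} (K : eqType) (w : K -> R) (lev : R -> seq K).
Hypothesis mem_lev : forall T k, (k \in lev T) = (w k <= T).
Hypothesis uniq_lev : forall T, uniq (lev T).
Hypothesis K_infinite : forall s : seq K, exists k, k \notin s.

Let next_ex (s : seq K) : exists k, k \notin s /\ forall l, l \notin s -> w k <= w l.
Proof.
have [k0 k0s] := K_infinite s.
pose r := [seq k <- lev (w k0) | k \notin s].
have k0r : k0 \in r by rewrite mem_filter k0s mem_lev lexx.
suff [k kr kmin] : exists2 k, k \in r & forall l, l \in r -> w k <= w l.
  move: kr; rewrite mem_filter mem_lev => /andP[ks kk0].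
  exists k; split=> // l ls; have [ll|] := leP (w l) (w k0).
    by apply: kmin; rewrite mem_filter ls mem_lev.
  by move=> /ltW; exact: le_trans.
elim: (r) (k0) k0r => // a t IH b _.
case: t IH => [|a' t] IH; first by exists a => [|l]; rewrite inE// => /eqP ->.
have [|k kt kmin] := IH a'; first by rewrite mem_head.
have [ka|/ltW ak] := leP (w k) (w a).
  exists k => [|l]; first by rewrite inE kt orbT.
  by rewrite inE => /predU1P[->//|]; exact: kmin.
exists a => [|l]; first by rewrite mem_head.
by rewrite inE => /predU1P[->//|/kmin]; exact: le_trans.
Qed.

Let next s := projT1 (cid (next_ex s)).
Let nextP s : next s \notin s /\ forall l, l \notin s -> w (next s) <= w l.
Proof. exact: (projT2 (cid (next_ex s))). Qed.

Fixpoint greedy n : seq K := if n is n'.+1 then rcons (greedy n') (next (greedy n')) else [::].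

(** Enumerate greedily: each step takes an element of least weight among the
    remaining ones, which exists since the levels [lev T] are finite. For the
    same reason every element is reached. *)
Lemma sorted_enumeration : exists kk : nat -> K,
  [/\ bijective kk, {homo (fun j => w (kk j)) : i j / (i <= j)%N >-> i <= j} &
      forall n T, (w (kk n) <= T) = (n < size (lev T))%N].
Proof.
pose kk n := next (greedy n).
have memg n k : (k \in greedy n) <-> exists2 j, (j < n)%N & k = kk j.
  elim: n => [|n IH] /=; first by split => // -[].
  rewrite mem_rcons inE; split.
    move=> /predU1P[->|/IH[j jn ->]]; first by exists n.
    by exists j => //; exact: ltnW.
  move=> [j]; rewrite ltnS leq_eqVlt => /predU1P[->->|jn kj]; first by rewrite eqxx.
  by apply/orP; right; apply/IH; exists j.
have notin i j : (i < j)%N -> kk i != kk j.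
  move=> ij; apply/eqP => E; have [/negP[]] := nextP (greedy j).
  by apply/memg; exists i.
have inj : injective kk.
  move=> i j E; apply/eqP; case: ltngtP => // ij.
    by have := notin _ _ ij; rewrite E eqxx.
  by have := notin _ _ ij; rewrite E eqxx.
have homo : {homo (fun j => w (kk j)) : i j / (i <= j)%N >-> i <= j}.
  move=> i j; rewrite leq_eqVlt => /predU1P[->//|ij].
  have [_] := nextP (greedy i); apply; apply/negP => /memg[l li E].
  by have := notin l j (ltn_trans li ij); rewrite -E eqxx.
have uniqk n : uniq [seq kk j | j <- iota 0 n] by rewrite map_inj_uniq ?iota_uniq.
have surj k : exists n, kk n = k.
  apply: contrapT => nk; have ne n : kk n != k by apply/eqP => E; apply: nk; exists n.
  have le n : w (kk n) <= w k.
    have [_] := nextP (greedy n); apply; apply/negP => /memg[j _ E].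
    by have := ne j; rewrite -E eqxx.
  pose N := size (lev (w k)).
  have : (size [seq kk j | j <- iota 0 N.+1] <= N)%N.
    by apply: uniq_leq_size => // _ /mapP[j _ ->]; rewrite mem_lev.
  by rewrite size_map size_iota ltnn.
pose h k := projT1 (cid (surj k)).
have hK k : kk (h k) = k by exact: (projT2 (cid (surj k))).
exists kk; split=> //.
  by exists h => // n; apply: inj; rewrite hK.
move=> n T; apply/idP/idP => [wT|].
  have : (size [seq kk j | j <- iota 0 n.+1] <= size (lev T))%N.
    apply: uniq_leq_size => // _ /mapP[j + ->]; rewrite mem_iota mem_lev ltnS => /andP[_ jn].
    by apply: le_trans wT; exact: homo.
  by rewrite size_map size_iota.
apply: contraTT; rewrite -ltNge -leqNgt => Tw.
have : (size (lev T) <= size [seq kk j | j <- iota 0 n])%N.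
  apply: uniq_leq_size => // k; rewrite mem_lev => kT; rewrite -(hK k) map_f// mem_iota/=.
  rewrite ltnNge; apply/negP => nh; have := homo _ _ nh; rewrite hK => /le_lt_trans.
  by move=> /(_ _ (le_lt_trans kT Tw)); rewrite ltxx.
by rewrite size_map size_iota.
Qed.

End Enumeration.

(** * Asymptotics of the sums of the squared weights *)

Section Limits.
Context {R : realType}.
Implicit Types (f g : nat -> R) (a b : R).

Lemma cvg_lnS f a : 0 < a -> f n @[n --> \oo] --> a -> ln (f n) @[n --> \oo] --> ln a.
Proof. by move=> a0 fa; apply: (cvg_comp _ _ fa); exact: continuous_ln. Qed.

Lemma cvg_expRS f a : f n @[n --> \oo] --> a -> expR (f n) @[n --> \oo] --> expR a.
Proof. by move=> fa; apply: (cvg_comp _ _ fa); exact: continuous_expR. Qed.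

Lemma cvg_invy f : f n @[n --> \oo] --> +oo -> (f n)^-1 @[n --> \oo] --> 0.
Proof.
move=> /cvgryPge fy; apply/cvgr0Pnorm_le => e e0.
apply: filterS (fy e^-1) => n fn.
have fn0 : 0 < f n by apply: lt_le_trans fn; rewrite invr_gt0.
by rewrite ger0_norm ?invr_ge0 ?(ltW fn0)// invf_ple ?posrE.
Qed.

Lemma cvg_lny f : f n @[n --> \oo] --> +oo -> ln (f n) @[n --> \oo] --> +oo.
Proof.
move=> /cvgryPge fy; apply/cvgryPge => M; apply: filterS (fy (expR M)) => n fn.
rewrite -[M]expRK ler_ln ?posrE ?expR_gt0//.
exact: lt_le_trans (expR_gt0 M) fn.
Qed.

Lemma cvg_naty : n%:R @[n --> \oo] --> (+oo : set_system R).
Proof.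
apply/cvgryPge => M; exists (Num.truncn `|M|).+1 => // n /= Mn.
have /andP[_ h] := truncn_itv (normr_ge0 M).
apply: le_trans (ler_norm M) _; apply: le_trans (ltW h) _.
by rewrite ler_nat.
Qed.

(** By [y ^+ 2 / 4 <= expR y] with [y = ln (f n)]. *)
Lemma cvg_lndiv f : f n @[n --> \oo] --> +oo -> ln (f n) / f n @[n --> \oo] --> 0.
Proof.
move=> fy; have ly := cvg_lny fy.
apply: (@squeeze_cvgr _ _ _ _ (fun=> 0) (fun n => 4 * (ln (f n))^-1)).
- move/cvgryPge : fy => /(_ 1) f1; move/cvgryPge : ly => /(_ 1) l1.
  move: f1; apply: filter_app; apply: filterS l1 => n l1 f1.
  have f0 := lt_le_trans ltr01 f1; have l0 := lt_le_trans ltr01 l1.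
  rewrite divr_ge0 ?(ltW f0) ?(ltW l0)//= ler_pdivrMr// mulrAC ler_pdivlMr//.
  rewrite -{3}[f n]lnK ?posrE// (_ : expR (ln (f n)) = expR (ln (f n) / 2) ^+ 2); last first.
    by rewrite -expRM_natl; congr expR; field.
  have := expR_ge1Dx (ln (f n) / 2).
  by move: (expR (ln (f n) / 2)) (ln (f n)) l0 => E y y0 h; nra.
- exact: cvg_cst.
- by rewrite -[X in _ --> X](mulr0 4); apply: cvgM; [exact: cvg_cst|exact: cvg_invy].
Qed.

(** The theorem of Stolz and Cesaro: telescoping the estimates for the
    increments from some [N] on leaves only constants. *)
Lemma stolz f g a :
    (\forall n \near \oo, g n < g n.+1) -> g n @[n --> \oo] --> +oo ->
    (f n.+1 - f n) / (g n.+1 - g n) @[n --> \oo] --> a ->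
  f n / g n @[n --> \oo] --> a.
Proof.
move=> ginc gy /cvgrPdist_le h; apply/cvgrPdist_le => e e0.
have e20 : 0 < e / 2 by rewrite divr_gt0.
have [N _ hN] : \forall n \near \oo, `|(f n.+1 - f n) - a * (g n.+1 - g n)| <= e / 2 * (g n.+1 - g n).
  move: ginc; apply: filter_app; apply: filterS (h _ e20) => n hn gn.
  have d0 : 0 < g n.+1 - g n by rewrite subr_gt0.
  rewrite -(@ler_pM2r _ (g n.+1 - g n)^-1) ?invr_gt0// mulfK ?gt_eqF//.
  rewrite -[X in _ * X]gtr0_norm ?invr_gt0// -normrM mulrBl mulfK ?gt_eqF// distrC.
  exact: hn.
have key n : (N <= n)%N -> `|(f n - f N) - a * (g n - g N)| <= e / 2 * (g n - g N).
  elim: n => [|n IH]; first by rewrite leqn0 => /eqP ->; rewrite !subrr mulr0 subr0 normr0 mulr0.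
  rewrite leq_eqVlt => /predU1P[<-|]; first by rewrite !subrr mulr0 subr0 normr0 mulr0.
  rewrite ltnS => Nn; have h1 := hN n Nn; have h2 := IH Nn.
  rewrite (_ : _ - _ = ((f n.+1 - f n) - a * (g n.+1 - g n)) + ((f n - f N) - a * (g n - g N))); last by ring.
  apply: le_trans (ler_normD _ _) _; apply: le_trans (lerD h1 h2) _.
  by rewrite -mulrDr subrKA.
pose c := `|f N - a * g N| + e / 2 * `|g N|.
have c0 : 0 <= c by rewrite addr_ge0// mulr_ge0// ltW.
have gbig : \forall n \near \oo, 1 + 2 * c / e <= g n by move/cvgryPge : gy; exact.
have NN : \forall n \near \oo, (N <= n)%N by exists N.
move: NN; apply: filter_app; apply: filterS gbig => n gn Nn.
have q0 : 0 <= 2 * c / e by rewrite divr_ge0 ?mulr_ge0// ltW.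
have g0 : 0 < g n by apply: lt_le_trans gn; rewrite ltr_pwDl.
rewrite -(@ler_pM2r _ (g n))// -[X in `|_| * X]gtr0_norm// -normrM mulrBl divfK ?gt_eqF//.
rewrite distrC; have -> : f n - a * g n = ((f n - f N) - a * (g n - g N)) + (f N - a * g N) by ring.
apply: le_trans (ler_normD _ _) _; apply: le_trans (lerD (key n Nn) (lexx _)) _.
have cg : c <= e / 2 * g n.
  have : 2 * c / e <= g n by apply: le_trans gn; rewrite lerDr.
  by rewrite ler_pdivrMr//; lra.
have := ler_norm (- g N); rewrite normrN => hg.
have : e / 2 * (- g N) <= e / 2 * `|g N| by rewrite ler_wpM2l// ltW.
move: cg; rewrite /c; lra.
Qed.

Lemma cvg_to f a b : f n @[n --> \oo] --> a -> a = b -> f n @[n --> \oo] --> b.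
Proof. by move=> fa <-. Qed.

Lemma cvg_mulc c f a : f n @[n --> \oo] --> a -> c * f n @[n --> \oo] --> c * a.
Proof. by move=> fa; apply: cvgM => //; exact: cvg_cst. Qed.

Lemma cvg_addc c f a : f n @[n --> \oo] --> a -> c + f n @[n --> \oo] --> c + a.
Proof. by move=> fa; apply: cvgD => //; exact: cvg_cst. Qed.

Lemma cvg_prod f g a b : f n @[n --> \oo] --> a -> g n @[n --> \oo] --> b ->
  f n * g n @[n --> \oo] --> a * b.
Proof. by move=> fa gb; exact: cvgM. Qed.

Lemma cvg_near f g a : (\forall n \near \oo, f n = g n) -> f n @[n --> \oo] --> a ->
  g n @[n --> \oo] --> a.
Proof. by move=> fg; apply: cvg_trans; exact: near_eq_cvg. Qed.

End Limits.
Arguments cvg_mulc {R} c {f a} _.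
Arguments cvg_addc {R} c {f a} _.

(** [n ^ (2 s + 1) / (ln n) ^ (2 s m)], as an exponential so that quotients of
    values become differences of exponents. *)
Definition growth {R : realType} (s : R) (m n : nat) : R :=
  expR ((2 * s + 1) * ln n%:R - 2 * s * m%:R * ln (ln n%:R)).

Section SortedWeights.
Context {R : realType}.
Variables (q : nat -> R) (cnt : R -> nat) (A : R) (m : nat) (s : R).
Hypothesis q_ge1 : forall n, 1 <= q n.
Hypothesis cntP : forall n T, (q n <= T) = (n < cnt T)%N.
Hypothesis A_gt0 : 0 < A.
Hypothesis s_gt0 : 0 < s.
Hypothesis cnt_le : asym_le (fun T => (cnt T)%:R) A m.
Hypothesis cnt_ge : asym_ge (fun T => (cnt T)%:R) A m.

Let q_gt0 n : 0 < q n. Proof. exact: lt_le_trans (q_ge1 n). Qed.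

Lemma sorted_unbounded : q n @[n --> \oo] --> +oo.
Proof.
apply/cvgryPge => M; exists (cnt M) => // n /= Mn.
by rewrite leNgt; apply/negP => /ltW; rewrite cntP ltnNge Mn.
Qed.

(** The counting function divided by its expected growth. *)
Let rho T := (cnt T)%:R / (T * ln T ^+ m).

Let cvg_rho (f : nat -> R) : f n @[n --> \oo] --> +oo -> rho (f n) @[n --> \oo] --> A.
Proof.
move=> fy; apply/cvgrPdist_le => e e0; have e20 : 0 < e / 2 by rewrite divr_gt0.
have [C1 C10 h1] := cnt_le e20; have [C2 C20 h2] := cnt_ge e20.
have big1 : \forall n \near \oo, expR 1 <= f n by move/cvgryPge : fy; exact.
have big2 : \forall n \near \oo, 2 * (C1 + C2) / e <= f n by move/cvgryPge : fy; exact.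
move: big1; apply: filter_app; apply: filterS big2 => n b2 b1.
have f0 : 0 < f n := lt_le_trans (expR_gt0 1) b1.
have f1 : 1 <= f n by apply: le_trans b1; apply: le_trans (expR_ge1Dx 1); rewrite lerDl.
have l1 : 1 <= ln (f n) by rewrite -[1]expRK ler_ln ?posrE ?expR_gt0.
have X1 : 1 <= ln (f n) ^+ m by exact: exprn_ege1.
have D0 : 0 < f n * ln (f n) ^+ m by rewrite mulr_gt0// (lt_le_trans ltr01).
have Df : f n <= f n * ln (f n) ^+ m by rewrite ler_peMr// ltW.
have Ce : C1 + C2 <= e / 2 * (f n * ln (f n) ^+ m).
  have : C1 + C2 <= e / 2 * f n by move: b2; rewrite ler_pdivrMr//; lra.
  by move=> h; apply: le_trans h _; rewrite ler_wpM2l// ltW.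
have := h1 _ f1; have := h2 _ f1.
rewrite /rho; move: Ce D0; rewrite -!mulrA; move: (f n * _) ((cnt (f n))%:R) => D c Ce D0 k2 k1.
have [x [-> cE]] : exists x, c / D = x /\ c = x * D.
  by exists (c / D); rewrite divfK ?gt_eqF.
rewrite cE in k1 k2.
have h3 : x * D <= (A + e) * D by lra.
have h4 : (A - e) * D <= x * D by lra.
by move: h3 h4; rewrite !ler_pM2r// ler_norml => *; apply/andP; split; lra.
Qed.

Let lq n := ln (q n).
Let Ln n : R := ln n%:R.
Let LL n : R := ln (ln n%:R).

Let lq_y : lq n @[n --> \oo] --> +oo. Proof. exact: cvg_lny sorted_unbounded. Qed.
Let Ln_y : Ln n @[n --> \oo] --> +oo. Proof. exact: cvg_lny cvg_naty. Qed.

Let near_ge (f : nat -> R) M : f n @[n --> \oo] --> +oo -> \forall n \near \oo, M <= f n.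
Proof. by move=> /cvgryPge. Qed.

Let r n := n%:R / (q n * lq n ^+ m).

(** The defining property of [cnt] says [cnt (q n - 1) <= n < cnt (q n)], for the
    bound [q n - 1] is below [q n]; both ends have the same asymptotics. *)
Let cvg_r : r n @[n --> \oo] --> A.
Proof.
have qy := sorted_unbounded.
have qy1 : q n - 1 @[n --> \oo] --> +oo.
  apply/cvgryPge => M; apply: filterS (near_ge (M + 1) qy) => n; lra.
have c1 : (q n - 1) / q n @[n --> \oo] --> (1 : R).
  apply: (@cvg_near _ (fun n => 1 - (q n)^-1)).
    by apply: nearW => n; rewrite mulrBl divff ?mul1r// gt_eqF.
  by rewrite -[X in _ --> X]subr0; apply: cvgB; [exact: cvg_cst|exact: cvg_invy].
have c2 : ln (q n - 1) / lq n @[n --> \oo] --> (1 : R).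
  apply: (@cvg_near _ (fun n => 1 + ln ((q n - 1) / q n) * (lq n)^-1)).
    apply: filterS (near_ge 3 qy) => n q3.
    have l0 : 0 < lq n by apply: ln_gt0; lra.
    have q1 : 0 < q n - 1 by lra.
    by rewrite ln_div ?posrE// mulrBl divff ?gt_eqF// addrC subrK.
  rewrite -[X in _ --> X]addr0 -[X in 1 + X](mulr0 (ln (1 : R))).
  apply: cvgD; first exact: cvg_cst.
  by apply: cvgM; [exact: cvg_lnS|exact: cvg_invy].
apply: (@squeeze_cvgr _ _ _ _ (fun n => rho (q n - 1) * ((q n - 1) / q n) * (ln (q n - 1) / lq n) ^+ m)
  (fun n => rho (q n))).
- apply: filterS (near_ge 3 qy) => n q3.
  have l0 : 0 < lq n by apply: ln_gt0; lra.
  have q1 : 0 < q n - 1 by lra.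
  have l1 : 0 < ln (q n - 1) by apply: ln_gt0; lra.
  have D0 : 0 < q n * lq n ^+ m by rewrite mulr_gt0// exprn_gt0.
  have D1 : 0 < (q n - 1) * ln (q n - 1) ^+ m by rewrite mulr_gt0// exprn_gt0.
  have -> : rho (q n - 1) * ((q n - 1) / q n) * (ln (q n - 1) / lq n) ^+ m =
      (cnt (q n - 1))%:R / (q n * lq n ^+ m).
    rewrite /rho expr_div_n; field.
    by rewrite !expf_neq0 ?gt_eqF//.
  rewrite /rho /r -/(lq n) !ler_pM2r ?invr_gt0// !ler_nat; apply/andP; split.
    by rewrite leqNgt -cntP -ltNge; lra.
  by apply: ltnW; rewrite -cntP.
- have c3 : (ln (q n - 1) / lq n) ^+ m @[n --> \oo] --> (1 ^+ m : R).
    by apply: (cvg_comp _ (fun x : R => x ^+ m) c2); exact: exprn_continuous.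
  apply: cvg_to (cvg_prod (cvg_prod (cvg_rho qy1) c1) c3) _.
  by rewrite expr1n !mulr1.
- exact: cvg_rho.
Qed.

Let ln_r : \forall n \near \oo, ln (r n) = Ln n - lq n - m%:R * ln (lq n).
Proof.
apply: filterS2 (near_ge 3 sorted_unbounded) (near_ge 1 cvg_naty) => n q3 n1.
have l0 : 0 < lq n by apply: ln_gt0; lra.
have X0 : 0 < lq n ^+ m by rewrite exprn_gt0.
have n0 : 0 < n%:R :> R := lt_le_trans ltr01 n1.
rewrite /r ln_div ?posrE ?mulr_gt0// lnM ?posrE// lnXn// -[ln (lq n) *+ m]mulr_natl.
by rewrite /Ln /lq; ring.
Qed.

Let cvg_ln_ratio : Ln n / lq n @[n --> \oo] --> (1 : R).
Proof.
apply: (@cvg_near _ (fun n => 1 + m%:R * (ln (lq n) / lq n) + ln (r n) * (lq n)^-1)).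
  apply: filterS2 ln_r (near_ge 1 lq_y) => n -> l1.
  by field; rewrite gt_eqF// (lt_le_trans _ l1).
have c1 := cvg_addc 1 (cvg_mulc m%:R (cvg_lndiv lq_y)).
have c2 := cvg_prod (cvg_lnS A_gt0 cvg_r) (cvg_invy lq_y).
by apply: cvg_to (cvgD c1 c2) _; rewrite !mulr0 !addr0.
Qed.

(** The logarithm of [n / (q n * ln n ^+ m)]: inverting the counting function
    replaces [ln (q n)] by [ln n], which it is equivalent to. *)
Let cvg_log_quotient : Ln n - lq n - m%:R * LL n @[n --> \oo] --> ln A.
Proof.
apply: (@cvg_near _ (fun n => ln (r n) - m%:R * ln (Ln n / lq n))).
  apply: filterS2 (filterI ln_r (near_ge 1 lq_y)) (near_ge 1 Ln_y) => n [-> l1] L1.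
  have l0 := lt_le_trans ltr01 l1; have L0 := lt_le_trans ltr01 L1.
  by rewrite ln_div ?posrE// /LL -/(Ln n); ring.
have c2 := cvg_mulc m%:R (cvg_lnS ltr01 cvg_ln_ratio).
by apply: cvg_to (cvgB (cvg_lnS A_gt0 cvg_r) c2) _; rewrite ln1 mulr0 subr0.
Qed.

Let w n := q n `^ s.
Let b n := expR (2 * s * Ln n - 2 * s * m%:R * LL n).
Let H := growth s m.
Let a := expR (- (2 * s) * ln A).

Let cvg_w2 : w n ^+ 2 / b n @[n --> \oo] --> a.
Proof.
apply: (@cvg_near _ (fun n => expR (- (2 * s) * (Ln n - lq n - m%:R * LL n)))).
  apply: nearW => n; rewrite /b -expRN /w /powR gt_eqF// -expRM_natl -expRD.
  by congr expR; rewrite -/(lq n); ring.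
by apply: cvg_expRS; apply: cvgM; [exact: cvg_cst|exact: cvg_log_quotient].
Qed.

Let x n : R := (2 * s + 1) * (Ln n.+1 - Ln n) - 2 * s * m%:R * (LL n.+1 - LL n).

Let H_succ n : H n.+1 = H n * expR (x n).
Proof. by rewrite /H /growth -expRD; congr expR; rewrite /x /Ln /LL; ring. Qed.

Let HE n : (0 < n)%N -> H n = n%:R * b n.
Proof.
move=> n0; rewrite /H /growth /b -[n%:R in RHS]lnK ?posrE ?ltr0n// -expRD; congr expR.
by rewrite /Ln /LL; ring.
Qed.

Let Ln_diff n : (0 < n)%N -> n.+1%:R^-1 <= Ln n.+1 - Ln n <= n%:R^-1.
Proof.
case: n => // n _; rewrite /Ln -ln_div ?posrE//.
by rewrite ln_succ_ge ln_succ_le.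
Qed.

Let cvg_invn : (n%:R : R)^-1 @[n --> \oo] --> (0 : R).
Proof. exact: cvg_invy cvg_naty. Qed.

Let cvg_nLn : n%:R * (Ln n.+1 - Ln n) @[n --> \oo] --> (1 : R).
Proof.
apply: (@squeeze_cvgr _ _ _ _ (fun n => 1 - n.+1%:R^-1) (fun=> 1)).
- exists 1%N => // n /= n0; have /andP[h1 h2] := Ln_diff n0.
  have p0 : 0 < n%:R :> R by rewrite ltr0n.
  rewrite -[X in X - _](@divff _ n.+1%:R) ?pnatr_eq0// -[X in _ - X]mul1r -mulrBl.
  rewrite -natr1 addrK natr1 ler_pM2l// h1/=.
  by rewrite -(@ler_pM2l _ n%:R^-1) ?invr_gt0// mulKf ?gt_eqF// mulr1.
- rewrite -[X in _ --> X]subr0; apply: cvgB; first exact: cvg_cst.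
  by rewrite (cvg_shiftS (fun n => n%:R^-1 : R)).
- exact: cvg_cst.
Qed.

Let cvg_nLL : n%:R * (LL n.+1 - LL n) @[n --> \oo] --> (0 : R).
Proof.
apply: (@squeeze_cvgr _ _ _ _ (fun=> 0) (fun n => (Ln n)^-1)); last 2 first.
- exact: cvg_cst.
- exact: cvg_invy.
apply: filterS2 (near_ge 1 Ln_y) (near_ge 1 cvg_naty) => n L1 n1.
have L0 := lt_le_trans ltr01 L1; have n0 := lt_le_trans ltr01 n1.
have n0' : (0 < n)%N by rewrite -(ltr0n R).
have /andP[h1 h2] := Ln_diff n0'.
have Lm : Ln n <= Ln n.+1 by rewrite -subr_ge0; apply: le_trans h1; rewrite invr_ge0.
have L0' : 0 < Ln n.+1 by exact: lt_le_trans Lm.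
rewrite /LL -/(Ln _) -/(Ln n) mulr_ge0 ?(ltW n0) ?subr_ge0 ?ler_ln ?posrE//=.
rewrite -ln_div ?posrE// (_ : Ln n.+1 / Ln n = 1 + (Ln n.+1 - Ln n) / Ln n); last first.
  by rewrite mulrBl divff ?gt_eqF// addrC subrK.
have d0 : 0 <= (Ln n.+1 - Ln n) / Ln n by rewrite divr_ge0 ?(ltW L0)// subr_ge0.
apply: (@le_trans _ _ (n%:R * ((Ln n.+1 - Ln n) / Ln n))).
  by rewrite ler_wpM2l ?(ltW n0)//; apply: le_ln1Dx; lra.
rewrite mulrA ler_pdivrMr// mulVf ?gt_eqF//.
rewrite -[leRHS](@mulfV _ n%:R) ?gt_eqF// ler_pM2l//.
by rewrite ler_nat.
Qed.

Let cvg_nx : n%:R * x n @[n --> \oo] --> 2 * s + 1.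
Proof.
rewrite (_ : (fun n => _) = fun n => (2 * s + 1) * (n%:R * (Ln n.+1 - Ln n)) -
    2 * s * m%:R * (n%:R * (LL n.+1 - LL n))); last by apply/funext => n; rewrite /x; ring.
apply: cvg_to (cvgB (cvg_mulc (2 * s + 1) cvg_nLn) (cvg_mulc (2 * s * m%:R) cvg_nLL)) _.
by rewrite mulr1 mulr0 subr0.
Qed.

Let cvg_x : x n @[n --> \oo] --> (0 : R).
Proof.
apply: (@cvg_near _ (fun n => n%:R^-1 * (n%:R * x n))).
  by exists 1%N => // n /= n0; rewrite mulKf// pnatr_eq0 -lt0n.
by apply: cvg_to (cvg_prod cvg_invn cvg_nx) _; rewrite mul0r.
Qed.

Let cvg_dH : (H n.+1 - H n) / b n @[n --> \oo] --> 2 * s + 1.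
Proof.
apply: (@cvg_near _ (fun n => n%:R * (expR (x n) - 1))).
  exists 1%N => // n /= n0; rewrite H_succ (HE n0); field.
  by rewrite gt_eqF// expR_gt0.
apply: (@squeeze_cvgr _ _ _ _ (fun n => n%:R * x n) (fun n => n%:R * x n * expR (x n))) => //.
  apply: nearW => n; rewrite ler_wpM2l//=; last by have := expR_ge1Dx (x n); lra.
  rewrite -mulrA ler_wpM2l//.
  have := ler_wpM2r (expR_ge0 (x n)) (expR_ge1Dx (- x n)).
  by rewrite -expRD addNr expR0 mulrDl mul1r mulNr; lra.
by apply: cvg_to (cvg_prod cvg_nx (cvg_expRS cvg_x)) _; rewrite expR0 mulr1.
Qed.

Let H_y : H n @[n --> \oo] --> +oo.
Proof.
have c : (2 * s + 1) - 2 * s * m%:R * (LL n / Ln n) @[n --> \oo] --> (2 * s + 1 : R).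
  rewrite -[X in _ --> X]subr0 -[X in _ --> _ - X](mulr0 (2 * s * m%:R)).
  by apply: cvgB; [|apply: cvgM; [|exact: cvg_lndiv]]; exact: cvg_cst.
have g1 : \forall n \near \oo, 1 < (2 * s + 1) - 2 * s * m%:R * (LL n / Ln n).
  by apply: (cvgr_gt _ c); rewrite ltrDr mulr_gt0.
apply/cvgryPge => M; have big := near_ge `|M| Ln_y; have big1 := near_ge 1 Ln_y.
apply: filterS2 (filterI g1 big) big1 => n [g bn] L1.
apply: le_trans (ler_norm M) _; apply: le_trans bn _.
rewrite /H /growth; apply: le_trans (expR_ge1Dx _); rewrite -/(Ln n) -/(LL n).
have L0 := lt_le_trans ltr01 L1.
rewrite (_ : _ - _ = Ln n * ((2 * s + 1) - 2 * s * m%:R * (LL n / Ln n))); last first.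
  by field; rewrite gt_eqF.
have : Ln n * 1 <= Ln n * ((2 * s + 1) - 2 * s * m%:R * (LL n / Ln n)).
  by rewrite ler_wpM2l ?(ltW L0)// ltW.
lra.
Qed.

Let s21 : 0 < 2 * s + 1. Proof. by rewrite addr_gt0// mulr_gt0. Qed.

Let H_inc : \forall n \near \oo, H n < H n.+1.
Proof.
have g : \forall n \near \oo, 0 < n%:R * x n by exact: (cvgr_gt _ cvg_nx).
apply: filterS g => n h.
have x0 : 0 < x n by rewrite ltNge; apply/negP => x0; move: h; rewrite ltNge mulr_ge0_le0.
by rewrite H_succ ltr_pMr ?expR_gt0// expR_gt1.
Qed.

(** The theorem of Stolz and Cesaro for [wsum] and [growth]: the increments of
    the former are [w n ^+ 2], equivalent to [A ^ (- 2 s) * b n], and those of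
    the latter are equivalent to [(2 s + 1) * b n]. *)
Lemma cvg_wsum : wsum (fun n => q n `^ s) n / growth s m n @[n --> \oo] -->
  expR (- (2 * s) * ln A) / (2 * s + 1).
Proof.
apply: stolz => //.
apply: (@cvg_near _ (fun n => (w n ^+ 2 / b n) * ((H n.+1 - H n) / b n)^-1)).
  apply: filterS H_inc => n Hn.
  have b0 : b n != 0 by rewrite gt_eqF// expR_gt0.
  have d0 : H n.+1 - H n != 0 by rewrite gt_eqF// subr_gt0.
  rewrite /wsum big_ord_recr /= [X in _ = (X - _) / _]addrC addrK -/(w n) -/(H n.+1) -/(H n); field.
  by rewrite b0 d0.
by apply: cvg_prod => //; apply: cvgV => //; rewrite gt_eqF.
Qed.

End SortedWeights.

(** * Asymptotics of the optimal tail ratio *)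

Section TailAsymptotics.
Context {R : realType}.
Variables (W : nat -> R) (A s : R) (m : nat).
Hypothesis A_gt0 : 0 < A.
Hypothesis s_gt0 : 0 < s.
Hypothesis W_gt0 : forall n, (0 < n)%N -> 0 < W n.

Let Ln n : R := ln n%:R.
Let LL n : R := ln (ln n%:R).
Let b n := expR (2 * s * Ln n - 2 * s * m%:R * LL n).
Let H n : R := growth s m n.
Let kappa := expR (- (2 * s) * ln A) / (2 * s + 1).
Hypothesis cvg_W : W n / H n @[n --> \oo] --> kappa.

Let Ln_y : Ln n @[n --> \oo] --> +oo. Proof. exact: cvg_lny cvg_naty. Qed.

Let near_ge (f : nat -> R) M : f n @[n --> \oo] --> +oo -> \forall n \near \oo, M <= f n.
Proof. by move=> /cvgryPge. Qed.

Let cvg_invn : (n%:R : R)^-1 @[n --> \oo] --> (0 : R).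
Proof. exact: cvg_invy cvg_naty. Qed.

Let HE n : (0 < n)%N -> H n = n%:R * b n.
Proof.
move=> n0; rewrite /H /growth /b -[n%:R in RHS]lnK ?posrE ?ltr0n// -expRD; congr expR.
by rewrite /Ln /LL; ring.
Qed.

Let s21 : 0 < 2 * s + 1. Proof. by rewrite addr_gt0// mulr_gt0. Qed.
Let kappa_gt0 : 0 < kappa. Proof. by rewrite divr_gt0// expR_gt0. Qed.

Let near3 : \forall n \near \oo, 1 <= Ln n /\ 2 <= n%:R :> R.
Proof. exact: filterI (near_ge 1 Ln_y) (near_ge 2 cvg_naty). Qed.

Let sqrt_expR (y : R) : Num.sqrt (expR y) = expR (y / 2).
Proof. by rewrite [y in LHS](splitr y) expRD -expr2 sqrtr_sqr ger0_norm ?expR_ge0. Qed.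

Let powRE (y p : R) : 0 < y -> y `^ p = expR (p * ln y).
Proof. by move=> y0; rewrite /powR gt_eqF. Qed.

Lemma cvg_inv_sqrt_wsum :
  (Num.sqrt (W n))^-1 / (n%:R `^ (- s - 2^-1) * ln n%:R `^ (s * m%:R)) @[n --> \oo] -->
  Num.sqrt (2 * s + 1) * A `^ s.
Proof.
have sk0 : 0 < Num.sqrt kappa by rewrite sqrtr_gt0.
have c : (Num.sqrt (W n / H n))^-1 @[n --> \oo] --> (Num.sqrt kappa)^-1.
  apply: cvgV; first by rewrite gt_eqF.
  by apply: (cvg_comp _ _ cvg_W); exact: sqrt_continuous.
have -> : Num.sqrt (2 * s + 1) * A `^ s = (Num.sqrt kappa)^-1.
  rewrite powRE// /kappa sqrtrM ?expR_ge0// sqrtrV ?(ltW s21)// sqrt_expR invfM invrK mulrC -expRN.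
  by congr (expR _ * _); field.
apply: cvg_near c; apply: filterS near3 => n [L1 n2].
have L0 := lt_le_trans ltr01 L1; have n0 : 0 < n%:R :> R by lra.
have W0 : 0 <= W n by rewrite ltW// W_gt0// -(ltr0n R).
rewrite sqrtrM// sqrtrV ?expR_ge0// /H /growth sqrt_expR invfM invrK; congr (_ * _).
rewrite !powRE// -expRD -expRN; congr expR.
by rewrite /Ln /LL; field.
Qed.

Let scale n := n%:R `^ (- s) * ln n%:R `^ (s * m%:R) : R.
Let tail0 := 2 * s / (2 * s + 1).
Let limit := tail0 `^ s * A `^ s.

Let tail0_gt0 : 0 < tail0. Proof. by rewrite divr_gt0// mulr_gt0. Qed.

Let scaled_tail n M := ((M.+1 - n)%:R / W M) * b n.

Let near_scaled (M : nat -> nat) : (forall n, (n <= M n)%N) -> \forall n \near \oo,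
  Num.sqrt (scaled_tail n (M n)) = Num.sqrt ((((M n).+1 - n)%:R / W (M n))) / scale n.
Proof.
move=> nM; apply: filterS near3 => n [L1 n2].
have L0 := lt_le_trans ltr01 L1; have n0 : 0 < n%:R :> R by lra.
have M0 : (0 < M n)%N by rewrite (leq_trans _ (nM n))// -(ltr0n R).
rewrite /scaled_tail sqrtrM ?divr_ge0 ?(ltW (W_gt0 M0))//; congr (_ * _).
rewrite /b sqrt_expR /scale !powRE// -expRD -expRN; congr expR.
by rewrite /Ln /LL; field.
Qed.

(** The maximum of [(1 - t) * t ^ c] over [0 < t < 1], attained at
    [t = c / (c + 1)]. *)
Let phi (c : R) := expR (c * ln (c / (c + 1))) / (c + 1).

(** Bound the logarithms of [(1 - t) * (c + 1)] and [t * (c + 1) / c] by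
    [ln y <= y - 1]. *)
Let phi_max c t : 0 < c -> 0 < t < 1 -> (1 - t) * expR (c * ln t) <= phi c.
Proof.
move=> c0 /andP[t0 t1]; have c1 : 0 < c + 1 by rewrite addr_gt0.
rewrite /phi ler_pdivlMr// -[X in X * _ * _]lnK ?posrE ?subr_gt0//.
rewrite -[X in _ * X <= _]lnK ?posrE// -!expRD ler_expR.
have e1 : 0 < (1 - t) * (c + 1) by rewrite mulr_gt0 ?subr_gt0.
have e2 : 0 < t / (c / (c + 1)) by rewrite !divr_gt0.
have ln_le (y : R) : 0 < y -> ln y <= y - 1.
  by move=> y0; rewrite -[y in ln y](subrKC 1); apply: le_ln1Dx; lra.
have h1 := ln_le _ e1; have h2 := ln_le _ e2.
rewrite lnM ?posrE ?subr_gt0// in h1.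
rewrite ln_div ?posrE ?divr_gt0// in h2.
have h3 := ler_wpM2l (ltW c0) h2.
have h4 : c * (t / (c / (c + 1)) - 1) = t * (c + 1) - c by field; rewrite !gt_eqF.
rewrite h4 in h3; lra.
Qed.

Let limitE : Num.sqrt (phi (2 * s) * kappa^-1) = limit.
Proof.
rewrite (_ : _ * _ = expR (2 * s * ln tail0 + 2 * s * ln A)).
  by rewrite sqrt_expR /limit !powRE// -expRD; congr expR; field.
rewrite expRD /phi /kappa invf_div -/tail0 (_ : expR (2 * s * ln A) = (expR (- (2 * s) * ln A))^-1).
  by field; rewrite !gt_eqF ?expR_gt0.
by rewrite -expRN; congr expR; ring.
Qed.

Let natM_y (M : nat -> nat) : (forall n, (n <= M n)%N) -> M n @[n --> \oo] --> \oo.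
Proof. by move=> nM P [N _ hN]; exists N => // n /= Nn; apply: hN; exact: leq_trans (nM n). Qed.

Let cvg_kappa (M : nat -> nat) : (forall n, (n <= M n)%N) ->
  W (M n) / H (M n) @[n --> \oo] --> kappa.
Proof. by move=> nM; exact: (cvg_comp _ _ (natM_y nM) cvg_W). Qed.

Let scaled_tailE n M : 1 <= Ln n -> (2 <= n%:R :> R) -> (n <= M)%N ->
  scaled_tail n M = ((M.+1 - n)%:R / M%:R) *
    expR (- (2 * s) * (Ln M - Ln n) + 2 * s * m%:R * ln (Ln M / Ln n)) * (W M / H M)^-1.
Proof.
move=> L1 n2 nM; have L0 := lt_le_trans ltr01 L1; have n0 : 0 < n%:R :> R by lra.
have nM' : n%:R <= M%:R :> R by rewrite ler_nat.
have M0 : 0 < M%:R :> R := lt_le_trans n0 nM'.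
have LM : Ln n <= Ln M by rewrite ler_ln ?posrE.
have LM0 : 0 < Ln M := lt_le_trans L0 LM.
have M0n : (0 < M)%N by rewrite -(ltr0n R).
rewrite ln_div ?posrE// /scaled_tail HE//.
have -> : expR (- (2 * s) * (Ln M - Ln n) + 2 * s * m%:R * (ln (Ln M) - ln (Ln n))) = b n / b M.
  by rewrite /b -expRN -expRD; congr expR; rewrite /Ln /LL; ring.
have W0 : W M != 0 by rewrite gt_eqF// W_gt0.
by field; rewrite W0 !gt_eqF// ?expR_gt0.
Qed.

(** For [M] of order [lam * n] the scaled tail ratio tends to
    [(1 - lam^-1) * lam ^ (- 2 s) / kappa]; the choice of [lam] maximises it. *)
Lemma tail_ratio_lower : exists2 M : nat -> nat, (forall n, (n <= M n)%N) &
  Num.sqrt ((((M n).+1 - n)%:R / W (M n))) / scale n @[n --> \oo] --> limit.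
Proof.
pose lam := (2 * s + 1) / (2 * s).
have s20 : 0 < 2 * s by rewrite mulr_gt0.
have lam1 : 1 < lam by rewrite ltr_pdivlMr// mul1r ltrDl.
have lam0 : 0 < lam by lra.
pose M n := (Num.truncn (lam * n%:R)).+1.
have bnd n : lam * n%:R < (M n)%:R <= lam * n%:R + 1.
  have l0 : 0 <= lam * n%:R by rewrite mulr_ge0// ltW.
  have /andP[h1 h2] := truncn_itv l0.
  by rewrite h2/= /M -natr1 lerD2r.
have nM n : (n <= M n)%N.
  rewrite -(ler_nat R); have /andP[h1 _] := bnd n; apply: le_trans (ltW h1).
  by rewrite ler_peMl// ltW.
exists M => //; apply: cvg_near (near_scaled nM) _; rewrite -limitE.
apply: (cvg_comp _ (@Num.sqrt R)); last exact: sqrt_continuous.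
have cx : (M n)%:R / n%:R @[n --> \oo] --> lam.
  apply: (@squeeze_cvgr _ _ _ _ (fun=> lam) (fun n => lam + n%:R^-1)).
  - apply: filterS near3 => n [_ n2]; have n0 : 0 < n%:R :> R by lra.
    have /andP[h1 h2] := bnd n; rewrite ler_pdivlMr// ler_pdivrMr// ltW//=.
    by rewrite mulrDl mulVf ?gt_eqF.
  - exact: cvg_cst.
  - by apply: cvg_to (cvg_addc lam cvg_invn) _; rewrite addr0.
have cl := cvg_lnS lam0 cx.
have cr : ln (M n)%:R / Ln n @[n --> \oo] --> (1 : R).
  apply: (@cvg_near _ (fun n => 1 + ln ((M n)%:R / n%:R) * (Ln n)^-1)).
    apply: filterS near3 => n [L1 n2].
    have L0 := lt_le_trans ltr01 L1; have n0 : 0 < n%:R :> R by lra.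
    have M0 : 0 < (M n)%:R :> R by rewrite (lt_le_trans n0)// ler_nat.
    by rewrite ln_div ?posrE// -/(Ln n); field; rewrite gt_eqF.
  by apply: cvg_to (cvg_addc 1 (cvg_prod cl (cvg_invy Ln_y))) _; rewrite mulr0 addr0.
apply: (@cvg_near _ (fun n => (1 + (M n)%:R^-1 - ((M n)%:R / n%:R)^-1) *
   expR (- (2 * s) * ln ((M n)%:R / n%:R) + 2 * s * m%:R * ln (ln (M n)%:R / Ln n)) *
   (W (M n) / H (M n))^-1)).
  apply: filterS near3 => n [L1 n2]; have n0 : 0 < n%:R :> R by lra.
  have M0 : 0 < (M n)%:R :> R by [].
  rewrite scaled_tailE// [ln ((M n)%:R / n%:R)]ln_div ?posrE//; congr (_ * _ * _).
  have natE k : (n <= k)%N -> (k.+1 - n)%:R = k%:R + 1 - n%:R :> R.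
    by move=> nk; rewrite natrB ?leqW// -natr1.
  by rewrite natE//; field; rewrite !gt_eqF.
have cM : (M n)%:R^-1 @[n --> \oo] --> (0 : R).
  exact: (cvg_comp _ _ (natM_y nM) cvg_invn).
have c1 : 1 + (M n)%:R^-1 - ((M n)%:R / n%:R)^-1 @[n --> \oo] --> 1 + 0 - lam^-1.
  by apply: cvgB; [exact: cvg_addc|apply: cvgV => //; rewrite gt_eqF].
have c2 : expR (- (2 * s) * ln ((M n)%:R / n%:R) + 2 * s * m%:R * ln (ln (M n)%:R / Ln n)) @[n --> \oo] -->
    expR (- (2 * s) * ln lam + 2 * s * m%:R * ln 1).
  by apply: cvg_expRS; apply: cvgD; apply: cvg_mulc => //; exact: cvg_lnS.
have c3 : (W (M n) / H (M n))^-1 @[n --> \oo] --> kappa^-1.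
  by apply: cvgV; [rewrite gt_eqF|exact: cvg_kappa].
apply: cvg_to (cvg_prod (cvg_prod c1 c2) c3) _; congr (_ * _).
rewrite ln1 mulr0 !addr0 /phi mulrC /lam invf_div; congr (_ * _).
  by rewrite mulNr -mulrN -lnV ?posrE// invf_div.
by field; rewrite gt_eqF.
Qed.

(** Uniformly in [M >= n]: put [t = (n - 1) / M], for which
    [(M + 1 - n) / M = 1 - t]. The quotient of the logarithms is absorbed by a
    small change of the exponent, for
    [ln (ln M / ln n) <= (ln M - ln n) / ln n]; so the scaled tail ratio is at
    most about [(1 - t) * t ^ c / kappa] with an exponent [c] that tends to
    [2 s], and [phi_max] applies. *)
Lemma tail_ratio_upper (M : nat -> nat) : (forall n, (n <= M n)%N) ->
  exists2 h : nat -> R,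
    \forall n \near \oo, Num.sqrt ((((M n).+1 - n)%:R / W (M n))) / scale n <= h n &
    h n @[n --> \oo] --> limit.
Proof.
move=> nM; pose c n := 2 * s - 2 * s * m%:R * (Ln n)^-1.
have cc : c n @[n --> \oo] --> 2 * s.
  apply: cvg_to (cvgB (cvg_cst (2 * s)) (cvg_mulc (2 * s * m%:R) (cvg_invy Ln_y))) _.
  by rewrite mulr0 subr0.
have s20 : 0 < 2 * s by rewrite mulr_gt0.
have c0 : \forall n \near \oo, 0 < c n by exact: (cvgr_gt _ cc).
pose h n := phi (c n) * expR (c n * ln (n%:R / (n%:R - 1))) * (W (M n) / H (M n))^-1.
exists (fun n => Num.sqrt (h n)); last first.
  rewrite -limitE; apply: (cvg_comp _ (@Num.sqrt R)); last exact: sqrt_continuous.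
  have cq : n%:R / (n%:R - 1) @[n --> \oo] --> (1 : R).
    apply: (@cvg_near _ (fun n => (1 - n%:R^-1)^-1)).
      apply: filterS near3 => n [_ n2]; field.
      by apply/andP; split; rewrite gt_eqF//; lra.
    apply: cvg_to; first by apply: cvgV; last exact: (cvgB (cvg_cst (1 : R)) cvg_invn); rewrite subr0 oner_eq0.
    by rewrite subr0 invr1.
  have c2 := cvg_expRS (cvg_prod cc (cvg_lnS ltr01 cq)).
  have c3 : (W (M n) / H (M n))^-1 @[n --> \oo] --> kappa^-1.
    by apply: cvgV; [rewrite gt_eqF|exact: cvg_kappa].
  have cd : c n + 1 @[n --> \oo] --> 2 * s + 1 by apply: cvgD => //; exact: cvg_cst.
  have ci : (c n + 1)^-1 @[n --> \oo] --> (2 * s + 1)^-1 by apply: cvgV => //; rewrite gt_eqF.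
  have c1 : phi (c n) @[n --> \oo] --> phi (2 * s).
    exact: (cvg_prod (cvg_expRS (cvg_prod cc (cvg_lnS tail0_gt0 (cvg_prod cc ci)))) ci).
  apply: cvg_to (cvg_prod (cvg_prod c1 c2) c3) _.
  by rewrite ln1 mulr0 expR0 mulr1.
apply: filterS2 (near_scaled nM) (filterI c0 near3) => n <- [cn0 [L1 n2]].
have L0 := lt_le_trans ltr01 L1; have n0 : 0 < n%:R :> R by lra.
have nM' : n%:R <= (M n)%:R :> R by rewrite ler_nat.
have M0 : 0 < (M n)%:R :> R := lt_le_trans n0 nM'.
have LM : Ln n <= Ln (M n) by rewrite ler_ln ?posrE.
have W0 : 0 < W (M n) by rewrite W_gt0// -(ltr0n R).
apply: ler_wsqrtr; rewrite scaled_tailE// /h ler_wpM2r//.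
  by rewrite invr_ge0 ltW// divr_gt0// expR_gt0.
pose t := (n%:R - 1) / (M n)%:R : R.
have t01 : 0 < t < 1 by rewrite /t divr_gt0//=; [rewrite ltr_pdivrMr//|]; lra.
have e1 : (M n).+1%:R = (M n)%:R + 1 :> R by rewrite natr1.
have -> : ((M n).+1 - n)%:R / (M n)%:R = 1 - t.
  by rewrite natrB ?leqW// e1 /t; field; rewrite gt_eqF.
have q1 : 0 < n%:R - 1 :> R by lra.
apply: (@le_trans _ _ ((1 - t) * (expR (c n * ln t) * expR (c n * ln (n%:R / (n%:R - 1)))))).
  have /andP[t0 t1] := t01.
  rewrite ler_wpM2l ?subr_ge0 ?(ltW t1)// -expRD ler_expR -mulrDr.
  rewrite -lnM ?posrE ?divr_gt0// (_ : t * _ = n%:R / (M n)%:R); last first.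
    by rewrite /t; field; rewrite !gt_eqF.
  rewrite [ln (n%:R / (M n)%:R)]ln_div ?posrE// -/(Ln n) -/(Ln (M n)).
  have l1 : ln (Ln (M n) / Ln n) <= (Ln (M n) - Ln n) / Ln n.
    have d0 : 0 <= (Ln (M n) - Ln n) / Ln n by rewrite divr_ge0 ?(ltW L0)// subr_ge0.
    rewrite (_ : Ln (M n) / Ln n = 1 + (Ln (M n) - Ln n) / Ln n); last by field; rewrite gt_eqF.
    by apply: le_ln1Dx; lra.
  have sm0 : 0 <= 2 * s * m%:R by rewrite mulr_ge0// ltW.
  have := ler_wpM2l sm0 l1.
  rewrite /c (_ : 2 * s * m%:R * ((Ln (M n) - Ln n) / Ln n) = 2 * s * m%:R * (Ln n)^-1 * (Ln (M n) - Ln n)); last first.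
    by field; rewrite gt_eqF.
  move: (2 * s * m%:R * (Ln n)^-1) => eta; lra.
by rewrite mulrA ler_wpM2r ?expR_ge0//; exact: phi_max.
Qed.

End TailAsymptotics.

(** * The mixed weights and the limits *)

Section MixWeight.
Context {R : realType}.

(** The weight of one coordinate for [s = 1]; at [r = +oo] it is the limit of the
    first formula. *)
Definition mix_factor (r : \bar R) (j : nat) : R :=
  match r with
  | r%:E => (1 + j%:R `^ r) `^ r^-1
  | _ => Num.max 1 j%:R
  end.

Variable r : \bar R.
Hypothesis r_gt0 : (0 < r)%E.

Lemma mix_factor0 : mix_factor r 0 = 1.
Proof.
case: r r_gt0 => [r'| |]//=; last by rewrite max_l.
by rewrite lte_fin => r0; rewrite powR0 ?gt_eqF// addr0 powR1.
Qed.

Lemma mix_factor_ge1 j : 1 <= mix_factor r j.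
Proof.
case: r r_gt0 => [r'| |]//=; last by rewrite le_max lexx.
rewrite lte_fin => r0; rewrite -[leLHS](congr1 (fun f => f r'^-1) (@powR1 R)).
by rewrite ge0_ler_powR ?nnegrE ?invr_ge0 ?(ltW r0) ?addr_ge0 ?powR_ge0// lerDl powR_ge0.
Qed.

Lemma mix_factor_ge j : j%:R <= mix_factor r j.
Proof.
case: r r_gt0 => [r'| |]//=; last by rewrite le_max lexx orbT.
rewrite lte_fin => r0; rewrite -[leLHS]powRr1// -[X in _ `^ X](@mulfV _ r') ?gt_eqF// powRrM.
by rewrite ge0_ler_powR ?nnegrE ?invr_ge0 ?(ltW r0) ?addr_ge0 ?powR_ge0// lerDr.
Qed.

(** For large [j], the summand 1 is a small fraction of [j ^ r]: the bound holds
    once [((1 + eps) ^ r - 1) * j ^ r >= 1]. *)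
Lemma mix_factor_asym eps : 0 < eps ->
  exists J, forall j, (J <= j)%N -> mix_factor r j <= (1 + eps) * j%:R.
Proof.
move=> e0; case: r r_gt0 => [r'| |]//=; last first.
  move=> _; exists 1%N => j j1; have j1' : 1 <= j%:R :> R by rewrite ler1n.
  by rewrite max_r// ler_peMl// lerDl ltW.
rewrite lte_fin => r0; pose dl := (1 + eps) `^ r' - 1.
have e1 : 0 <= 1 + eps by rewrite addr_ge0// ltW.
have d0 : 0 < dl.
  by rewrite subr_gt0 -[ltLHS](congr1 (fun f => f r') (@powR1 R)) gt0_ltr_powR ?nnegrE// ltrDl.
pose J := (Num.truncn (dl^-1 `^ r'^-1)).+1.
exists J => j Jj; have jb : dl^-1 `^ r'^-1 <= j%:R.
  have /andP[_ h] := truncn_itv (powR_ge0 dl^-1 r'^-1).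
  by apply: le_trans (ltW h) _; rewrite ler_nat.
have jr : 1 <= dl * j%:R `^ r'.
  rewrite -ler_pdivrMl// mulr1 -[leLHS]powRr1 ?invr_ge0 ?(ltW d0)//.
  rewrite -[X in _ `^ X <= _](@mulVf _ r') ?gt_eqF// powRrM.
  by rewrite ge0_ler_powR ?nnegrE ?powR_ge0 ?(ltW r0).
have le1 : 1 + j%:R `^ r' <= ((1 + eps) * j%:R) `^ r'.
  rewrite powRM//; move: jr; rewrite /dl mulrBl mul1r lerBrDr.
  by rewrite addrC.
apply: (@le_trans _ _ ((((1 + eps) * j%:R) `^ r') `^ r'^-1)).
  by rewrite ge0_ler_powR ?nnegrE ?invr_ge0 ?(ltW r0) ?addr_ge0 ?powR_ge0.
by rewrite -powRrM mulfV ?gt_eqF// powRr1// mulr_ge0.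
Qed.

Lemma powR_prod (I : finType) (f : I -> R) (s : R) : (forall i, 0 <= f i) ->
  (\prod_i f i) `^ s = \prod_i f i `^ s.
Proof.
move=> f0; suff [] : 0 <= \prod_i f i /\ (\prod_i f i) `^ s = \prod_i f i `^ s by [].
apply: (big_rec2 (fun x y : R => 0 <= x /\ x `^ s = y)); first by rewrite powR1.
by move=> i x y _ [x0 <-]; rewrite powRM// mulr_ge0.
Qed.

Lemma mix_weightE d (s : R) (k : d.-tuple int) :
  mix_weight s r k = mixed_prod (mix_factor r) k `^ s.
Proof.
have nE i : `|(tnth k i)%:~R| = `|tnth k i|%N%:R :> R by rewrite -intr_norm natr_absz.
rewrite /mixed_prod powR_prod; last by move=> i; exact: le_trans (mix_factor_ge1 _).
rewrite /mix_weight /mix_factor; case: r r_gt0 => [r'| |]//= _.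
  by apply: eq_bigr => i _; rewrite nE -powRrM mulrC.
by apply: eq_bigr => i _; rewrite nE.
Qed.

End MixWeight.

Section FinalLimits.
Context {R : realType}.

Lemma cvg_EFin_div (u : nat -> \bar R) (f c : nat -> R) (L : R) :
    (\forall n \near \oo, 0 < c n) -> (\forall n \near \oo, u n = (f n)%:E) ->
    f n / c n @[n --> \oo] --> L ->
  (u n / (c n)%:E)%E @[n --> \oo] --> L%:E.
Proof.
move=> c0 uf fL; have : (f n / c n)%:E @[n --> \oo] --> L%:E.
  by apply: cvg_EFin => //; exact: nearW.
apply: cvg_trans; apply: near_eq_cvg; apply: filterS2 c0 uf => n c0 ->.
by rewrite inver gt_eqF.
Qed.

Lemma squeeze_EFin_div (u : nat -> \bar R) (lo hi h c : nat -> R) (L : R) :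
    (\forall n \near \oo, 0 < c n) ->
    (\forall n \near \oo, ((lo n)%:E <= u n <= (hi n)%:E)%E) ->
    lo n / c n @[n --> \oo] --> L ->
    (\forall n \near \oo, hi n / c n <= h n) -> h n @[n --> \oo] --> L ->
  (u n / (c n)%:E)%E @[n --> \oo] --> L%:E.
Proof.
move=> c0 lu loL hih hL; apply: (@cvg_EFin_div _ (fine \o u)) => //.
  apply: filterS lu => n /andP[l h1] /=.
  by rewrite fineK// fin_numE -ltNye -ltey (lt_le_trans _ l) ?ltNyr// (le_lt_trans h1) ?ltry.
apply: (@squeeze_cvgr _ _ _ _ (fun n => lo n / c n) h) => //.
apply: filterS2 (filterI c0 lu) hih => n [c0n /andP[l h1]] hn /=.
have fu : (fine (u n))%:E = u n.
  by rewrite fineK// fin_numE -ltNye -ltey (lt_le_trans _ l) ?ltNyr// (le_lt_trans h1) ?ltry.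
rewrite ler_pM2r ?invr_gt0// -lee_fin fu l/=; apply: le_trans hn.
by rewrite ler_pM2r ?invr_gt0// -lee_fin fu.
Qed.

Lemma near_scale_gt0 (a b : R) : \forall n \near \oo, 0 < n%:R `^ a * ln n%:R `^ b :> R.
Proof.
exists 2%N => // n /= n2; rewrite mulr_gt0 ?powR_gt0//.
  by rewrite ltr0n (leq_trans _ n2).
by apply: ln_gt0; rewrite ltr1n.
Qed.

End FinalLimits.

Theorem theorem4p6 (R : realType) (d : nat) (s : R) (r : \bar R)
    (d_gt0 : (0 < d)%N) (s_gt0 : 0 < s) (r_gt0 : (0 < r)%E) :
  (forall v : nat -> \bar R,
     v = bernstein_number (Amix_norm s r) (@L2_norm R d) idfun \/
     v = weyl_number (Amix_norm s r) (@L2_norm R d) idfun ->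
     (v n / (n%:R `^ (- s - 2^-1) * ln n%:R `^ (s * d.-1%:R))%:E)%E
       @[n --> \oo] -->
     (Num.sqrt (2 * s + 1) * (2 ^+ d / (d.-1)`!%:R) `^ s)%:E) /\
  (forall u : nat -> \bar R,
     u = approximation_number (Amix_norm s r) (@L2_norm R d) idfun \/
     u = kolmogorov_number (Amix_norm s r) (@L2_norm R d) idfun ->
     (u n / (n%:R `^ (- s) * ln n%:R `^ (s * d.-1%:R))%:E)%E
       @[n --> \oo] -->
     ((2 * s / (2 * s + 1)) `^ s * (2 ^+ d / (d.-1)`!%:R) `^ s)%:E).
Proof.
case: d d_gt0 => // m _; rewrite [m.+1.-1]/=.
pose p := mix_factor r.
have p0 := mix_factor0 r_gt0; have p1 := mix_factor_ge1 r_gt0.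
have pj := mix_factor_ge r_gt0; have pa := mix_factor_asym r_gt0.
pose K : eqType := m.+1.-tuple int.
have Kinf (l : seq K) : exists k, k \notin l.
  apply: contrapT => nk; have inl k : k \in l by apply/negPn/negP => kl; apply: nk; exists k.
  pose f (n : nat) : K := [tuple n%:Z | i < m.+1].
  have fi : injective f.
    by move=> i j /(congr1 (fun t => tnth t ord0)); rewrite !tnth_mktuple => -[].
  have : (size [seq f n | n <- iota 0 (size l).+1] <= size l)%N.
    by apply: uniq_leq_size => //; rewrite map_inj_uniq ?iota_uniq.
  by rewrite size_map size_iota ltnn.
have [kk [kk_bij kk_homo kk_cnt]] := sorted_enumeration
  (mem_cross p1 pj (d := m.+1)) (uniq_cross p m.+1) Kinf.
pose q n := mixed_prod p (kk n).
have q1 n : 1 <= q n by exact: mixed_prod_ge1.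
pose A : R := 2 ^+ m.+1 / m`!%:R.
have A0 : 0 < A by rewrite divr_gt0 ?exprn_gt0// ltr0n fact_gt0.
have [cle cge] := cross_count_asym p0 p1 pj pa m.
have wE : (fun j => mix_weight s r (kk j)) = (fun j => q j `^ s).
  by apply/funext => j; rewrite mix_weightE.
have w1 (k : m.+1.-tuple int) : 1 <= mix_weight s r k.
  rewrite mix_weightE// -[leLHS](congr1 (fun f => f s) (@powR1 R)).
  by rewrite ge0_ler_powR ?nnegrE ?(ltW s_gt0)// ?mixed_prod_ge1// (le_trans ler01)// mixed_prod_ge1.
have wm : {homo (fun j => mix_weight s r (kk j)) : i j / (i <= j)%N >-> i <= j}.
  rewrite wE => i j ij; rewrite ge0_ler_powR ?nnegrE ?(ltW s_gt0) ?(le_trans ler01)//.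
  exact: kk_homo.
have wu M : exists j, M <= mix_weight s r (kk j).
  have /cvgryPge/(_ (`|M| `^ s^-1))[N _ /(_ N (leqnn N)) hN] :=
    sorted_unbounded (q := q) (fun n T => kk_cnt n T).
  exists N; rewrite mix_weightE//; apply: le_trans (ler_norm M) _.
  rewrite -[leLHS]powRr1// -[X in _ `^ X <= _](@mulVf _ s) ?gt_eqF// powRrM.
  by rewrite ge0_ler_powR ?nnegrE ?powR_ge0 ?(ltW s_gt0)//; exact: le_trans ler01 (q1 N).
have sys := wiener_system kk_bij w1 wm wu.
pose w j := mix_weight s r (kk j).
have W0 n : (0 < n)%N -> 0 < wsum w n by exact: (wsum_gt0 sys).
have cW : wsum w n / growth s m n @[n --> \oo] --> expR (- (2 * s) * ln A) / (2 * s + 1).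
  by rewrite /w wE; exact: (cvg_wsum q1 (fun n T => kk_cnt n T) A0 s_gt0 cle cge).
have pos : \forall n \near \oo, (0 < n)%N by exists 1%N.
split=> [v hv|u hu].
  apply: (@cvg_EFin_div _ _ (fun n => (Num.sqrt (wsum w n))^-1)).
  - exact: near_scale_gt0.
  - apply: filterS pos => n n0; apply/eqP; rewrite eq_le; case: hv => ->.
      by rewrite (bernstein_le sys)// (bernstein_ge sys).
    by rewrite (weyl_le sys)// (weyl_ge sys).
  - exact: (cvg_inv_sqrt_wsum A0 s_gt0 W0 cW).
have [Ml nMl cl] := tail_ratio_lower A0 s_gt0 W0 cW.
have hi n : exists M, (n <= M)%N /\ ((0 < n)%N -> (u n <= (Num.sqrt (tail_ratio w n M))%:E)%E).
  case: (posnP n) => [->|n0]; first by exists 0%N.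
  case: hu => ->.
    by have [M ? ?] := approximation_le sys n0; exists M.
  by have [M ? ?] := kolmogorov_le sys n0; exists M.
have {hi}[Mh hMh] := choice hi.
have nMh n : (n <= Mh n)%N by have [] := hMh n.
have [h hh ch] := tail_ratio_upper A0 s_gt0 W0 cW nMh.
apply: (@squeeze_EFin_div _ u _ (fun n => Num.sqrt (tail_ratio w n (Mh n))) h _ _ _ _ cl) => //.
- exact: near_scale_gt0.
- apply: filterS pos => n n0; have [_ ->] := hMh n; rewrite ?andbT//.
  case: hu => ->; first exact: (approximation_ge sys).
  by apply: (kolmogorov_ge sys); rewrite n0 nMl.
Qed.
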